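(* Let $G$ be a smooth real function on $(0,x_0)$, where $x_0=\sqrt[5]{\frac{-11+5\sqrt5}{2}}$, and let $m_G$ be defined implicitly by $$x=\pi\int_{\sqrt{m_G(x)}}^{+\infty}\eta(it/2)^4\,G\!\left(R(e^{-\pi t})\right)dt .$$ If $y\in(0,x_0)$ and $A$ satisfy $$5\int_0^{y}\frac{G(t)}{t\sqrt[6]{t^{-5}-11-t^5}}\,dt=A,$$ then $y=R\!\left(e^{-\pi\sqrt{m_G(A)}}\right)$.
   Context: $\eta(\tau)=e^{\pi i\tau/12}\prod_{n\ge1}(1-e^{2\pi i n\tau})$ is the Dedekind eta function ($\operatorname{Im}\tau>0$). For $0<q<1$, $R(q)=\cfrac{q^{1/5}}{1+\cfrac{q}{1+\cfrac{q^2}{1+\cdots}}}$ is the Rogers–Ramanujan continued fraction; it maps $(0,1)$ increasingly onto $(0,x_0)$. The function $m_G$ is the inverse of $r\mapsto m_G^{(-1)}(r):=\pi\int_{\sqrt r}^{\infty}\eta(it/2)^4G(R(e^{-\pi t}))\,dt$, $r>0$. *)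

(* Defs.v *)
From Stdlib Require Import Reals.
From Coquelicot Require Import Coquelicot.
Open Scope R_scope.

Fixpoint eta_pprod (s : R) (N : nat) : R :=
  match N with
  | O => 1
  | S M => eta_pprod s M * (1 - exp (- 2 * PI * INR (S M) * s))
  end.

(* eta(i s) for real s > 0:  e^{pi i (i s)/12} prod_{n>=1} (1 - e^{2 pi i n (i s)}) *)
Definition eta_i (s : R) : R :=
  exp (- PI * s / 12) * real (Lim_seq (fun N => eta_pprod s N)).

Fixpoint cf_tail (q : R) (n k : nat) : R :=
  match n with
  | O => 1
  | S m => 1 + q ^ k / cf_tail q m (S k)
  end.

Definition RR (q : R) : R :=
  real (Lim_seq (fun N => Rpower q (1/5) / cf_tail q N 1)).

Definition x0 : R := Rpower ((-11 + 5 * sqrt 5) / 2) (1/5).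

Definition smooth_on (a b : R) (G : R -> R) : Prop :=
  forall (n : nat) (x : R), a < x < b -> ex_derive_n G n x.

Definition mG_integrand (G : R -> R) (t : R) : R :=
  PI * (eta_i (t / 2) ^ 4 * G (RR (exp (- PI * t)))).

Definition is_mG (G : R -> R) (m : R -> R) : Prop :=
  (forall r, 0 < r ->
     ex_RInt_gen (mG_integrand G) (at_point (sqrt r)) (Rbar_locally p_infty)) /\
  (forall x r, 0 < r ->
     (m x = r <->
      is_RInt_gen (mG_integrand G) (at_point (sqrt r)) (Rbar_locally p_infty) x)).

(* Main.v *)
(** With q = e^{-tau}, write g1, g2 for the theta series sum (-1)^k q^{(5k^2+3k)/2} and
    sum (-1)^k q^{(5k^2+k)/2}, and phi(tau) for prod (1 - q^n).  Schur's polynomial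
    identities evaluate the numerators and denominators of the convergents, so that
    R(q) = q^{1/5} g1/g2, and everything rests on two classical identities of Ramanujan:
      1/R^5 - 11 - R^5 = e^tau phi(tau)^6 / phi(5 tau)^6   and
      dR/dtau = - (1/5) R phi(tau)^5 / phi(5 tau).
    For the first, the triple product at a fifth root of unity, dissected modulo 5, factors
    g2 - alpha q^{1/5} g1 for the golden ratio alpha and its conjugate; multiply over the
    five fifth roots of q.  For the second, the Wronskian of g1 and g2 is a double sum over a
    sublattice of Z^2; rotations of the Gaussian integers identify it with a quarter of the
    sum over Z^2, which is phi^6 by Jacobi's formula for phi^3.
    The two identities make t = R(e^{-pi s}) transform one integrand into the other, and the
    first one forces R to tend to x0 as q tends to 1, hence R is onto (0, x0). *)
Require Import Defs.
From Stdlib Require Import Reals Ranalysis5 Lra Lia ZArith List Permutation Classical ClassicalEpsilon.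
From Coquelicot Require Import Coquelicot.
Import ListNotations.
Open Scope R_scope.

(** * Unconditional sums *)

(** The triple product and Schur's evaluation are limits of finite identities in Gaussian binomials,
    and a single bound on these, uniform in both indices, dominates both passages to the limit. The
    nome has to be complex because all five fifth roots of q occur. The variable w of the triple
    product is encoded by a real sequence d with d (k+1) + d (k-1) = c d k in place of w^k, so that
    w = 1, real w and roots of unity are covered by one induction. Sums are limits along finite sets
    of indices, because the argument lives on bijections of Z and Z^2 (shifts, residue classes,
    Gaussian rotations) that preserve no enumeration. The limit of R at q = 1 comes from comparing
    phi(tau) and phi(5 tau) factor by factor: arbitrarily many factors of their quotient drop below
    1/2 as tau tends to 0. The weights of the two integrals match because the sixth root of 1/R^5 -
    11 - R^5 is e^{tau/6} phi(tau) / phi(5 tau); dividing phi(tau)^5 / phi(5 tau) by it leaves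
    e^{-tau/6} phi(tau)^4, which is eta(it/2)^4 at tau = pi t. *)

Definition lsum {T : Type} (f : T -> R) (l : list T) : R :=
  fold_right (fun x s => f x + s) 0 l.

Lemma lsum_app {T} (f : T -> R) l l' : lsum f (l ++ l') = lsum f l + lsum f l'.
Proof. induction l as [|a l IH]; simpl; [ring|rewrite IH; ring]. Qed.

Lemma lsum_perm {T} (f : T -> R) l l' : Permutation l l' -> lsum f l = lsum f l'.
Proof. induction 1; simpl; lra. Qed.

Lemma lsum_ext_in {T} (f g : T -> R) l :
  (forall x, In x l -> f x = g x) -> lsum f l = lsum g l.
Proof.
  induction l as [|a l IH]; simpl; intros H; [reflexivity|].
  rewrite (H a), IH; auto.
Qed.

Lemma lsum_map {T U} (f : U -> R) (e : T -> U) l :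
  lsum f (map e l) = lsum (fun x => f (e x)) l.
Proof. induction l as [|a l IH]; simpl; [reflexivity|now rewrite IH]. Qed.

Lemma lsum_plus {T} (f g : T -> R) l :
  lsum (fun x => f x + g x) l = lsum f l + lsum g l.
Proof. induction l as [|a l IH]; simpl; [ring|rewrite IH; ring]. Qed.

Lemma lsum_scal {T} c (f : T -> R) l : lsum (fun x => c * f x) l = c * lsum f l.
Proof. induction l as [|a l IH]; simpl; [ring|rewrite IH; ring]. Qed.

Lemma lsum_le {T} (f g : T -> R) l : (forall x, f x <= g x) -> lsum f l <= lsum g l.
Proof.
  intros H; induction l as [|a l IH]; simpl; [lra|specialize (H a); lra].
Qed.

Lemma lsum_nonneg {T} (f : T -> R) l : (forall x, 0 <= f x) -> 0 <= lsum f l.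
Proof.
  intros H; induction l as [|a l IH]; simpl; [lra|specialize (H a); lra].
Qed.

Lemma lsum_abs {T} (f : T -> R) l : Rabs (lsum f l) <= lsum (fun x => Rabs (f x)) l.
Proof.
  induction l as [|a l IH]; simpl; [rewrite Rabs_R0; lra|].
  eapply Rle_trans; [apply Rabs_triang|lra].
Qed.

Lemma lsum_zero {T} (f : T -> R) l : (forall x, In x l -> f x = 0) -> lsum f l = 0.
Proof.
  induction l as [|a l IH]; simpl; intros H; [reflexivity|].
  rewrite (H a), IH; auto; lra.
Qed.

Lemma lsum_prod {T U} (f : T -> R) (g : U -> R) l l' :
  lsum (fun p => f (fst p) * g (snd p)) (list_prod l l') = lsum f l * lsum g l'.
Proof.
  induction l as [|a l IH]; simpl; [ring|].
  rewrite lsum_app, IH, lsum_map; simpl. rewrite lsum_scal; ring.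
Qed.

(** Duplicate-free lists stand for finite sets; this is the complement of a subset, and it splits
    any permutation-invariant sum. *)
Lemma incl_perm_app {T} (l0 l : list T) :
  NoDup l0 -> NoDup l -> incl l0 l -> exists l', Permutation l (l0 ++ l').
Proof.
  revert l; induction l0 as [|a l0 IH]; intros l H0 H Hi.
  - exists l; apply Permutation_refl.
  - destruct (in_split a l) as [l1 [l2 E]]; [apply Hi; now left|].
    assert (P : Permutation l (a :: l1 ++ l2)).
    { rewrite E. apply Permutation_sym, Permutation_middle. }
    pose proof (Permutation_NoDup P H) as H'.
    inversion H'; subst. inversion H0; subst.
    destruct (IH (l1 ++ l2)) as [l' P']; auto.
    + intros x Hx. assert (Hx' : In x (l1 ++ a :: l2)) by (apply Hi; now right).
      apply (Permutation_in _ P) in Hx'. destruct Hx' as [->|]; [contradiction|assumption].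
    + exists l'. eapply Permutation_trans; [exact P|]. simpl. now constructor.
Qed.

(** Index types are arbitrary, so [nodup] receives its equality test from classical logic. *)
Definition eq_dec_classic {T : Type} (x y : T) : {x = y} + {x <> y} :=
  excluded_middle_informative (x = y).

(** The filter of the finite subsets of [T] directed by inclusion. Convergence along it is
    unconditional summation, hence invariant under bijections of the index type. *)
Definition fin_filter (T : Type) (P : list T -> Prop) : Prop :=
  exists l0, forall l, NoDup l -> incl l0 l -> P l.

Global Instance fin_filter_proper (T : Type) : ProperFilter (fin_filter T).
Proof.
  constructor.
  - intros P [l0 H]. exists (nodup eq_dec_classic l0). apply H.
    + apply NoDup_nodup.
    + intros x Hx. now apply nodup_In.
  - constructor.
    + exists nil; auto.
    + intros P Q [l1 H1] [l2 H2]. exists (l1 ++ l2). intros l Hl Hi.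
      split; [apply H1|apply H2]; auto; intros x Hx; apply Hi, in_or_app; auto.
    + intros P Q HPQ [l0 H]. exists l0; auto.
Qed.

Definition has_sum {T : Type} (f : T -> R) (s : R) : Prop :=
  filterlim (lsum f) (fin_filter T) (locally s).

Definition summable {T : Type} (f : T -> R) : Prop :=
  exists M, forall l, NoDup l -> lsum (fun x => Rabs (f x)) l <= M.

Lemma has_sum_unique {T} (f : T -> R) s s' : has_sum f s -> has_sum f s' -> s = s'.
Proof. intros H H'. exact (filterlim_locally_unique _ _ _ H H'). Qed.

Lemma has_sum_eps {T} (f : T -> R) s :
  has_sum f s <->
  forall eps, 0 < eps -> fin_filter T (fun l => Rabs (lsum f l - s) < eps).
Proof.
  split.
  - intros H eps He. apply (proj1 (filterlim_locally _ _) H (mkposreal eps He)).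
  - intros H. apply filterlim_locally. intros eps. apply (H eps), cond_pos.
Qed.

Lemma has_sum_ext {T} (f g : T -> R) s : (forall x, f x = g x) -> has_sum f s -> has_sum g s.
Proof.
  intros E. apply filterlim_ext. intros l. apply lsum_ext_in; auto.
Qed.

Lemma has_sum_plus {T} (f g : T -> R) s s' :
  has_sum f s -> has_sum g s' -> has_sum (fun x => f x + g x) (s + s').
Proof.
  intros H H'.
  apply (filterlim_ext (fun l => plus (lsum f l) (lsum g l))).
  { intros l. now rewrite lsum_plus. }
  eapply filterlim_comp_2; [exact H|exact H'|].
  exact (filterlim_plus s s').
Qed.

Lemma has_sum_scal {T} c (f : T -> R) s : has_sum f s -> has_sum (fun x => c * f x) (c * s).
Proof.
  intros H.
  apply (filterlim_ext (fun l => scal c (lsum f l))).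
  { intros l. now rewrite lsum_scal. }
  eapply filterlim_comp; [exact H|].
  exact (filterlim_scal_r c s).
Qed.

Lemma has_sum_minus {T} (f g : T -> R) s s' :
  has_sum f s -> has_sum g s' -> has_sum (fun x => f x - g x) (s - s').
Proof.
  intros H H'. replace (s - s') with (s + (-1) * s') by ring.
  apply (has_sum_ext (fun x => f x + (-1) * g x)); [intros; ring|].
  apply has_sum_plus; [|apply has_sum_scal]; assumption.
Qed.

Lemma has_sum_finite {T} (f : T -> R) l0 :
  NoDup l0 -> (forall x, ~ In x l0 -> f x = 0) -> has_sum f (lsum f l0).
Proof.
  intros N0 H. apply has_sum_eps. intros eps He.
  exists l0. intros l Hl Hi.
  destruct (incl_perm_app l0 l N0 Hl Hi) as [l' P].
  rewrite (lsum_perm _ _ _ P), lsum_app, (lsum_zero f l').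
  - replace (_ - _) with 0 by ring. now rewrite Rabs_R0.
  - intros x Hx. apply H. intros Hx0.
    pose proof (Permutation_NoDup P Hl) as N.
    revert N Hx0; clear -Hx. induction l0 as [|a l0 IH]; simpl; [tauto|].
    intros N [->|E]; inversion N; subst; auto. apply H1, in_or_app; auto.
Qed.

Lemma has_sum_reindex {T U} (e : T -> U) (f : U -> R) s :
  (forall x y, e x = e y -> x = y) ->
  (forall u, (forall x, e x <> u) -> f u = 0) ->
  has_sum (fun x => f (e x)) s -> has_sum f s.
Proof.
  intros inj supp H. apply has_sum_eps. intros eps He.
  destruct (proj1 (has_sum_eps _ _) H eps He) as [l0 H0].
  exists (map e l0). intros l Hl Hi.
  (* A finite set in [U] is traded for the preimages of its members in the image of [e]; the other
     members contribute 0. *)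
  assert (D : forall l, NoDup l -> exists l1, NoDup l1 /\ lsum f l = lsum (fun x => f (e x)) l1
     /\ (forall x, In (e x) l <-> In x l1)).
  { clear -inj supp. induction l as [|u l IH]; intros N.
    - exists nil; repeat split; auto; try constructor; simpl; tauto.
    - inversion N; subst. destruct (IH H2) as [l1 [N1 [S1 I1]]].
      destruct (classic (exists x, e x = u)) as [[x Ex]|Hn].
      + exists (x :: l1). split; [|split].
        * constructor; auto. intros Hx. apply H1. rewrite <- Ex. now apply I1.
        * simpl. rewrite S1, Ex. reflexivity.
        * intros y; simpl; split.
          { intros [E|E]; [left; apply inj; congruence|right; now apply I1]. }
          { intros [E|E]; [left; congruence|right; now apply I1]. }
      + exists l1. split; [|split]; auto.
        * simpl. rewrite S1, (supp u); [ring|]. intros x Ex; apply Hn; eauto.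
        * intros y; simpl; rewrite <- I1; split; auto.
          intros [E|E]; auto. exfalso; apply Hn; exists y; auto. }
  destruct (D l Hl) as [l1 [N1 [S1 I1]]]. rewrite S1. apply H0; auto.
  intros x Hx. apply I1, Hi, in_map, Hx.
Qed.

Lemma has_sum_bij {T U} (e : T -> U) (d : U -> T) (f : U -> R) s :
  (forall x, d (e x) = x) -> (forall u, e (d u) = u) ->
  has_sum (fun x => f (e x)) s -> has_sum f s.
Proof.
  intros de ed. apply has_sum_reindex.
  - intros x y E. rewrite <- (de x), <- (de y). now f_equal.
  - intros u H. now destruct (H (d u)).
Qed.

(** * Absolute summability, dominated convergence and products of sums *)

Lemma summable_tail {T} (f : T -> R) eps :
  summable f -> 0 < eps ->
  exists l0, NoDup l0 /\ forall l', NoDup (l0 ++ l') -> lsum (fun x => Rabs (f x)) l' <= eps.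
Proof.
  intros [M HM] He.
  pose (E := fun r => exists l, NoDup l /\ r = lsum (fun x => Rabs (f x)) l).
  destruct (completeness E) as [s [U L]].
  - exists M. intros r [l [N ->]]. auto.
  - exists 0. exists nil. split; [constructor|reflexivity].
  (* A finite set whose absolute sum comes within eps of the supremum leaves at most eps to any
     disjoint set. *)
  - destruct (classic (exists l0, NoDup l0 /\ s - eps < lsum (fun x => Rabs (f x)) l0))
      as [[l0 [N0 H0]]|Hn].
    + exists l0. split; auto. intros l' N.
      assert (lsum (fun x => Rabs (f x)) (l0 ++ l') <= s) by (apply U; exists (l0 ++ l'); auto).
      rewrite lsum_app in H. lra.
    + assert (s <= s - eps); [|lra]. apply L. intros r [l [N ->]].
      apply Rnot_lt_le. intros H. apply Hn; eauto.
Qed.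

Lemma summable_le {T} (f g : T -> R) :
  (forall x, Rabs (f x) <= g x) -> summable g -> summable f.
Proof.
  intros H [M HM]. exists M. intros l N. eapply Rle_trans; [|apply (HM l N)].
  apply lsum_le. intros x. eapply Rle_trans; [apply H|apply Rle_abs].
Qed.

Lemma summable_plus {T} (f g : T -> R) :
  summable f -> summable g -> summable (fun x => f x + g x).
Proof.
  intros [M HM] [M' HM']. exists (M + M'). intros l N.
  eapply Rle_trans; [apply lsum_le; intros x; apply Rabs_triang|].
  rewrite lsum_plus. specialize (HM l N). specialize (HM' l N). lra.
Qed.

Lemma summable_scal {T} c (f : T -> R) : summable f -> summable (fun x => c * f x).
Proof.
  intros [M HM]. exists (Rabs c * M). intros l N.
  rewrite (lsum_ext_in _ (fun x => Rabs c * Rabs (f x))) by (intros; apply Rabs_mult).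
  rewrite lsum_scal. apply Rmult_le_compat_l; [apply Rabs_pos|auto].
Qed.

Lemma summable_ext {T} (f g : T -> R) : (forall x, f x = g x) -> summable f -> summable g.
Proof.
  intros E [M HM]. exists M. intros l N. eapply Rle_trans; [|apply (HM l N)].
  apply Req_le, lsum_ext_in. intros; now rewrite E.
Qed.

Lemma lsum_tail_bound {T} (f : T -> R) l0 eps :
  NoDup l0 ->
  (forall l', NoDup (l0 ++ l') -> lsum (fun x => Rabs (f x)) l' <= eps) ->
  forall l, NoDup l -> incl l0 l -> Rabs (lsum f l - lsum f l0) <= eps.
Proof.
  intros N0 H l N I. destruct (incl_perm_app l0 l N0 N I) as [l' P].
  rewrite (lsum_perm _ _ _ P), lsum_app.
  replace (_ - _) with (lsum f l') by ring.
  eapply Rle_trans; [apply lsum_abs|]. apply H. exact (Permutation_NoDup P N).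
Qed.

Lemma summable_has_sum {T} (f : T -> R) : summable f -> exists s, has_sum f s.
Proof.
  intros Hf. apply (proj1 (filterlim_locally_cauchy (F := fin_filter T) (lsum f))). intros eps.
  assert (He : 0 < eps / 3) by (destruct eps; simpl; lra).
  destruct (summable_tail f _ Hf He) as [l0 [N0 H0]].
  exists (fun l => Rabs (lsum f l - lsum f l0) <= eps / 3). split.
  - exists l0. apply lsum_tail_bound; auto.
  - intros u v Hu Hv. change (Rabs (lsum f v - lsum f u) < eps).
    replace (_ - _) with ((lsum f v - lsum f l0) - (lsum f u - lsum f l0)) by ring.
    eapply Rle_lt_trans; [apply Rabs_triang|]. rewrite Rabs_Ropp.
    destruct eps; simpl in *; lra.
Qed.

Lemma has_sum_close {T} (f : T -> R) s r M :
  has_sum f s -> fin_filter T (fun l => Rabs (lsum f l - r) <= M) -> Rabs (s - r) <= M.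
Proof.
  intros H B. apply Rnot_lt_le. intros L.
  destruct (filter_ex _ (filter_and _ _ B
     (proj1 (has_sum_eps _ _) H (Rabs (s - r) - M) ltac:(lra)))) as [l [H1 H2]].
  assert (Rabs (s - r) <= Rabs (lsum f l - r) + Rabs (lsum f l - s)); [|lra].
  replace (s - r) with ((lsum f l - r) - (lsum f l - s)) by ring.
  eapply Rle_trans; [apply Rabs_triang|]. rewrite Rabs_Ropp; lra.
Qed.

Lemma has_sum_bound {T} (f : T -> R) s M :
  has_sum f s -> (forall l, NoDup l -> lsum (fun x => Rabs (f x)) l <= M) -> Rabs s <= M.
Proof.
  intros H B. replace s with (s - 0) by ring. apply (has_sum_close f); auto.
  exists nil. intros l N _. replace (_ - 0) with (lsum f l) by ring.
  eapply Rle_trans; [apply lsum_abs|auto].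
Qed.

Lemma is_lim_seq_lsum {T} (f : nat -> T -> R) (g : T -> R) l :
  (forall x, is_lim_seq (fun N => f N x) (g x)) ->
  is_lim_seq (fun N => lsum (f N) l) (lsum g l).
Proof.
  intros H. induction l as [|a l IH]; simpl; [apply is_lim_seq_const|].
  now apply is_lim_seq_plus'.
Qed.

(** Dominated convergence for sums: outside a finite set chosen for [M], the sums of [f N] and of
    [g] are both at most eps/4, and on the finite set convergence is termwise. The conclusion
    includes the existence of both limits. *)
Lemma tannery {T} (f : nat -> T -> R) (g M : T -> R) (S : nat -> R) :
  summable M -> (forall N x, Rabs (f N x) <= M x) ->
  (forall x, is_lim_seq (fun N => f N x) (g x)) ->
  (forall N, has_sum (f N) (S N)) ->
  exists s, has_sum g s /\ is_lim_seq S s.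
Proof.
  intros HM B L HS.
  assert (Bg : forall x, Rabs (g x) <= M x).
  { intros x. apply (is_lim_seq_le (fun N => Rabs (f N x)) (fun _ => M x) (Rabs (g x)) (M x)).
    - intros; apply B.
    - apply (is_lim_seq_abs _ (g x)), L.
    - apply is_lim_seq_const. }
  destruct (summable_has_sum g) as [s Hs]; [now apply summable_le with M|].
  exists s. split; auto. apply is_lim_seq_spec. intros eps.
  assert (He : 0 < eps / 4) by (destruct eps; simpl; lra).
  destruct (summable_tail M _ HM He) as [l0 [N0 H0]].
  assert (C : forall h t, (forall x, Rabs (h x) <= M x) -> has_sum h t ->
     Rabs (t - lsum h l0) <= eps / 4).
  { intros h t Bh Ht. apply (has_sum_close h); auto. exists l0.
    apply lsum_tail_bound; auto. intros l' Nl.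
    eapply Rle_trans; [|apply (H0 l' Nl)]. apply lsum_le. intros x.
    eapply Rle_trans; [apply Bh|apply Rle_abs]. }
  pose proof (is_lim_seq_lsum f g l0 L) as L0. apply is_lim_seq_spec in L0.
  destruct (L0 (mkposreal _ He)) as [N1 H1].
  exists N1. intros n Hn. specialize (H1 n Hn). simpl in H1.
  pose proof (C g s Bg Hs) as C1. pose proof (C (f n) (S n) (B n) (HS n)) as C2.
  replace (S n - s) with
    ((S n - lsum (f n) l0) + (lsum (f n) l0 - lsum g l0) + - (s - lsum g l0)) by ring.
  eapply Rle_lt_trans; [apply Rabs_triang|].
  rewrite Rabs_Ropp.
  eapply Rle_lt_trans; [apply Rplus_le_compat_r, Rabs_triang|].
  destruct eps; simpl in *; lra.
Qed.

Lemma lsum_incl_le {T} (f : T -> R) l l' :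
  (forall x, 0 <= f x) -> NoDup l -> NoDup l' -> incl l l' -> lsum f l <= lsum f l'.
Proof.
  intros P N N' I. destruct (incl_perm_app l l' N N' I) as [l1 Pm].
  rewrite (lsum_perm _ _ _ Pm), lsum_app. pose proof (lsum_nonneg f l1 P); lra.
Qed.

Lemma NoDup_list_prod {T U} (l : list T) (l' : list U) :
  NoDup l -> NoDup l' -> NoDup (list_prod l l').
Proof.
  intros N N'. induction N as [|a l Ha N IH]; simpl; [constructor|].
  apply NoDup_app; auto.
  - apply NoDup_map_NoDup_ForallPairs; auto. intros x y _ _ E. congruence.
  - intros [x y] Hx Hy. apply in_map_iff in Hx. destruct Hx as [z [E _]].
    apply in_prod_iff in Hy. inversion E; subst. tauto.
Qed.

(** A finite set of pairs lies in the rectangle of its two projections, where the absolute sum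
    factors. *)
Lemma summable_prod {T U} (f : T -> R) (g : U -> R) :
  summable f -> summable g -> summable (fun p => f (fst p) * g (snd p)).
Proof.
  intros [M HM] [M' HM']. exists (M * M'). intros l N.
  set (l1 := nodup eq_dec_classic (map fst l)).
  set (l2 := nodup eq_dec_classic (map snd l)).
  assert (N1 : NoDup l1) by apply NoDup_nodup.
  assert (N2 : NoDup l2) by apply NoDup_nodup.
  apply Rle_trans with (lsum (fun p => Rabs (f (fst p) * g (snd p))) (list_prod l1 l2)).
  - apply lsum_incl_le; auto.
    + intros; apply Rabs_pos.
    + now apply NoDup_list_prod.
    + intros [x y] H. apply in_prod_iff. split; apply nodup_In.
      * now apply (in_map fst) in H.
      * now apply (in_map snd) in H.
  - rewrite (lsum_ext_in _ (fun p => Rabs (f (fst p)) * Rabs (g (snd p))))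
      by (intros; apply Rabs_mult).
    rewrite (lsum_prod (fun x => Rabs (f x)) (fun x => Rabs (g x))).
    apply Rmult_le_compat; auto; apply lsum_nonneg; intros; apply Rabs_pos.
Qed.

(** Summability gives the sum over pairs some value t. Rectangles are cofinal among finite sets of
    pairs, and on them the sum factors, so t is arbitrarily close to s s'. *)
Lemma has_sum_prod {T U} (f : T -> R) (g : U -> R) s s' :
  summable f -> summable g -> has_sum f s -> has_sum g s' ->
  has_sum (fun p => f (fst p) * g (snd p)) (s * s').
Proof.
  intros Sf Sg Hf Hg.
  destruct (summable_has_sum _ (summable_prod f g Sf Sg)) as [t Ht].
  replace (s * s') with t; auto.
  assert (E : forall eps, 0 < eps -> Rabs (t - s * s') <= eps).
  { intros eps He.
    destruct (proj1 (has_sum_eps _ _) Ht _ (ltac:(lra) : 0 < eps / 2)) as [l0 H0].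
    assert (L : filterlim (fun p => mult (fst p) (snd p))
       (filter_prod (locally s) (locally s')) (locally (mult s s')))
      by exact (filterlim_mult s s').
    assert (X' : filterlim (fun p => lsum f (fst p) * lsum g (snd p))
       (filter_prod (fin_filter T) (fin_filter U)) (locally (s * s'))).
    { eapply filterlim_comp_2;
       [eapply filterlim_comp; [apply filterlim_fst|exact Hf]
       |eapply filterlim_comp; [apply filterlim_snd|exact Hg]|exact L]. }
    apply (proj1 (filterlim_locally _ _)) with (eps := mkposreal (eps/2) ltac:(lra)) in X'.
    destruct X' as [P Q [l1 HP] [l2 HQ] HPQ].
    set (m1 := nodup eq_dec_classic (l1 ++ map fst l0)).
    set (m2 := nodup eq_dec_classic (l2 ++ map snd l0)).
    assert (N1 : NoDup m1) by apply NoDup_nodup.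
    assert (N2 : NoDup m2) by apply NoDup_nodup.
    assert (B : Rabs (lsum f m1 * lsum g m2 - s * s') < eps / 2).
    { apply (HPQ m1 m2).
      - apply HP; auto. intros x Hx; apply nodup_In, in_or_app; auto.
      - apply HQ; auto. intros x Hx; apply nodup_In, in_or_app; auto. }
    specialize (H0 (list_prod m1 m2)). rewrite lsum_prod in H0.
    assert (Rabs (lsum f m1 * lsum g m2 - t) < eps / 2).
    { apply H0; [now apply NoDup_list_prod|].
      intros [x y] H. apply in_prod_iff.
      split; apply nodup_In, in_or_app; right;
        [now apply (in_map fst) in H|now apply (in_map snd) in H]. }
    replace (t - s * s') with ((lsum f m1 * lsum g m2 - s * s') - (lsum f m1 * lsum g m2 - t)) by ring.
    eapply Rle_trans; [apply Rabs_triang|]. rewrite Rabs_Ropp; lra. }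
  apply Rminus_diag_uniq. destruct (Req_dec (t - s * s') 0); auto.
  pose proof (Rabs_pos_lt _ H). specialize (E (Rabs (t - s * s') / 2) ltac:(lra)). lra.
Qed.

(** * Gaussian binomial coefficients with complex nome *)

Definition has_sumC {T : Type} (f : T -> C) (s : C) : Prop :=
  has_sum (fun x => Re (f x)) (Re s) /\ has_sum (fun x => Im (f x)) (Im s).

Definition is_limC (u : nat -> C) (l : C) : Prop :=
  is_lim_seq (fun n => Re (u n)) (Re l) /\ is_lim_seq (fun n => Im (u n)) (Im l).

Lemma C_eq (a b : C) : Re a = Re b -> Im a = Im b -> a = b.
Proof. destruct a, b; simpl; intros; subst; reflexivity. Qed.

Lemma has_sumC_unique {T} (f : T -> C) s s' : has_sumC f s -> has_sumC f s' -> s = s'.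
Proof. intros [A B] [A' B']. apply C_eq; eapply has_sum_unique; eauto. Qed.

Lemma has_sumC_ext {T} (f g : T -> C) s :
  (forall x, f x = g x) -> has_sumC f s -> has_sumC g s.
Proof.
  intros E [A B].
  split; [apply (has_sum_ext (fun x => Re (f x)))|apply (has_sum_ext (fun x => Im (f x)))]; auto;
   intros; now rewrite E.
Qed.

Lemma has_sumC_plus {T} (f g : T -> C) s s' :
  has_sumC f s -> has_sumC g s' -> has_sumC (fun x => (f x + g x)%C) (s + s')%C.
Proof. intros [A B] [A' B']. split; simpl; now apply has_sum_plus. Qed.

Lemma has_sumC_scal {T} (c : C) (f : T -> C) s :
  has_sumC f s -> has_sumC (fun x => (c * f x)%C) (c * s)%C.
Proof.
  intros [A B]. split; simpl.
  - apply has_sum_minus; now apply has_sum_scal.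
  - apply has_sum_plus; now apply has_sum_scal.
Qed.

Lemma has_sumC_bij {T U} (e : T -> U) (d : U -> T) (f : U -> C) s :
  (forall x, d (e x) = x) -> (forall u, e (d u) = u) ->
  has_sumC (fun x => f (e x)) s -> has_sumC f s.
Proof. intros H1 H2 [A B]; split; eapply has_sum_bij; eauto. Qed.

Lemma is_limC_ext u v l : (forall n, u n = v n) -> is_limC u l -> is_limC v l.
Proof.
  intros E [A B].
  split; [apply (is_lim_seq_ext (fun n => Re (u n)))|apply (is_lim_seq_ext (fun n => Im (u n)))];
   auto; intros; now rewrite E.
Qed.

Lemma is_limC_const c : is_limC (fun _ => c) c.
Proof. split; apply is_lim_seq_const. Qed.

Lemma is_limC_plus u v l l' :
  is_limC u l -> is_limC v l' -> is_limC (fun n => (u n + v n)%C) (l + l')%C.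
Proof. intros [A B] [A' B']; split; now apply is_lim_seq_plus'. Qed.

Lemma is_limC_mult u v l l' :
  is_limC u l -> is_limC v l' -> is_limC (fun n => (u n * v n)%C) (l * l')%C.
Proof.
  intros [A B] [A' B']; split; simpl.
  - apply is_lim_seq_minus'; now apply is_lim_seq_mult'.
  - apply is_lim_seq_plus'; now apply is_lim_seq_mult'.
Qed.

Lemma is_limC_subseq u l (p : nat -> nat) :
  filterlim p eventually eventually -> is_limC u l -> is_limC (fun n => u (p n)) l.
Proof.
  intros P [A B]; split.
  - apply (is_lim_seq_subseq (fun n => Re (u n)) (Re l) p P A).
  - apply (is_lim_seq_subseq (fun n => Im (u n)) (Im l) p P B).
Qed.

Lemma Cmod_Re_Im_bound (z : C) : Rabs (Re z) <= Cmod z /\ Rabs (Im z) <= Cmod z.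
Proof.
  pose proof (Rmax_Cmod z). split.
  - eapply Rle_trans; [apply Rmax_l|exact H].
  - eapply Rle_trans; [apply Rmax_r|exact H].
Qed.

Lemma is_limC_Cmod (u : nat -> C) (l : C) : is_limC u l -> is_lim_seq (fun n => Cmod (u n)) (Cmod l).
Proof.
  intros [A B]. unfold Cmod.
  apply is_lim_seq_continuous.
  - apply continuity_pt_sqrt. pose proof (pow2_ge_0 (fst l)). pose proof (pow2_ge_0 (snd l)). lra.
  - simpl. apply is_lim_seq_plus'; apply is_lim_seq_mult'; auto;
    (apply is_lim_seq_mult'; [auto|apply is_lim_seq_const]).
Qed.

Lemma is_limC_inv (u : nat -> C) (l : C) : (forall n, u n <> 0%C) -> l <> 0%C ->
  is_limC u l -> is_limC (fun n => (/ u n)%C) (/ l)%C.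
Proof.
  intros Hu Hl [A B].
  assert (N : forall z : C, z <> 0%C -> Re z ^ 2 + Im z ^ 2 <> 0).
  { intros z Hz E. apply Hz. apply C_eq; simpl; nra. }
  assert (D : is_lim_seq (fun n => Re (u n) ^ 2 + Im (u n) ^ 2) (Re l ^ 2 + Im l ^ 2)).
  { simpl. apply is_lim_seq_plus'; apply is_lim_seq_mult'; auto;
    (apply is_lim_seq_mult'; [auto|apply is_lim_seq_const]). }
  split; simpl.
  - apply is_lim_seq_div'; auto; try (apply N; auto).
  - apply is_lim_seq_div'; auto; try (apply N; auto).
    apply (is_lim_seq_opp _ (Im l)), B.
Qed.

Lemma geom_increments_cv (u : nat -> R) (K rho : R) :
  0 <= rho < 1 -> (forall n, Rabs (u (S n) - u n) <= K * rho ^ n) -> ex_finite_lim_seq u.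
Proof.
  intros Hr H.
  assert (E : ex_series (fun n => u (S n) - u n)).
  { apply (ex_series_le (fun n => u (S n) - u n) (fun n => K * rho ^ n)); [exact H|].
    apply (ex_series_scal (V := R_NormedModule) K (fun n => rho ^ n)).
    apply ex_series_geom. rewrite Rabs_pos_eq; lra. }
  destruct E as [l Hl]. exists (l + u O).
  apply is_lim_seq_incr_1.
  apply (is_lim_seq_ext (fun n => sum_n (fun k => u (S k) - u k) n + u O)).
  - intros n. induction n as [|n IH].
    + rewrite sum_O. ring.
    + rewrite sum_Sn. unfold plus; simpl. lra.
  - apply is_lim_seq_plus'; [exact Hl|apply is_lim_seq_const].
Qed.

(* zp tau th x is the real power x of the complex number exp (- tau + i th). *)
Definition zp (tau th x : R) : C :=
  (exp (- tau * x) * cos (th * x), exp (- tau * x) * sin (th * x)).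

Lemma zp_plus tau th x y : zp tau th (x + y) = (zp tau th x * zp tau th y)%C.
Proof.
  unfold zp, Cmult; simpl. rewrite !Rmult_plus_distr_l, exp_plus, cos_plus, sin_plus.
  f_equal; ring.
Qed.

Lemma zp_0 tau th : zp tau th 0 = 1%C.
Proof. unfold zp. rewrite !Rmult_0_r, exp_0, cos_0, sin_0. unfold RtoC; f_equal; ring. Qed.

Lemma Cmod_zp tau th x : Cmod (zp tau th x) = exp (- tau * x).
Proof.
  unfold Cmod, zp. cbn [fst snd].
  replace ((exp (- tau * x) * cos (th * x)) ^ 2 + (exp (- tau * x) * sin (th * x)) ^ 2)
    with ((exp (- tau * x))² * ((sin (th * x))² + (cos (th * x))²)) by (unfold Rsqr; ring).
  rewrite sin2_cos2, Rmult_1_r. apply sqrt_Rsqr. left; apply exp_pos.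
Qed.

Fixpoint poch (tau th : R) (n : nat) : C :=
  match n with
  | O => 1%C
  | S m => (poch tau th m * (1 - zp tau th (INR n)))%C
  end.

(* The Gaussian binomial coefficient [n, k] at the nome zp 1; it is 0 unless 0 <= k <= n. *)
Fixpoint beta (tau th : R) (n : nat) (k : Z) : C :=
  match n with
  | O => if Z.eqb k 0 then 1%C else 0%C
  | S m => (beta tau th m (k - 1) + zp tau th (IZR k) * beta tau th m k)%C
  end.

Lemma beta_out tau th n k : (k < 0 \/ Z.of_nat n < k)%Z -> beta tau th n k = 0%C.
Proof.
  revert k; induction n as [|n IH]; intros k H.
  - simpl. destruct (Z.eqb_spec k 0); [lia|reflexivity].
  - simpl. rewrite !IH by lia. ring.
Qed.

Lemma beta_pascal tau th n k :
  beta tau th (S n) k =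
  (beta tau th n (k - 1) + zp tau th (IZR k) * beta tau th n k)%C.
Proof. reflexivity. Qed.

(** The mirror image of [beta_pascal] under k -> n - k. Having both rules lets the power of the nome
    be placed on either neighbour, which the two recurrences below need. *)
Lemma beta_pascal' tau th n k :
  beta tau th (S n) k =
  (beta tau th n k + zp tau th (INR n + 1 - IZR k) * beta tau th n (k - 1))%C.
Proof.
  revert k; induction n as [|n IH]; intros k.
  - simpl. destruct (Z.eqb_spec (k - 1) 0), (Z.eqb_spec k 0); try lia.
    + replace k with 1%Z by lia. replace (0 + 1 - 1) with 0 by ring. rewrite zp_0. ring.
    + subst k. rewrite zp_0. ring.
    + ring.
  - rewrite (beta_pascal tau th (S n) k), S_INR.
    set (w := zp tau th (INR n + 1 + 1 - IZR k)).
    transitivity (beta tau th n k * zp tau th (IZR k) + beta tau th n (k - 1)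
      + w * beta tau th n (k - 1 - 1)
      + (zp tau th (IZR k) * zp tau th (INR n + 1 - IZR k)) * beta tau th n (k - 1))%C.
    { rewrite (IH k), (IH (k - 1)%Z), minus_IZR. unfold w.
      replace (INR n + 1 + 1 - IZR k) with (INR n + 1 - (IZR k - 1)) by ring. ring. }
    rewrite (beta_pascal _ _ n k), (beta_pascal _ _ n (k - 1)), minus_IZR.
    assert (E : (w * zp tau th (IZR k - 1) =
             zp tau th (IZR k) * zp tau th (INR n + 1 - IZR k))%C).
    { unfold w. rewrite <- !zp_plus. f_equal; ring. }
    rewrite <- E. ring.
Qed.

(** The product formula for Gaussian binomials, cleared of denominators so that it holds for every
    nome. *)
Lemma beta_poch tau th i j :
  (beta tau th (i + j) (Z.of_nat i) * poch tau th i * poch tau th j = poch tau th (i + j))%C.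
Proof.
  remember (i + j)%nat as n eqn:En. revert i j En.
  induction n as [|n IH]; intros i j En.
  - assert (i = 0 /\ j = 0)%nat as [-> ->] by lia. simpl. ring.
  - destruct i as [|i]; [|destruct j as [|j]].
    + simpl in En. subst j. rewrite beta_pascal, beta_out by lia.
      change (IZR (Z.of_nat 0)) with 0. rewrite zp_0.
      specialize (IH O n eq_refl). simpl in *.
      replace (Cmult (Cmult (0 + 1 * beta tau th n 0) 1) (poch tau th n * (1 - zp tau th (match n with O => 1 | S _ => INR n + 1 end))))
        with ((beta tau th n 0 * 1 * poch tau th n) * (1 - zp tau th (match n with O => 1 | S _ => INR n + 1 end)))%C by ring.
      rewrite IH. reflexivity.
    + assert (i = n) by lia; subst i. rewrite beta_pascal, (beta_out _ _ n (Z.of_nat (S n))) by lia.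
      replace (Z.of_nat (S n) - 1)%Z with (Z.of_nat n) by lia.
      specialize (IH n O ltac:(lia)).
      change (poch tau th (S n)) with (poch tau th n * (1 - zp tau th (INR (S n))))%C.
      change (poch tau th 0) with (RtoC 1) in *.
      transitivity ((beta tau th n (Z.of_nat n) * poch tau th n * 1) * (1 - zp tau th (INR (S n))))%C;
        [ring|rewrite IH; ring].
    + rewrite beta_pascal.
      replace (Z.of_nat (S i) - 1)%Z with (Z.of_nat i) by lia.
      pose proof (IH i (S j) ltac:(lia)) as H1. pose proof (IH (S i) j ltac:(lia)) as H2.
      change (poch tau th (S n)) with (poch tau th n * (1 - zp tau th (INR (S n))))%C.
      assert (Ei : poch tau th (S i) = (poch tau th i * (1 - zp tau th (INR (S i))))%C) by reflexivity.
      assert (Ej : poch tau th (S j) = (poch tau th j * (1 - zp tau th (INR (S j))))%C) by reflexivity.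
      (* Gives 1 - z^{n+1} = (1 - z^{i+1}) + z^{i+1} (1 - z^{j+1}), matching the two terms of
         Pascal's rule. *)
      assert (E : zp tau th (INR (S n)) = (zp tau th (INR (S i)) * zp tau th (INR (S j)))%C).
      { rewrite <- zp_plus. f_equal. rewrite <- plus_INR. f_equal. lia. }
      rewrite <- INR_IZR_INZ.
      transitivity ((beta tau th n (Z.of_nat i) * poch tau th i * poch tau th (S j)) * (1 - zp tau th (INR (S i)))
        + zp tau th (INR (S i)) * (beta tau th n (Z.of_nat (S i)) * poch tau th (S i) * poch tau th j) * (1 - zp tau th (INR (S j))))%C.
      * rewrite Ei, Ej. ring.
      * rewrite H1, H2, E. ring.
Qed.

Lemma Cmod_one_minus_lower (z : C) : 1 - Cmod z <= Cmod (1 - z).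
Proof.
  pose proof (Cmod_triangle (1 - z) z) as H.
  replace (1 - z + z)%C with (RtoC 1) in H by ring. rewrite Cmod_1 in H. lra.
Qed.

Lemma Cmod_one_minus_upper (z : C) : Cmod (1 - z) <= 1 + Cmod z.
Proof.
  pose proof (Cmod_triangle 1 (- z)) as H. rewrite Cmod_opp, Cmod_1 in H. exact H.
Qed.

Lemma geom_partial_bound rho n : 0 <= rho < 1 -> sum_f_R0 (fun i => rho ^ i) n <= / (1 - rho).
Proof.
  intros H. rewrite tech3 by lra.
  apply Rmult_le_reg_r with (1 - rho); [lra|].
  field_simplify; try lra. pose proof (pow_le rho (S n) (proj1 H)). simpl in *; lra.
Qed.

Lemma exp_neg_lt1 tau : 0 < tau -> 0 <= exp (- tau) < 1.
Proof.
  intros H. split; [left; apply exp_pos|]. rewrite <- exp_0. apply exp_increasing; lra.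
Qed.

Lemma exp_le x y : x <= y -> exp x <= exp y.
Proof. intros [H| ->]; [left; now apply exp_increasing|right; reflexivity]. Qed.

Lemma exp_mul_INR a n : exp (a * INR n) = exp a ^ n.
Proof.
  induction n as [|n IH].
  - simpl. rewrite Rmult_0_r. apply exp_0.
  - rewrite S_INR, Rmult_plus_distr_l, exp_plus, IH, Rmult_1_r. simpl. ring.
Qed.

(** Each factor lies between 1 - rho^n and 1 + rho^n in modulus; both are compared with
    exponentials, whose exponents form a geometric series. *)
Lemma poch_bounds tau th : 0 < tau ->
  exists c K, 0 < c /\ forall n, c <= Cmod (poch tau th n) <= K.
Proof.
  intros Ht. pose proof (exp_neg_lt1 tau Ht) as Hr. set (rho := exp (- tau)) in *.
  assert (Z : forall n, Cmod (zp tau th (INR n)) = rho ^ n).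
  { intros n. rewrite Cmod_zp. apply exp_mul_INR. }
  (* The [- 1] removes the term i = 0, as the product starts at exponent 1. *)
  assert (L : forall n, exp (- (sum_f_R0 (fun i => rho ^ i) n - 1) / (1 - rho)) <= Cmod (poch tau th n)
     <= exp (sum_f_R0 (fun i => rho ^ i) n - 1)).
  { induction n as [|n IH].
    - simpl. rewrite Cmod_1. unfold Rminus, Rdiv. rewrite Rplus_opp_r, Ropp_0, Rmult_0_l, exp_0; lra.
    - cbn [poch]. rewrite Cmod_mult.
      pose proof (Cmod_one_minus_lower (zp tau th (INR (S n)))) as H1.
      pose proof (Cmod_one_minus_upper (zp tau th (INR (S n)))) as H2.
      rewrite Z in H1, H2. set (x := rho ^ S n) in *.
      assert (Hx : 0 <= x <= rho).
      { unfold x. split; [apply pow_le; lra|]. simpl.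
        assert (rho ^ n <= 1) by (rewrite <- (pow1 n); apply pow_incr; lra). nra. }
      replace (sum_f_R0 (fun i => rho ^ i) (S n)) with (sum_f_R0 (fun i => rho ^ i) n + x) by reflexivity.
      set (s := sum_f_R0 _ n) in *.
      (* Follows from (1 + x / (1 - rho)) (1 - x) >= 1, valid for 0 <= x <= rho. *)
      assert (E1 : exp (- x / (1 - rho)) <= 1 - x).
      { pose proof (exp_ineq1_le (x / (1 - rho))) as H.
        replace (- x / (1 - rho)) with (- (x / (1 - rho))) by (field; lra).
        rewrite exp_Ropp. apply Rmult_le_reg_l with (exp (x / (1 - rho))); [apply exp_pos|].
        rewrite Rinv_r by (apply Rgt_not_eq, exp_pos).
        assert (D : 0 <= x / (1 - rho)) by (apply Rmult_le_pos; [lra|left; apply Rinv_0_lt_compat; lra]).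
        assert (1 <= (1 + x / (1 - rho)) * (1 - x)).
        { assert (x * x <= x / (1-rho) * (1 - rho) * rho) by (replace (x / (1-rho) * (1 - rho)) with x by (field; lra); nra).
          assert (x = x / (1-rho) * (1-rho)) by (field; lra). nra. }
        nra. }
      assert (E2 : 1 + x <= exp x) by apply exp_ineq1_le.
      replace (- (s + x - 1) / (1 - rho)) with (- (s - 1) / (1 - rho) + - x / (1 - rho)) by (field; lra).
      replace (s + x - 1) with ((s - 1) + x) by ring.
      rewrite !exp_plus. split.
      + apply Rmult_le_compat; try (left; apply exp_pos); lra.
      + apply Rmult_le_compat; try apply Cmod_ge_0; lra. }
  exists (exp (- / (1 - rho) / (1 - rho))), (exp (/ (1 - rho))).
  split; [apply exp_pos|]. intros n. destruct (L n) as [L1 L2].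
  pose proof (geom_partial_bound rho n ltac:(lra)) as G.
  assert (I : 0 < / (1 - rho)) by (apply Rinv_0_lt_compat; lra).
  split.
  - eapply Rle_trans; [|exact L1]. apply exp_le. unfold Rdiv. apply Rmult_le_compat_r; lra.
  - eapply Rle_trans; [exact L2|]. apply exp_le. lra.
Qed.

Lemma poch_neq0 tau th n : 0 < tau -> poch tau th n <> 0%C.
Proof.
  intros H E. destruct (poch_bounds tau th H) as [c [K [Hc B]]].
  specialize (B n). rewrite E, Cmod_0 in B. lra.
Qed.

Lemma poch_cv tau th : 0 < tau -> exists F : C, F <> 0%C /\ is_limC (poch tau th) F.
Proof.
  intros Ht. destruct (poch_bounds tau th Ht) as [c [K [Hc B]]].
  pose proof (exp_neg_lt1 tau Ht) as Hr.
  assert (D : forall n, Cmod (poch tau th (S n) - poch tau th n) <= K * exp (- tau) ^ n).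
  { intros n. cbn [poch].
    replace (poch tau th n * (1 - zp tau th (INR (S n))) - poch tau th n)%C
      with (poch tau th n * - zp tau th (INR (S n)))%C by ring.
    rewrite Cmod_mult, Cmod_opp, Cmod_zp, exp_mul_INR.
    apply Rmult_le_compat; try apply Cmod_ge_0.
    - left; apply pow_lt, exp_pos.
    - apply B.
    - simpl. rewrite <- (Rmult_1_l (exp (- tau) ^ n)) at 2. apply Rmult_le_compat_r; [|lra].
      left; apply pow_lt, exp_pos. }
  destruct (geom_increments_cv (fun n => Re (poch tau th n)) K (exp (- tau)) Hr) as [a Ha].
  { intros n. destruct (Cmod_Re_Im_bound (poch tau th (S n) - poch tau th n)) as [A _].
    eapply Rle_trans; [exact A|apply D]. }
  destruct (geom_increments_cv (fun n => Im (poch tau th n)) K (exp (- tau)) Hr) as [b Hb].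
  { intros n. destruct (Cmod_Re_Im_bound (poch tau th (S n) - poch tau th n)) as [_ A].
    eapply Rle_trans; [exact A|apply D]. }
  exists (a, b). assert (L : is_limC (poch tau th) (a, b)) by (split; assumption).
  split; auto. intros E. apply is_limC_Cmod in L. rewrite E, Cmod_0 in L.
  assert (c <= 0); [|lra].
  apply (is_lim_seq_le (fun _ => c) (fun n => Cmod (poch tau th n)) c 0).
  - intros n; apply B.
  - apply is_lim_seq_const.
  - exact L.
Qed.

Lemma beta_quot tau th i j : 0 < tau ->
  beta tau th (i + j) (Z.of_nat i) =
  (poch tau th (i + j) * / (poch tau th i * poch tau th j))%C.
Proof.
  intros H. rewrite <- (beta_poch tau th i j). field.
  split; now apply poch_neq0.
Qed.

Lemma beta_bound tau th : 0 < tau -> exists K, forall n k, Cmod (beta tau th n k) <= K.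
Proof.
  intros Ht. destruct (poch_bounds tau th Ht) as [c [K [Hc B]]].
  assert (HK : 0 <= K) by (specialize (B O); lra).
  exists (K * / (c * c)). intros n k.
  assert (P : 0 < / (c * c)) by (apply Rinv_0_lt_compat; nra).
  destruct (Z_lt_le_dec k 0); [|destruct (Z_lt_le_dec (Z.of_nat n) k)].
  - rewrite beta_out, Cmod_0 by lia. nra.
  - rewrite beta_out, Cmod_0 by lia. nra.
  - destruct (Z_of_nat_complete k ltac:(lia)) as [i ->].
    destruct (Nat.le_exists_sub i n ltac:(lia)) as [j [-> _]]. rewrite Nat.add_comm.
    rewrite beta_quot, Cmod_mult, Cmod_inv, Cmod_mult
      by (auto; apply Cmult_neq_0; now apply poch_neq0).
    apply Rmult_le_compat; try apply Cmod_ge_0.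
    + left. apply Rinv_0_lt_compat.
      apply Rmult_lt_0_compat; eapply Rlt_le_trans; try apply B; lra.
    + apply B.
    + apply Rinv_le_contravar; [nra|]. apply Rmult_le_compat; try lra; apply B.
Qed.

(** When both lower indices grow, the quotient of [poch] values tends to F / (F F). *)
Lemma beta_lim tau th (F : C) (u v : nat -> nat) : 0 < tau -> F <> 0%C ->
  is_limC (poch tau th) F ->
  filterlim u eventually eventually -> filterlim v eventually eventually ->
  is_limC (fun N => beta tau th (u N + v N) (Z.of_nat (u N))) (/ F)%C.
Proof.
  intros Ht HF L Hu Hv.
  apply (is_limC_ext (fun N => (poch tau th (u N + v N) * / (poch tau th (u N) * poch tau th (v N)))%C)).
  { intros N. symmetry. now apply beta_quot. }
  replace (/ F)%C with (F * / (F * F))%C by (field; assumption).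
  apply is_limC_mult.
  - apply (is_limC_subseq _ _ (fun N => (u N + v N)%nat)); auto.
    intros P [N0 HP]. destruct (Hu (fun n => (N0 <= n)%nat)) as [N1 H1]; [exists N0; auto|].
    exists N1. intros n Hn. apply HP. specialize (H1 n Hn). lia.
  - apply is_limC_inv.
    + intros n. apply Cmult_neq_0; now apply poch_neq0.
    + now apply Cmult_neq_0.
    + apply is_limC_mult; now apply is_limC_subseq.
Qed.

(** * The Jacobi triple product *)

Definition sgn (k : Z) : R := if Z.even k then 1 else -1.

Lemma sgn_plus a b : sgn (a + b) = sgn a * sgn b.
Proof.
  unfold sgn. rewrite Z.even_add. destruct (Z.even a), (Z.even b); simpl; ring.
Qed.

Lemma sgn_opp a : sgn (- a) = sgn a.
Proof. unfold sgn. now rewrite Z.even_opp. Qed.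

Lemma sgn_1 : sgn 1 = -1.
Proof. reflexivity. Qed.

Lemma sgn_m1 : sgn (-1) = -1.
Proof. reflexivity. Qed.

Lemma sgn_double a : sgn (2 * a) = 1.
Proof. unfold sgn. now rewrite Z.even_mul. Qed.

Lemma Rabs_sgn a : Rabs (sgn a) = 1.
Proof. unfold sgn. destruct (Z.even a); unfold Rabs; destruct Rcase_abs; lra. Qed.

Definition zrange (N : nat) : list Z :=
  map (fun i => (Z.of_nat i - Z.of_nat N)%Z) (seq 0 (2 * N + 1)).

Lemma in_zrange N k : In k (zrange N) <-> (Z.abs k <= Z.of_nat N)%Z.
Proof.
  unfold zrange. rewrite in_map_iff. split.
  - intros [i [<- H]]. apply in_seq in H. lia.
  - intros H. exists (Z.to_nat (k + Z.of_nat N)). rewrite in_seq. lia.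
Qed.

Lemma NoDup_zrange N : NoDup (zrange N).
Proof.
  apply NoDup_map_NoDup_ForallPairs; [|apply seq_NoDup].
  intros x y _ _ H. lia.
Qed.

Lemma has_sumC_finite {T} (f : T -> C) l0 :
  NoDup l0 -> (forall x, ~ In x l0 -> f x = 0%C) ->
  has_sumC f (lsum (fun x => Re (f x)) l0, lsum (fun x => Im (f x)) l0).
Proof.
  intros N H. split; apply has_sum_finite; auto; intros x Hx; now rewrite H.
Qed.

Lemma has_sumC_finite_ex (f : Z -> C) N :
  (forall k, (Z.of_nat N < Z.abs k)%Z -> f k = 0%C) -> exists s, has_sumC f s.
Proof.
  intros H. eexists. apply (has_sumC_finite f (zrange N)); [apply NoDup_zrange|].
  intros k Hk. apply H. rewrite in_zrange in Hk. lia.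
Qed.

(* With c = w + 1/w the factors are (1 - w z^n) (1 - z^n / w). *)
Fixpoint qprod (tau th c : R) (N : nat) : C :=
  match N with
  | O => 1%C
  | S M => (qprod tau th c M * (1 - RtoC c * zp tau th (INR N) + zp tau th (2 * INR N)))%C
  end.

Definition tri (k : Z) : R := IZR k * (IZR k + 1) / 2.

(* The summand of the finite triple product: z^{k(k+1)/2} [2N+1, N-k]_z. *)
Definition jterm (tau th : R) (N : nat) (k : Z) : C :=
  (zp tau th (tri k) * beta tau th (2 * N + 1) (Z.of_nat N - k))%C.

Lemma jterm_out tau th N k : (Z.of_nat (S N) < Z.abs k)%Z -> jterm tau th N k = 0%C.
Proof. intros H. unfold jterm. rewrite beta_out by lia. ring. Qed.

(** Raising N by one raises the upper index of the binomial by two, so Pascal's rule is applied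
    twice, once in each form. The coefficients are those of the new factor of [qprod], apart from
    the shifts k - 1 and k + 1. *)
Lemma jterm_S tau th N k :
  jterm tau th (S N) k =
  ((1 + zp tau th (2 * INR (S N))) * jterm tau th N k
   + zp tau th (INR (S N)) * (jterm tau th N (k - 1) + jterm tau th N (k + 1)))%C.
Proof.
  unfold jterm.
  replace (2 * S N + 1)%nat with (S (S (2 * N + 1))) by lia.
  set (n := (2 * N + 1)%nat).
  rewrite beta_pascal, !(beta_pascal' _ _ n).
  replace (Z.of_nat (S N) - k - 1)%Z with (Z.of_nat N - k)%Z by lia.
  replace (Z.of_nat (S N) - k)%Z with (Z.of_nat N - (k - 1))%Z by lia.
  replace (Z.of_nat N - k - 1)%Z with (Z.of_nat N - (k + 1))%Z by lia.
  assert (En : INR n = 2 * INR N + 1) by (unfold n; rewrite plus_INR, mult_INR; simpl; ring).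
  rewrite En, S_INR, !minus_IZR, <- !INR_IZR_INZ.
  assert (T1 : tri (k - 1) = tri k - IZR k) by (unfold tri; rewrite minus_IZR; field).
  assert (T2 : tri (k + 1) = tri k + IZR k + 1) by (unfold tri; rewrite plus_IZR; field).
  rewrite T1, T2.
  set (x := INR N). set (y := IZR k). set (t := tri k).
  set (b0 := beta tau th n (Z.of_nat N - k)).
  set (b1 := beta tau th n (Z.of_nat N - (k + 1))).
  set (b2 := beta tau th n (Z.of_nat N - (k - 1))).
  assert (E1 : (zp tau th t * zp tau th (2 * x + 1 + 1 - (x - y)) =
    zp tau th (x + 1) * zp tau th (t + y + 1))%C) by (rewrite <- !zp_plus; f_equal; ring).
  assert (E2 : (zp tau th t * zp tau th (x - (y - 1)) =
    zp tau th (x + 1) * zp tau th (t - y))%C) by (rewrite <- !zp_plus; f_equal; ring).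
  assert (E3 : (zp tau th (x - (y - 1)) * zp tau th (2 * x + 1 + 1 - (x - (y - 1))) =
    zp tau th (2 * (x + 1)))%C) by (rewrite <- !zp_plus; f_equal; ring).
  replace (Z.of_nat N - (k - 1) - 1)%Z with (Z.of_nat N - k)%Z by lia. fold b0.
  transitivity (zp tau th t * b0
     + (zp tau th t * zp tau th (2 * x + 1 + 1 - (x - y))) * b1
     + (zp tau th t * zp tau th (x - (y - 1))) * b2
     + zp tau th t * (zp tau th (x - (y - 1)) * zp tau th (2 * x + 1 + 1 - (x - (y - 1)))) * b0)%C;
   [ring|].
  rewrite E1, E2, E3. ring.
Qed.

Lemma RtoC_m1 : RtoC (-1) = (- (1))%C.
Proof. apply C_eq; simpl; ring. Qed.

(** Summation by parts moves the shifts of [jterm_S] onto sgn k d k, where they become -(d (k+1) + d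
    (k-1)) = -c d k: the middle coefficient of the new factor. At N = 0 only k = 0 and k = -1
    survive, whence the prefactor, which is 1 - 1/w for d k = w^k. *)
Lemma jtp_finite tau th (d : Z -> R) c N :
  (forall k, d (k + 1)%Z + d (k - 1)%Z = c * d k) ->
  has_sumC (fun k => (RtoC (sgn k * d k) * jterm tau th N k)%C)
           (RtoC (d 0%Z - d (-1)%Z) * qprod tau th c N)%C.
Proof.
  intros Hd. induction N as [|N IH].
  - assert (J0 : jterm tau th 0 0 = 1%C).
    { unfold jterm, tri. simpl. replace (0 * (0 + 1) / 2) with 0 by field. rewrite zp_0. ring. }
    assert (J1 : jterm tau th 0 (-1) = 1%C).
    { unfold jterm, tri. simpl. replace (-1 * (-1 + 1) / 2) with 0 by field. rewrite !zp_0. ring. }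
    pose proof (has_sumC_finite (fun k => (RtoC (sgn k * d k) * jterm tau th 0 k)%C) [0%Z; (-1)%Z]) as H.
    cbn [lsum fold_right] in H. rewrite J0, J1 in H.
    match type of H with _ -> _ -> has_sumC _ ?s =>
      replace (RtoC (d 0%Z - d (-1)%Z) * qprod tau th c 0)%C with s end.
    + apply H.
      * repeat constructor; simpl; intuition lia.
      * intros k Hk. unfold jterm. destruct (Z.eq_dec k 0); [subst; simpl in Hk; tauto|].
        destruct (Z.eq_dec k (-1)); [subst; simpl in Hk; tauto|].
        rewrite beta_out by lia. ring.
    + apply C_eq; unfold sgn; simpl; ring.
  - destruct (has_sumC_finite_ex (fun k => (RtoC (sgn k * d (k + 1)%Z) * jterm tau th N k)%C) (S N))
      as [sp Hp]; [intros; rewrite jterm_out by assumption; ring|].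
    destruct (has_sumC_finite_ex (fun k => (RtoC (sgn k * d (k - 1)%Z) * jterm tau th N k)%C) (S N))
      as [sm Hm]; [intros; rewrite jterm_out by assumption; ring|].
    set (s := (RtoC (d 0%Z - d (-1)%Z) * qprod tau th c N)%C) in *.
    assert (E : (sp + sm = RtoC c * s)%C).
    { eapply has_sumC_unique; [apply has_sumC_plus; [exact Hp|exact Hm]|].
      eapply has_sumC_ext; [|apply (has_sumC_scal (RtoC c)), IH].
      intros k. cbv beta. rewrite Cmult_assoc, <- RtoC_mult.
      replace (c * (sgn k * d k)) with (sgn k * d (k + 1)%Z + sgn k * d (k - 1)%Z) by (rewrite <- Rmult_plus_distr_l, Hd; ring).
      rewrite RtoC_plus. ring. }
    assert (Hp' : has_sumC (fun k => (RtoC (sgn k * d k) * jterm tau th N (k - 1))%C) (- (1) * sp)%C).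
    { apply (has_sumC_bij (fun k => (k + 1)%Z) (fun k => (k - 1)%Z)); try (intros; lia).
      eapply has_sumC_ext; [|apply (has_sumC_scal (- (1))%C), Hp].
      intros k. cbv beta. replace (k + 1 - 1)%Z with k by lia.
      rewrite sgn_plus, sgn_1. rewrite !RtoC_mult, RtoC_m1. ring. }
    assert (Hm' : has_sumC (fun k => (RtoC (sgn k * d k) * jterm tau th N (k + 1))%C) (- (1) * sm)%C).
    { apply (has_sumC_bij (fun k => (k - 1)%Z) (fun k => (k + 1)%Z)); try (intros; lia).
      eapply has_sumC_ext; [|apply (has_sumC_scal (- (1))%C), Hm].
      intros k. cbv beta. replace (k - 1 + 1)%Z with k by lia.
      replace (k - 1)%Z with (k + -1)%Z by lia. rewrite sgn_plus, sgn_m1. rewrite !RtoC_mult, RtoC_m1. ring. }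
    pose proof (has_sumC_plus _ _ _ _
      (has_sumC_scal (1 + zp tau th (2 * INR (S N)))%C _ _ IH)
      (has_sumC_scal (zp tau th (INR (S N))) _ _ (has_sumC_plus _ _ _ _ Hp' Hm'))) as H.
    match type of H with has_sumC _ ?r =>
      replace (RtoC (d 0%Z - d (-1)%Z) * qprod tau th c (S N))%C with r end.
    + eapply has_sumC_ext; [|exact H]. intros k. cbv beta. rewrite jterm_S. ring.
    + cbn [qprod]. transitivity ((1 + zp tau th (2 * INR (S N))) * s - zp tau th (INR (S N)) * (sp + sm))%C;
        [ring|]. rewrite E. unfold s. ring.
Qed.

Lemma is_limC_ext_loc (u v : nat -> C) l :
  eventually (fun n => u n = v n) -> is_limC u l -> is_limC v l.
Proof.
  intros [N E] [A B]. split.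
  - apply (is_lim_seq_ext_loc (fun n => Re (u n))); auto. exists N; intros; now rewrite E.
  - apply (is_lim_seq_ext_loc (fun n => Im (u n))); auto. exists N; intros; now rewrite E.
Qed.

Lemma tanneryC {T} (f : nat -> T -> C) (g : T -> C) (M : T -> R) (S : nat -> C) :
  summable M -> (forall N x, Cmod (f N x) <= M x) ->
  (forall x, is_limC (fun N => f N x) (g x)) ->
  (forall N, has_sumC (f N) (S N)) ->
  exists s, has_sumC g s /\ is_limC S s.
Proof.
  intros HM B L HS.
  destruct (tannery (fun N x => Re (f N x)) (fun x => Re (g x)) M (fun N => Re (S N))) as [a [A1 A2]]; auto.
  - intros N x. eapply Rle_trans; [apply Cmod_Re_Im_bound|auto].
  - intros x; apply L.
  - intros N; apply HS.
  - destruct (tannery (fun N x => Im (f N x)) (fun x => Im (g x)) M (fun N => Im (S N))) as [b [B1 B2]]; auto.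
    + intros N x. eapply Rle_trans; [apply Cmod_Re_Im_bound|auto].
    + intros x; apply L.
    + intros N; apply HS.
    + exists (a, b). repeat split; auto.
Qed.

Lemma filterlim_shift (a : Z) :
  filterlim (fun N => Z.to_nat (Z.of_nat N + a)) eventually eventually.
Proof.
  intros P [N0 HP]. exists (N0 + Z.to_nat (- a))%nat. intros n Hn. apply HP. lia.
Qed.

Lemma beta_mid_lim tau th (F : C) (a : Z) : 0 < tau -> F <> 0%C ->
  is_limC (poch tau th) F ->
  is_limC (fun N => beta tau th (2 * N + 1) (Z.of_nat N - a)) (/ F)%C.
Proof.
  intros Ht HF L.
  eapply is_limC_ext_loc;
   [|apply (beta_lim tau th F _ _ Ht HF L (filterlim_shift (- a)) (filterlim_shift (1 + a)))].
  exists (Z.to_nat (Z.abs a) + 1)%nat. intros n Hn. cbv beta. f_equal; lia.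
Qed.

(* Taking d k = w^k, c = w + 1/w gives the usual form; sequences d
   such as 2k+1 (c = 2) or a periodic one give the specialisations at roots of unity. *)
Lemma jacobi_triple tau th (d : Z -> R) c : 0 < tau ->
  (forall k, d (k + 1)%Z + d (k - 1)%Z = c * d k) ->
  summable (fun k => Rabs (d k) * exp (- tau * tri k)) ->
  exists s, has_sumC (fun k => (RtoC (sgn k * d k) * zp tau th (tri k))%C) s /\
    is_limC (fun N => (RtoC (d 0%Z - d (-1)%Z) * (poch tau th N * qprod tau th c N))%C) s.
Proof.
  intros Ht Hd Hs.
  destruct (poch_cv tau th Ht) as [F [HF L]].
  destruct (beta_bound tau th Ht) as [K HK].
  destruct (tanneryC (fun N k => (RtoC (sgn k * d k) * jterm tau th N k)%C)
    (fun k => (RtoC (sgn k * d k) * (zp tau th (tri k) * / F))%C)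
    (fun k => K * (Rabs (d k) * exp (- tau * tri k)))
    (fun N => (RtoC (d 0%Z - d (-1)%Z) * qprod tau th c N)%C)) as [s [H1 H2]].
  - now apply summable_scal.
  - intros N k. unfold jterm. rewrite !Cmod_mult, Cmod_R, Rabs_mult, Rabs_sgn, Cmod_zp, Rmult_1_l.
    rewrite (Rmult_comm K), Rmult_assoc.
    apply Rmult_le_compat_l; [apply Rabs_pos|].
    apply Rmult_le_compat_l; [left; apply exp_pos|apply HK].
  - intros k. apply is_limC_mult; [apply is_limC_const|].
    apply is_limC_mult; [apply is_limC_const|]. now apply beta_mid_lim.
  - intros N. now apply jtp_finite.
  (* Every binomial tends to 1/F, where F is the limit of [poch]; multiplying by F turns this into
     the Euler factor of the product side. *)
  - exists (F * s)%C. split.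
    + eapply has_sumC_ext; [|apply (has_sumC_scal F), H1]. intros k. cbv beta. field. exact HF.
    + eapply is_limC_ext; [|apply is_limC_mult; [exact L|exact H2]]. intros N. cbv beta. ring.
Qed.

(** * Theta series *)

Lemma lsum_seq_pow rho a n : 0 <= rho < 1 ->
  lsum (fun i => rho ^ i) (seq a n) <= rho ^ a / (1 - rho).
Proof.
  intros H. revert a; induction n as [|n IH]; intros a; simpl.
  - apply Rmult_le_pos; [apply pow_le; lra|left; apply Rinv_0_lt_compat; lra].
  - specialize (IH (S a)). simpl in IH.
    replace (rho ^ a / (1 - rho)) with (rho ^ a + rho * rho ^ a / (1 - rho)) by (field; lra). lra.
Qed.

Lemma exp_mul_abs s k : exp (- s * Rabs (IZR k)) = exp (- s) ^ Z.abs_nat k.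
Proof.
  rewrite <- exp_mul_INR. do 2 f_equal.
  rewrite INR_IZR_INZ, Zabs2Nat.id_abs, abs_IZR. reflexivity.
Qed.

Lemma summable_exp_abs s : 0 < s -> summable (fun k : Z => exp (- s * Rabs (IZR k))).
Proof.
  intros Hs. pose proof (exp_neg_lt1 s Hs) as Hr. set (rho := exp (- s)) in *.
  exists (/ (1 - rho) + / (1 - rho)). intros l Hl.
  set (N := fold_right (fun k n => Nat.max (Z.abs_nat k) n) O l).
  assert (HN : forall k, In k l -> (Z.abs_nat k <= N)%nat).
  { unfold N. clear. induction l as [|a l IH]; simpl; [tauto|].
    intros k [->|H]; [lia|specialize (IH k H); lia]. }
  set (l' := map Z.of_nat (seq 0 (S N)) ++ map (fun n => (- Z.of_nat n)%Z) (seq 1 N)).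
  apply Rle_trans with (lsum (fun k => Rabs (exp (- s * Rabs (IZR k)))) l').
  - apply lsum_incl_le; auto.
    + intros; apply Rabs_pos.
    + apply NoDup_app.
      * apply NoDup_map_NoDup_ForallPairs; [|apply seq_NoDup]. intros x y _ _ E; lia.
      * apply NoDup_map_NoDup_ForallPairs; [|apply seq_NoDup]. intros x y _ _ E; lia.
      * intros a Ha Hb. apply in_map_iff in Ha, Hb.
        destruct Ha as [x [<- _]], Hb as [y [Ey Hy]]. apply in_seq in Hy. lia.
    + intros k Hk. specialize (HN k Hk). apply in_or_app.
      destruct (Z_lt_le_dec k 0).
      * right. apply in_map_iff. exists (Z.abs_nat k). rewrite in_seq. lia.
      * left. apply in_map_iff. exists (Z.abs_nat k). rewrite in_seq. lia.
  - unfold l'. rewrite lsum_app, !lsum_map.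
    rewrite !(lsum_ext_in (fun x => Rabs _) (fun i => rho ^ i)).
    + pose proof (lsum_seq_pow rho 0 (S N) ltac:(lra)).
      pose proof (lsum_seq_pow rho 1 N ltac:(lra)). simpl pow in *.
      assert (0 < / (1 - rho)) by (apply Rinv_0_lt_compat; lra).
      unfold Rdiv in *. nra.
    + intros n _. rewrite Rabs_pos_eq by (left; apply exp_pos). rewrite exp_mul_abs. f_equal. lia.
    + intros n _. rewrite Rabs_pos_eq by (left; apply exp_pos). rewrite exp_mul_abs. f_equal. lia.
Qed.

(* The constant 2 absorbs the small values of k for which k(k+1)/2 < |k|. *)
Definition growing (e : Z -> R) : Prop := forall k, 0 <= e k /\ Rabs (IZR k) - 2 <= e k.

(** Half of the decay absorbs the weight: 1 + x <= A exp (tau x / 8), whose fourth power costs exp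
    (tau x / 2). The other half gives exp (- tau |k| / 2), and the 2 in [growing] costs the factor
    exp tau. The fourth power is what [theta_derive] requires: a weight of order 2 and two
    derivatives. *)
Lemma summable_theta (w e : Z -> R) K tau : 0 < tau -> growing e ->
  (forall k, Rabs (w k) <= K * (1 + e k) ^ 4) ->
  summable (fun k => w k * exp (- tau * e k)).
Proof.
  intros Ht He Hw.
  set (A := 1 + 8 / tau).
  assert (HA : 0 < 8 / tau) by (apply Rdiv_lt_0_compat; lra).
  assert (HK : 0 <= K).
  { pose proof (Rabs_pos (w 0%Z)). specialize (Hw 0%Z). destruct (He 0%Z) as [H0 _].
    pose proof (pow_lt (1 + e 0%Z) 4 ltac:(lra)). nra. }
  apply summable_le with (fun k => (K * A ^ 4 * exp tau) * exp (- (tau / 2) * Rabs (IZR k))).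
  2:{ apply summable_scal, summable_exp_abs. lra. }
  intros k. rewrite Rabs_mult, (Rabs_pos_eq (exp _)) by (left; apply exp_pos).
  destruct (He k) as [H1 H2].
  set (x := e k) in *.
  assert (B : 1 + x <= A * exp (tau * x / 8)).
  { pose proof (exp_ineq1_le (tau * x / 8)).
    assert (E : 8 / tau * (tau * x / 8) = x) by (field; lra). unfold A.
    assert (0 <= tau * x / 8) by nra. nra. }
  assert (B4 : (1 + x) ^ 4 <= A ^ 4 * exp (tau * x / 2)).
  { replace (exp (tau * x / 2)) with (exp (tau * x / 8) ^ 4).
    - rewrite <- Rpow_mult_distr. apply pow_incr. lra.
    - rewrite <- exp_mul_INR. f_equal. simpl. field. }
  replace (K * A ^ 4 * exp tau * exp (- (tau / 2) * Rabs (IZR k)))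
    with (K * A ^ 4 * exp (tau + - (tau / 2) * Rabs (IZR k))) by (rewrite exp_plus; ring).
  apply Rle_trans with (K * (A ^ 4 * exp (tau * x / 2)) * exp (- tau * x)).
  - apply Rmult_le_compat_r; [left; apply exp_pos|].
    eapply Rle_trans; [apply Hw|]. apply Rmult_le_compat_l; auto.
  - rewrite <- Rmult_assoc, (Rmult_assoc _ (exp _)), <- exp_plus.
    apply Rmult_le_compat_l.
    + apply Rmult_le_pos; auto. apply pow_le. unfold A; lra.
    + apply exp_le. nra.
Qed.

(** A total function, by way of symmetric partial sums, so that theta series are plain functions of
    tau; it agrees with [has_sum] whenever the latter holds. *)
Definition zsum (f : Z -> R) : R := real (Lim_seq (fun N => lsum f (zrange N))).

Lemma zsum_eq f s : has_sum f s -> zsum f = s.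
Proof.
  intros H. unfold zsum. rewrite (is_lim_seq_unique _ s); [reflexivity|].
  unfold is_lim_seq. eapply filterlim_comp; [|exact H].
  intros P [l0 H0].
  exists (fold_right (fun k n => Nat.max (Z.abs_nat k) n) O l0). intros n Hn. apply H0.
  - apply NoDup_zrange.
  - intros k Hk. apply in_zrange.
    assert ((Z.abs_nat k <= n)%nat); [|lia].
    revert Hn Hk. clear. induction l0 as [|a l IH]; simpl; [tauto|].
    intros Hn [->|H]; [lia|apply IH; auto; lia].
Qed.

Lemma has_sum_zsum f : summable f -> has_sum f (zsum f).
Proof.
  intros H. destruct (summable_has_sum f H) as [s Hs]. now rewrite (zsum_eq f s Hs).
Qed.

Lemma exp_taylor x : Rabs (exp x - 1 - x) <= x ^ 2 * exp (Rabs x).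
Proof.
  pose proof (exp_ineq1_le x) as H1. pose proof (exp_ineq1_le (- x)) as H2.
  rewrite exp_Ropp in H2.
  assert (P := exp_pos x).
  assert (H3 : exp x - 1 <= x * exp x).
  { apply (Rmult_le_compat_l (exp x)) in H2; [|lra].
    rewrite Rinv_r in H2 by lra. lra. }
  rewrite (Rabs_pos_eq (exp x - 1 - x)) by lra.
  destruct (Rle_lt_dec 0 x).
  - rewrite Rabs_pos_eq by lra. nra.
  - assert (1 <= exp (Rabs x)).
    { rewrite <- exp_0. apply exp_le, Rabs_pos. }
    assert (exp x - 1 - x <= x ^ 2) by (simpl; nra). nra.
Qed.

(** Termwise differentiation: for |h| <= tau/2 half of the decay survives the increment, so the
    remainder is at most h^2 times the convergent sum of |w| e^2 exp (- (tau/2) e). *)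
Lemma theta_derive (w e : Z -> R) K (G : R -> R) tau : 0 < tau -> growing e ->
  (forall k, Rabs (w k) <= K * (1 + e k) ^ 2) ->
  (forall t, 0 < t -> has_sum (fun k => w k * exp (- t * e k)) (G t)) ->
  exists D, has_sum (fun k => - (w k * e k) * exp (- tau * e k)) D /\ is_derive G tau D.
Proof.
  intros Ht He Hw HG.
  assert (HK : 0 <= K).
  { pose proof (Rabs_pos (w 0%Z)). specialize (Hw 0%Z). destruct (He 0%Z) as [H0 _].
    pose proof (pow_lt (1 + e 0%Z) 2 ltac:(lra)). nra. }
  assert (S1 : summable (fun k => - (w k * e k) * exp (- tau * e k))).
  { apply summable_theta with K; auto. intros k. destruct (He k) as [H0 _]. specialize (Hw k).
    rewrite Rabs_Ropp, Rabs_mult, (Rabs_pos_eq (e k)) by lra.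
    apply Rle_trans with (K * (1 + e k) ^ 2 * (1 + e k) ^ 2); [|right; ring].
    apply Rmult_le_compat; [apply Rabs_pos|lra|lra|simpl; nra]. }
  destruct (summable_has_sum _ S1) as [D HD]. exists D. split; auto.
  assert (S2 : summable (fun k => w k * (e k) ^ 2 * exp (- (tau / 2) * e k))).
  { apply summable_theta with K; auto; [lra|]. intros k. destruct (He k) as [H0 _]. specialize (Hw k).
    rewrite Rabs_mult, (Rabs_pos_eq (e k ^ 2)) by (apply pow_le; lra).
    apply Rle_trans with (K * (1 + e k) ^ 2 * (1 + e k) ^ 2); [|right; ring].
    apply Rmult_le_compat; [apply Rabs_pos|apply pow_le; lra|lra|apply pow_incr; lra]. }
  destruct S2 as [M HM].
  assert (HM0 : 0 <= M) by (specialize (HM nil (NoDup_nil _)); simpl in HM; lra).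
  assert (B : forall h, Rabs h <= tau / 2 -> Rabs (G (tau + h) - G tau - h * D) <= h ^ 2 * M).
  { intros h Hh. assert (0 < tau + h) by (revert Hh; unfold Rabs; destruct Rcase_abs; lra).
    pose proof (has_sum_minus _ _ _ _ (has_sum_minus _ _ _ _ (HG (tau + h) H) (HG tau Ht))
      (has_sum_scal h _ _ HD)) as Hd.
    apply (has_sum_bound _ _ _ Hd). intros l Nl.
    eapply Rle_trans; [|apply Rmult_le_compat_l; [apply pow2_ge_0|apply (HM l Nl)]].
    rewrite <- lsum_scal. apply lsum_le. intros k. destruct (He k) as [H0 _].
    replace (w k * exp (- (tau + h) * e k) - w k * exp (- tau * e k) - h * (- (w k * e k) * exp (- tau * e k)))
      with (w k * exp (- tau * e k) * (exp (- h * e k) - 1 - - h * e k)).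
    2:{ replace (- (tau + h) * e k) with (- tau * e k + - h * e k) by ring. rewrite exp_plus. ring. }
    rewrite !Rabs_mult, (Rabs_pos_eq (exp (- tau * e k))), (Rabs_pos_eq (exp (- (tau/2) * e k)))
      by (left; apply exp_pos).
    pose proof (exp_taylor (- h * e k)) as T.
    rewrite Rabs_mult, Rabs_Ropp, (Rabs_pos_eq (e k)) in T by lra.
    rewrite (Rabs_pos_eq (e k ^ 2)) by (apply pow_le; lra).
    assert (E : exp (- tau * e k) * exp (Rabs h * e k) <= exp (- (tau / 2) * e k)).
    { rewrite <- exp_plus. apply exp_le. nra. }
    apply Rle_trans with (Rabs (w k) * exp (- tau * e k) * ((- h * e k) ^ 2 * exp (Rabs h * e k))).
    - apply Rmult_le_compat_l; [|exact T]. apply Rmult_le_pos; [apply Rabs_pos|left; apply exp_pos].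
    - replace (Rabs (w k) * exp (- tau * e k) * ((- h * e k) ^ 2 * exp (Rabs h * e k)))
        with (h ^ 2 * (Rabs (w k) * e k ^ 2) * (exp (- tau * e k) * exp (Rabs h * e k))) by ring.
      replace (h ^ 2 * (Rabs (w k) * e k ^ 2 * exp (- (tau / 2) * e k)))
        with (h ^ 2 * (Rabs (w k) * e k ^ 2) * exp (- (tau / 2) * e k)) by ring.
      apply Rmult_le_compat_l; auto.
      apply Rmult_le_pos; [apply pow2_ge_0|apply Rmult_le_pos; [apply Rabs_pos|apply pow_le; lra]]. }
  apply is_derive_Reals. intros eps Heps.
  assert (Hd : 0 < Rmin (tau / 2) (eps / (M + 1))).
  { apply Rmin_glb_lt; [lra|]. apply Rdiv_lt_0_compat; lra. }
  exists (mkposreal _ Hd). intros h Hh0 Hh. simpl in Hh.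
  assert (h1 : Rabs h < tau / 2) by (eapply Rlt_le_trans; [exact Hh|apply Rmin_l]).
  assert (h2 : Rabs h < eps / (M + 1)) by (eapply Rlt_le_trans; [exact Hh|apply Rmin_r]).
  specialize (B h ltac:(lra)).
  replace ((G (tau + h) - G tau) / h - D) with ((G (tau + h) - G tau - h * D) / h) by (field; auto).
  unfold Rdiv. rewrite Rabs_mult, Rabs_inv.
  assert (Ph := Rabs_pos_lt h Hh0).
  apply Rmult_lt_reg_r with (Rabs h); auto. rewrite Rmult_assoc, Rinv_l, Rmult_1_r by lra.
  eapply Rle_lt_trans; [exact B|].
  rewrite <- (pow2_abs h). simpl. rewrite Rmult_1_r.
  assert (Rabs h * M < eps).
  { apply Rle_lt_trans with (Rabs h * (M + 1)); [nra|].
    apply (Rmult_lt_compat_r (M + 1)) in h2; [|lra].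
    unfold Rdiv in h2. rewrite Rmult_assoc, Rinv_l, Rmult_1_r in h2 by lra. lra. }
  nra.
Qed.

(** * Euler's product and the product forms of the theta series *)

Fixpoint rpoch (tau : R) (n : nat) : R :=
  match n with
  | O => 1
  | S m => rpoch tau m * (1 - exp (- tau * INR n))
  end.

Definition phi (tau : R) : R := real (Lim_seq (rpoch tau)).

Lemma zp_real tau x : zp tau 0 x = RtoC (exp (- tau * x)).
Proof. unfold zp, RtoC. rewrite Rmult_0_l, cos_0, sin_0. f_equal; ring. Qed.

Lemma poch_real tau n : poch tau 0 n = RtoC (rpoch tau n).
Proof.
  induction n as [|n IH]; [reflexivity|]. cbn [poch rpoch].
  now rewrite IH, zp_real, RtoC_mult, RtoC_minus.
Qed.

Lemma rpoch_pos tau n : 0 < tau -> 0 < rpoch tau n.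
Proof.
  intros H. induction n as [|n IH]; [simpl; lra|]. cbn [rpoch].
  apply Rmult_lt_0_compat; auto.
  assert (exp (- tau * INR (S n)) < 1); [|lra].
  rewrite <- exp_0. apply exp_increasing. rewrite S_INR. pose proof (pos_INR n). nra.
Qed.

(** The limit is nonnegative and real as a limit of positive reals, and nonzero by [poch_cv]. *)
Lemma phi_spec tau : 0 < tau -> is_lim_seq (rpoch tau) (phi tau) /\ 0 < phi tau.
Proof.
  intros H. destruct (poch_cv tau 0 H) as [F [HF [L1 L2]]].
  apply (is_lim_seq_ext _ (rpoch tau)) in L1; [|intros n; now rewrite poch_real].
  assert (E : phi tau = Re F) by (unfold phi; now rewrite (is_lim_seq_unique _ _ L1)).
  rewrite E. split; auto.
  assert (P : 0 <= Re F).
  { apply (is_lim_seq_le (fun _ => 0) (rpoch tau) 0 (Re F)); auto.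
    - intros n. left. now apply rpoch_pos.
    - apply is_lim_seq_const. }
  assert (I : Im F = 0).
  { apply (is_lim_seq_ext _ (fun _ => 0)) in L2; [|intros n; now rewrite poch_real].
    apply is_lim_seq_unique in L2. rewrite Lim_seq_const in L2. congruence. }
  destruct P as [P|P]; auto. exfalso; apply HF. apply C_eq; simpl; auto.
Qed.

Fixpoint rqprod (tau c : R) (N : nat) : R :=
  match N with
  | O => 1
  | S M => rqprod tau c M * (1 - c * exp (- tau * INR N) + exp (- tau * (2 * INR N)))
  end.

Lemma qprod_real tau c n : qprod tau 0 c n = RtoC (rqprod tau c n).
Proof.
  induction n as [|n IH]; [reflexivity|]. cbn [qprod rqprod].
  now rewrite IH, !zp_real, RtoC_mult, RtoC_plus, RtoC_minus, RtoC_mult.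
Qed.

Lemma jacobi_triple_real tau (d : Z -> R) c : 0 < tau ->
  (forall k, d (k + 1)%Z + d (k - 1)%Z = c * d k) ->
  summable (fun k => Rabs (d k) * exp (- tau * tri k)) ->
  exists s, has_sum (fun k => sgn k * d k * exp (- tau * tri k)) s /\
    is_lim_seq (fun N => (d 0%Z - d (-1)%Z) * (rpoch tau N * rqprod tau c N)) s.
Proof.
  intros Ht Hd Hs. destruct (jacobi_triple tau 0 d c Ht Hd Hs) as [s [[H1 _] [H2 _]]].
  exists (Re s). split.
  - eapply has_sum_ext; [|exact H1]. intros k. cbv beta. rewrite zp_real, <- RtoC_mult. reflexivity.
  - eapply is_lim_seq_ext; [|exact H2]. intros n. cbv beta.
    rewrite poch_real, qprod_real, <- !RtoC_mult. reflexivity.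
Qed.

Definition e1 (k : Z) : R := (5 * IZR k ^ 2 + 3 * IZR k) / 2.
Definition e2 (k : Z) : R := (5 * IZR k ^ 2 + IZR k) / 2.

Lemma IZR_sqr_ge k : Rabs (IZR k) <= IZR k ^ 2.
Proof.
  rewrite <- abs_IZR, pow_IZR. apply IZR_le. simpl. nia.
Qed.

Lemma growing_e1 : growing e1.
Proof.
  intros k. unfold e1. pose proof (IZR_sqr_ge k). pose proof (Rabs_pos (IZR k)).
  unfold Rabs in *. destruct Rcase_abs; lra.
Qed.

Lemma growing_e2 : growing e2.
Proof.
  intros k. unfold e2. pose proof (IZR_sqr_ge k). pose proof (Rabs_pos (IZR k)).
  unfold Rabs in *. destruct Rcase_abs; lra.
Qed.

Lemma growing_tri : growing tri.
Proof.
  intros k. unfold tri. pose proof (IZR_sqr_ge k). pose proof (Rabs_pos (IZR k)).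
  pose proof (Rle_0_sqr (IZR k - 1 / 2)). pose proof (Rle_0_sqr (IZR k + 3 / 2)).
  unfold Rabs, Rsqr in *. simpl in *. destruct Rcase_abs; split; lra.
Qed.

Lemma pow_ge_1 x n : 0 <= x -> 1 <= (1 + x) ^ n.
Proof. intros H. rewrite <- (pow1 n) at 1. apply pow_incr; lra. Qed.

Definition g1 tau := zsum (fun k => sgn k * exp (- tau * e1 k)).
Definition g2 tau := zsum (fun k => sgn k * exp (- tau * e2 k)).
Definition th3 tau := zsum (fun k => sgn k * (2 * IZR k + 1) * exp (- tau * tri k)).

Lemma sgn_weight (e : Z -> R) n k : growing e -> Rabs (sgn k) <= 1 * (1 + e k) ^ n.
Proof. intros H. rewrite Rabs_sgn, Rmult_1_l. apply pow_ge_1, H. Qed.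

Lemma odd_weight k : Rabs (sgn k * (2 * IZR k + 1)) <= 9 * (1 + tri k) ^ 2.
Proof.
  rewrite Rabs_mult, Rabs_sgn, Rmult_1_l. destruct (growing_tri k) as [H _].
  assert (E : (2 * IZR k + 1) ^ 2 = 8 * tri k + 1) by (unfold tri; field).
  assert (Rabs (2 * IZR k + 1) <= 1 + (2 * IZR k + 1) ^ 2).
  { simpl. unfold Rabs; destruct Rcase_abs; nra. }
  simpl in *. nra.
Qed.

Lemma weight_2_4 (e w : Z -> R) K k : growing e -> Rabs (w k) <= K * (1 + e k) ^ 2 ->
  Rabs (w k) <= K * (1 + e k) ^ 4.
Proof.
  intros He H. eapply Rle_trans; [exact H|].
  pose proof (pow_ge_1 (e k) 2 (proj1 (He k))) as P.
  assert (0 <= K) by (pose proof (Rabs_pos (w k)); nra).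
  replace ((1 + e k) ^ 4) with ((1 + e k) ^ 2 * (1 + e k) ^ 2) by ring.
  apply Rmult_le_compat_l; auto. nra.
Qed.

Lemma summable_g1 tau : 0 < tau -> summable (fun k => sgn k * exp (- tau * e1 k)).
Proof.
  intros H. apply summable_theta with 1; auto using growing_e1.
  intros; apply sgn_weight, growing_e1.
Qed.

Lemma summable_g2 tau : 0 < tau -> summable (fun k => sgn k * exp (- tau * e2 k)).
Proof.
  intros H. apply summable_theta with 1; auto using growing_e2.
  intros; apply sgn_weight, growing_e2.
Qed.

Lemma summable_th3 tau : 0 < tau ->
  summable (fun k => sgn k * (2 * IZR k + 1) * exp (- tau * tri k)).
Proof.
  intros H. apply summable_theta with 9; auto using growing_tri.
  intros k. apply (weight_2_4 tri (fun k => sgn k * (2 * IZR k + 1))); auto using growing_tri, odd_weight.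
Qed.

(** Jacobi's formula is the degenerate case w = 1: 2k + 1 is the linear solution of the recurrence
    with c = 2, and each factor becomes the square (1 - q^n)^2. The 2 appears because k and -1 - k
    contribute equally to the sum over Z. *)
Lemma th3_phi tau : 0 < tau -> th3 tau = 2 * phi tau ^ 3.
Proof.
  intros Ht. destruct (jacobi_triple_real tau (fun k => 2 * IZR k + 1) 2 Ht) as [s [H1 H2]].
  - intros k. rewrite plus_IZR, minus_IZR. ring.
  - apply summable_le with (fun k => Rabs (sgn k * (2 * IZR k + 1) * exp (- tau * tri k))).
    + intros k. rewrite !Rabs_mult, Rabs_sgn, Rabs_Rabsolu. lra.
    + destruct (summable_th3 tau Ht) as [M HM]. exists M. intros l N.
      eapply Rle_trans; [|apply (HM l N)]. apply lsum_le. intros k. rewrite Rabs_Rabsolu. lra.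
  - assert (E : th3 tau = s) by (apply zsum_eq; exact H1).
    rewrite E. apply is_lim_seq_unique in H2.
    assert (L : is_lim_seq (fun N => 2 * (rpoch tau N * (rpoch tau N * (rpoch tau N * 1)))) (2 * phi tau ^ 3)).
    { pose proof (proj1 (phi_spec tau Ht)) as L. simpl.
      repeat apply is_lim_seq_mult'; auto; apply is_lim_seq_const. }
    apply (is_lim_seq_ext _ (fun N => (2 * 0 + 1 - (2 * -1 + 1)) * (rpoch tau N * rqprod tau 2 N))) in L.
    + apply is_lim_seq_unique in L. rewrite L in H2. congruence.
    + intros n. replace (rqprod tau 2 n) with (rpoch tau n ^ 2); [ring|].
      induction n as [|n IH]; [simpl; ring|]. cbn [rpoch rqprod]. rewrite <- IH.
      replace (- tau * (2 * INR (S n))) with (- tau * INR (S n) + - tau * INR (S n)) by ring.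
      rewrite exp_plus. ring.
Qed.

(** The triple product at nome q^5 with w = 1/q, as 5 tri k - k = e1 k; the exponents that occur are
    congruent to 0, 1, 4 modulo 5. *)
Lemma g1_prod tau : 0 < tau ->
  is_lim_seq (fun N => (1 - exp (- tau)) * (rpoch (5 * tau) N * rqprod (5 * tau) (exp tau + exp (- tau)) N)) (g1 tau).
Proof.
  intros Ht. destruct (jacobi_triple_real (5 * tau) (fun k => exp (tau * IZR k)) (exp tau + exp (- tau)) ltac:(lra)) as [s [H1 H2]].
  - intros k. rewrite plus_IZR, minus_IZR.
    replace (tau * (IZR k + 1)) with (tau + tau * IZR k) by ring.
    replace (tau * (IZR k - 1)) with (- tau + tau * IZR k) by ring.
    rewrite !exp_plus. ring.
  - apply (summable_ext (fun k => 1 * exp (- tau * e1 k))).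
    + intros k. rewrite (Rabs_pos_eq (exp _)) by (left; apply exp_pos).
      rewrite <- exp_plus, Rmult_1_l. f_equal. unfold e1, tri. field.
    + apply summable_theta with 1; auto using growing_e1.
      intros k. rewrite Rabs_R1, Rmult_1_l. apply pow_ge_1, growing_e1.
  - replace (g1 tau) with s.
    + eapply is_lim_seq_ext; [|exact H2]. intros n. cbv beta. rewrite Rmult_0_r, exp_0.
      do 2 f_equal. f_equal. ring.
    + symmetry. apply zsum_eq. eapply has_sum_ext; [|exact H1]. intros k. cbv beta.
      rewrite Rmult_assoc, <- exp_plus. do 2 f_equal. unfold e1, tri. field.
Qed.

(** Here w = q^{-2}, as 5 tri k - 2k = e2 k; the exponents are congruent to 0, 2, 3 modulo 5. *)
Lemma g2_prod tau : 0 < tau ->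
  is_lim_seq (fun N => (1 - exp (- (2 * tau))) * (rpoch (5 * tau) N * rqprod (5 * tau) (exp (2 * tau) + exp (- (2 * tau))) N)) (g2 tau).
Proof.
  intros Ht. destruct (jacobi_triple_real (5 * tau) (fun k => exp (2 * tau * IZR k)) (exp (2 * tau) + exp (- (2 * tau))) ltac:(lra)) as [s [H1 H2]].
  - intros k. rewrite plus_IZR, minus_IZR.
    replace (2 * tau * (IZR k + 1)) with (2 * tau + 2 * tau * IZR k) by ring.
    replace (2 * tau * (IZR k - 1)) with (- (2 * tau) + 2 * tau * IZR k) by ring.
    rewrite !exp_plus. ring.
  - apply (summable_ext (fun k => 1 * exp (- tau * e2 k))).
    + intros k. rewrite (Rabs_pos_eq (exp _)) by (left; apply exp_pos).
      rewrite <- exp_plus, Rmult_1_l. f_equal. unfold e2, tri. field.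
    + apply summable_theta with 1; auto using growing_e2.
      intros k. rewrite Rabs_R1, Rmult_1_l. apply pow_ge_1, growing_e2.
  - replace (g2 tau) with s.
    + eapply is_lim_seq_ext; [|exact H2]. intros n. cbv beta. rewrite Rmult_0_r, exp_0.
      do 2 f_equal. f_equal. ring.
    + symmetry. apply zsum_eq. eapply has_sum_ext; [|exact H1]. intros k. cbv beta.
      rewrite Rmult_assoc, <- exp_plus. do 2 f_equal. unfold e2, tri. field.
Qed.

(** Together the two truncated products contain every exponent up to 5N + 2 once, and the multiples
    of 5 twice. *)
Lemma g1_g2_finite tau N :
  ((1 - exp (- tau)) * (rpoch (5 * tau) N * rqprod (5 * tau) (exp tau + exp (- tau)) N)) *
  ((1 - exp (- (2 * tau))) * (rpoch (5 * tau) N * rqprod (5 * tau) (exp (2 * tau) + exp (- (2 * tau))) N))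
  = rpoch tau (5 * N + 2) * rpoch (5 * tau) N.
Proof.
  set (q := exp (- tau)).
  assert (Q0 : q <> 0) by (apply Rgt_not_eq, exp_pos).
  assert (Q1 : exp tau = / q) by (unfold q; rewrite exp_Ropp, Rinv_inv; reflexivity).
  assert (Q2 : exp (- (2 * tau)) = q * q) by (unfold q; rewrite <- exp_plus; f_equal; ring).
  assert (Q3 : exp (2 * tau) = / q * / q) by (rewrite <- Q1, <- exp_plus; f_equal; ring).
  rewrite Q1, Q2, Q3.
  induction N as [|N IH].
  - simpl. replace (- tau * 1) with (- tau) by ring. replace (- tau * (1 + 1)) with (- (2 * tau)) by ring.
    fold q. rewrite Q2. ring.
  - replace (5 * S N + 2)%nat with (S (S (S (S (S (5 * N + 2)))))) by lia.
    cbn [rpoch rqprod].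
    set (X := exp (- tau * (5 * INR N))).
    assert (P : forall j, exp (- tau * INR (5 * N + 2 + j)) = X * q ^ (2 + j)).
    { intros j. unfold X, q. rewrite <- exp_mul_INR, <- exp_plus. f_equal.
      rewrite !plus_INR, mult_INR. simpl (INR 5). simpl (INR 2). ring. }
    replace (S (S (S (S (S (5 * N + 2)))))) with (5 * N + 2 + 5)%nat by lia.
    replace (S (S (S (S (5 * N + 2))))) with (5 * N + 2 + 4)%nat by lia.
    replace (S (S (S (5 * N + 2)))) with (5 * N + 2 + 3)%nat by lia.
    replace (S (S (5 * N + 2))) with (5 * N + 2 + 2)%nat by lia.
    replace (S (5 * N + 2)) with (5 * N + 2 + 1)%nat by lia.
    rewrite !P.
    replace (exp (- (5 * tau) * INR (S N))) with (X * q ^ 5).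
    2:{ unfold X, q. rewrite <- exp_mul_INR, <- exp_plus. f_equal. rewrite (S_INR N). simpl (INR 5). ring. }
    replace (exp (- (5 * tau) * (2 * INR (S N)))) with (X * q ^ 5 * (X * q ^ 5)).
    2:{ unfold X, q. rewrite <- exp_mul_INR, <- !exp_plus. f_equal. rewrite (S_INR N). simpl (INR 5). ring. }
    set (A := rpoch (5 * tau) N) in *. set (B := rqprod (5 * tau) (/ q + q) N) in *.
    set (B' := rqprod (5 * tau) (/ q * / q + q * q) N) in *.
    set (Z := rpoch tau (5 * N + 2)) in *.
    transitivity ((1 - q) * (A * B) * ((1 - q * q) * (A * B')) * (1 - X * q ^ 5) ^ 2 *
      ((1 - X * q ^ 4) * (1 - X * q ^ 6)) * ((1 - X * q ^ 3) * (1 - X * q ^ 7))).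
    + field. auto.
    + rewrite IH. simpl (_ + _)%nat. ring.
Qed.

Lemma filterlim_5N (a : nat) : filterlim (fun N => (5 * N + a)%nat) eventually eventually.
Proof. intros P [N0 H]. exists N0. intros n Hn. apply H. lia. Qed.

Lemma g1_g2 tau : 0 < tau -> g1 tau * g2 tau = phi tau * phi (5 * tau).
Proof.
  intros Ht.
  pose proof (is_lim_seq_mult' _ _ _ _ (g1_prod tau Ht) (g2_prod tau Ht)) as H.
  apply (is_lim_seq_ext _ _ _ (g1_g2_finite tau)) in H.
  pose proof (is_lim_seq_mult' _ _ _ _
    (is_lim_seq_subseq _ _ _ (filterlim_5N 2) (proj1 (phi_spec tau Ht)))
    (proj1 (phi_spec (5 * tau) ltac:(lra)))) as H'.
  apply is_lim_seq_unique in H, H'. rewrite H in H'. congruence.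
Qed.

(** * Schur's identities *)

(* Schur's sum over lambda, split by the parity lambda = 2 mu or 2 mu + 1;
   s = 0 gives the numerators and s = 1 the denominators of the convergents. *)
Definition sa (s mu : Z) : R := IZR mu * (10 * IZR mu + 1 - 4 * IZR s).
Definition sb (s mu : Z) : R := sa s mu + 10 * IZR mu + 3 - 2 * IZR s.

Definition sidx1 (s : Z) (n : nat) (mu : Z) : Z := (Z.of_nat n / 2 + s - 5 * mu)%Z.
Definition sidx2 (s : Z) (n : nat) (mu : Z) : Z := ((Z.of_nat n - 1) / 2 - 2 + s - 5 * mu)%Z.

Definition sterm (tau th : R) (s : Z) (n : nat) (mu : Z) : C :=
  (zp tau th (sa s mu) * beta tau th n (sidx1 s n mu)
   - zp tau th (sb s mu) * beta tau th n (sidx2 s n mu))%C.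

(* The part of Schur's recurrence that does not cancel termwise; it telescopes in mu. *)
Definition sleft (tau th : R) (s : Z) (n : nat) (mu : Z) : C :=
  let k := (Z.of_nat (n / 2) + 1 + s - 5 * mu)%Z in
  if Nat.even n then (zp tau th (sa s mu) * (zp tau th (IZR k) * beta tau th n k))%C else 0%C.

Lemma sterm_rec tau th s n mu :
  sterm tau th s (S (S n)) mu =
  (sterm tau th s (S n) mu + zp tau th (INR n + 1) * sterm tau th s n mu
   + (sleft tau th s n mu - sleft tau th s n (mu + 1)))%C.
Proof.
  unfold sterm, sleft. destruct (Nat.Even_or_Odd n) as [[p Hp]|[p Hp]].
  - assert (Ev : Nat.even n = true) by (apply Nat.even_spec; now exists p).
    assert (Dv : (n / 2)%nat = p) by (subst n; now rewrite Nat.mul_comm, Nat.div_mul).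
    rewrite Ev, Dv. cbv zeta.
    set (k := (Z.of_nat p + 1 + s - 5 * mu)%Z).
    set (j := (Z.of_nat p - 2 + s - 5 * mu)%Z).
    replace (sidx1 s (S (S n)) mu) with k by (unfold sidx1, k; subst n; rewrite <- (Z.div_unique _ 2 (Z.of_nat p + 1) 0); lia).
    replace (sidx1 s (S n) mu) with (k - 1)%Z by (unfold sidx1, k; subst n; rewrite <- (Z.div_unique _ 2 (Z.of_nat p) 1); lia).
    replace (sidx1 s n mu) with (k - 1)%Z by (unfold sidx1, k; subst n; rewrite <- (Z.div_unique _ 2 (Z.of_nat p) 0); lia).
    replace (sidx2 s (S (S n)) mu) with j by (unfold sidx2, j; subst n; rewrite <- (Z.div_unique _ 2 (Z.of_nat p) 1); lia).
    replace (sidx2 s (S n) mu) with j by (unfold sidx2, j; subst n; rewrite <- (Z.div_unique _ 2 (Z.of_nat p) 0); lia).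
    replace (sidx2 s n mu) with (j - 1)%Z by (unfold sidx2, j; subst n; rewrite <- (Z.div_unique _ 2 (Z.of_nat p - 1) 1); lia).
    replace (Z.of_nat p + 1 + s - 5 * (mu + 1))%Z with (j - 1 - 1)%Z by (unfold j; lia).
    rewrite (beta_pascal tau th (S n) k), (beta_pascal' tau th n k).
    rewrite (beta_pascal' tau th (S n) j), (beta_pascal tau th n (j - 1)).
    assert (E1 : (zp tau th (IZR k) * zp tau th (INR n + 1 - IZR k) = zp tau th (INR n + 1))%C)
      by (rewrite <- zp_plus; f_equal; ring).
    assert (E2 : (zp tau th (INR (S n) + 1 - IZR j) * zp tau th (IZR (j - 1)) = zp tau th (INR n + 1))%C)
      by (rewrite <- zp_plus; f_equal; rewrite minus_IZR, S_INR; ring).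
    (* The leftover of the second binomial at mu equals that of the first at mu + 1. *)
    assert (E3 : (zp tau th (sb s mu) * zp tau th (INR (S n) + 1 - IZR j) =
                  zp tau th (sa s (mu + 1)) * zp tau th (IZR (j - 1 - 1)))%C).
    { rewrite <- !zp_plus. f_equal. unfold sb, sa, j. subst n.
      rewrite S_INR, mult_INR, !minus_IZR, !plus_IZR, !minus_IZR, mult_IZR, <- INR_IZR_INZ.
      simpl (INR 2). ring. }
    set (za := zp tau th (sa s mu)) in *. set (zb := zp tau th (sb s mu)) in *.
    rewrite (Cmult_assoc (zp tau th (sa s (mu + 1)))), <- E3, <- E1 at 1.
    transitivity (za * (beta tau th (S n) (k - 1) + zp tau th (IZR k) * beta tau th n k
      + (zp tau th (IZR k) * zp tau th (INR n + 1 - IZR k)) * beta tau th n (k - 1))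
      - zb * (beta tau th (S n) j + zp tau th (INR (S n) + 1 - IZR j) * beta tau th n (j - 1 - 1)
      + (zp tau th (INR (S n) + 1 - IZR j) * zp tau th (IZR (j - 1))) * beta tau th n (j - 1)))%C;
      [ring|].
    rewrite E2, E1. ring.
  - assert (Ev : Nat.even n = false).
    { rewrite <- Nat.negb_odd. replace (Nat.odd n) with true; [reflexivity|].
      symmetry; apply Nat.odd_spec; now exists p. }
    rewrite Ev.
    set (k := (Z.of_nat p + 1 + s - 5 * mu)%Z).
    replace (sidx1 s (S (S n)) mu) with k by (unfold sidx1, k; subst n; rewrite <- (Z.div_unique _ 2 (Z.of_nat p + 1) 1); lia).
    replace (sidx1 s (S n) mu) with k by (unfold sidx1, k; subst n; rewrite <- (Z.div_unique _ 2 (Z.of_nat p + 1) 0); lia).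
    replace (sidx1 s n mu) with (k - 1)%Z by (unfold sidx1, k; subst n; rewrite <- (Z.div_unique _ 2 (Z.of_nat p) 1); lia).
    replace (sidx2 s (S (S n)) mu) with (k - 1 - 1)%Z by (unfold sidx2, k; subst n; rewrite <- (Z.div_unique _ 2 (Z.of_nat p + 1) 0); lia).
    replace (sidx2 s (S n) mu) with (k - 1 - 1 - 1)%Z by (unfold sidx2, k; subst n; rewrite <- (Z.div_unique _ 2 (Z.of_nat p) 1); lia).
    replace (sidx2 s n mu) with (k - 1 - 1 - 1)%Z by (unfold sidx2, k; subst n; rewrite <- (Z.div_unique _ 2 (Z.of_nat p) 0); lia).
    set (j := (k - 1 - 1)%Z).
    rewrite (beta_pascal' tau th (S n) k), (beta_pascal tau th n (k - 1)).
    rewrite (beta_pascal tau th (S n) j), (beta_pascal' tau th n j).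
    replace (k - 1 - 1)%Z with j by reflexivity.
    assert (E1 : (zp tau th (IZR j) * zp tau th (INR n + 1 - IZR j) = zp tau th (INR n + 1))%C)
      by (rewrite <- zp_plus; f_equal; ring).
    assert (E2 : (zp tau th (INR (S n) + 1 - IZR k) * zp tau th (IZR (k - 1)) = zp tau th (INR n + 1))%C)
      by (rewrite <- zp_plus; f_equal; rewrite minus_IZR, S_INR; ring).
    assert (E3 : (zp tau th (sa s mu) * zp tau th (INR (S n) + 1 - IZR k) =
                  zp tau th (sb s mu) * zp tau th (IZR j))%C).
    { rewrite <- !zp_plus. f_equal. unfold sb, j, k. subst n.
      rewrite S_INR, plus_INR, mult_INR, !minus_IZR, !plus_IZR, mult_IZR, <- INR_IZR_INZ.
      simpl (INR 2). simpl (INR 1). ring. }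
    set (za := zp tau th (sa s mu)) in *. set (zb := zp tau th (sb s mu)) in *.
    transitivity (za * beta tau th (S n) k
      + (za * zp tau th (INR (S n) + 1 - IZR k)) * beta tau th n j
      + za * (zp tau th (INR (S n) + 1 - IZR k) * zp tau th (IZR (k - 1))) * beta tau th n (k - 1)
      - (zb * beta tau th (S n) (j - 1) + zb * zp tau th (IZR j) * beta tau th n j
      + zb * (zp tau th (IZR j) * zp tau th (INR n + 1 - IZR j)) * beta tau th n (j - 1)))%C;
      [ring|].
    rewrite E1, E2, E3. ring.
Qed.

(** The recurrence of the convergents of 1 + q/(1 + q^2/(1 + ...)): initial values 1, 1 give the
    numerators and 0, 1 the denominators, one index ahead of [cf_tail]. *)
Fixpoint schur (q a b : R) (n : nat) {struct n} : R :=
  match n with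
  | O => a
  | S O => b
  | S (S m as p) => schur q a b p + q ^ p * schur q a b m
  end.

Lemma sleft_out tau th s n mu : (0 <= s <= 1)%Z -> (Z.of_nat n + 3 < Z.abs mu)%Z ->
  sleft tau th s n mu = 0%C.
Proof.
  intros Hs H. unfold sleft. destruct (Nat.even n); auto.
  pose proof (Nat.Div0.div_le_upper_bound n 2 n ltac:(lia)).
  rewrite beta_out by lia. ring.
Qed.

(** Both sides obey the same two-step recurrence, the [sleft] part summing to a series minus its own
    shift, hence to 0. For n < 2 only mu = 0 contributes; 1 - s is then the initial value. *)
Lemma sterm_sum tau s n : (s = 0 \/ s = 1)%Z ->
  has_sumC (sterm tau 0 s n) (RtoC (schur (exp (- tau)) (1 - IZR s) 1 n)).
Proof.
  intros Hs.
  assert (Init : forall n, (n < 2)%nat -> forall v, sterm tau 0 s n 0 = RtoC v ->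
    has_sumC (sterm tau 0 s n) (RtoC v)).
  { intros m Hm v Hv.
    pose proof (has_sumC_finite (sterm tau 0 s m) [0%Z]) as H.
    cbn [lsum fold_right] in H. rewrite Hv in H.
    match type of H with _ -> _ -> has_sumC _ ?t => replace (RtoC v) with t end.
    - apply H; [repeat constructor; simpl; tauto|].
      intros k Hk. assert (k <> 0%Z) by (intros ->; apply Hk; now left).
      assert (A : (Z.of_nat m / 2 = 0)%Z) by (rewrite Z.div_small; lia).
      assert (B : (-1 <= (Z.of_nat m - 1) / 2 <= 0)%Z).
      { split; [apply Z.div_le_lower_bound|apply Z.div_le_upper_bound]; lia. }
      unfold sterm, sidx1, sidx2. rewrite A, !beta_out; [ring| |]; lia.
    - apply C_eq; simpl; ring. }
  assert (H2 : has_sumC (sterm tau 0 s n) (RtoC (schur (exp (- tau)) (1 - IZR s) 1 n)) /\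
    has_sumC (sterm tau 0 s (S n)) (RtoC (schur (exp (- tau)) (1 - IZR s) 1 (S n)))); [|apply H2].
  induction n as [|n [IH1 IH2]].
  - split; apply Init; try lia; unfold sterm, sidx1, sidx2, sa;
    destruct Hs as [-> | ->]; simpl; rewrite ?Rmult_0_l, ?zp_0; apply C_eq; simpl; ring.
  - split; auto.
    destruct (has_sumC_finite_ex (sleft tau 0 s n) (n + 3)) as [l Hl].
    { intros; apply sleft_out; lia. }
    assert (Hl' : has_sumC (fun mu => sleft tau 0 s n (mu + 1)) l).
    { apply (has_sumC_bij (fun k => (k - 1)%Z) (fun k => (k + 1)%Z)); try (intros; lia).
      eapply has_sumC_ext; [|exact Hl]. intros k. cbv beta. f_equal. lia. }
    pose proof (has_sumC_plus _ _ _ _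
      (has_sumC_plus _ _ _ _ IH2 (has_sumC_scal (zp tau 0 (INR n + 1)) _ _ IH1))
      (has_sumC_plus _ _ _ _ Hl (has_sumC_scal (- (1))%C _ _ Hl'))) as H.
    match type of H with has_sumC _ ?t =>
      replace (RtoC (schur (exp (- tau)) (1 - IZR s) 1 (S (S n)))) with t end.
    + eapply has_sumC_ext; [|exact H]. intros mu. cbv beta. rewrite sterm_rec. ring.
    + change (schur (exp (- tau)) (1 - IZR s) 1 (S (S n))) with
        (schur (exp (- tau)) (1 - IZR s) 1 (S n) + exp (- tau) ^ S n * schur (exp (- tau)) (1 - IZR s) 1 n).
      rewrite RtoC_plus, RtoC_mult, zp_real, <- S_INR, exp_mul_INR. ring.
Qed.

Lemma summable_inj {T U} (e : T -> U) (f : U -> R) :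
  (forall x y, e x = e y -> x = y) -> summable f -> summable (fun x => f (e x)).
Proof.
  intros inj [M HM]. exists M. intros l N.
  rewrite <- (lsum_map (fun u => Rabs (f u)) e). apply HM.
  apply NoDup_map_NoDup_ForallPairs; auto. intros x y _ _; apply inj.
Qed.

Lemma has_sum_even_odd (f : Z -> R) s : summable f -> has_sum f s ->
  has_sum (fun mu => f (2 * mu)%Z + f (2 * mu + 1)%Z) s.
Proof.
  intros S H.
  destruct (summable_has_sum (fun mu => f (2 * mu)%Z)) as [a Ha];
    [apply (summable_inj (fun mu => (2 * mu)%Z)); auto; intros; lia|].
  destruct (summable_has_sum (fun mu => f (2 * mu + 1)%Z)) as [b Hb];
    [apply (summable_inj (fun mu => (2 * mu + 1)%Z)); auto; intros; lia|].
  replace s with (a + b); [now apply has_sum_plus|].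
  apply (has_sum_unique f); auto.
  apply (has_sum_ext (fun k => (if Z.even k then f k else 0) + (if Z.even k then 0 else f k))).
  { intros k. destruct (Z.even k); ring. }
  apply has_sum_plus.
  - apply (has_sum_reindex (fun mu => (2 * mu)%Z)).
    + intros; lia.
    + intros u Hu. destruct (Z.even u) eqn:E; auto. apply Z.even_spec in E.
      destruct E as [v ->]. now destruct (Hu v).
    + eapply has_sum_ext; [|exact Ha]. intros k. cbv beta. now rewrite Z.even_mul.
  - apply (has_sum_reindex (fun mu => (2 * mu + 1)%Z)).
    + intros; lia.
    + intros u Hu. destruct (Z.even u) eqn:E; auto. rewrite <- Z.negb_odd in E.
      apply Bool.negb_false_iff, Z.odd_spec in E. destruct E as [v ->]. now destruct (Hu v).
    + eapply has_sum_ext; [|exact Hb]. intros k. cbv beta. now rewrite Z.even_add, Z.even_mul.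
Qed.

Lemma beta_lim_idx tau th (F : C) (idx : nat -> Z) : 0 < tau -> F <> 0%C ->
  is_limC (poch tau th) F ->
  (forall M, eventually (fun n => M <= idx n /\ M <= Z.of_nat n - idx n)%Z) ->
  is_limC (fun n => beta tau th n (idx n)) (/ F)%C.
Proof.
  intros Ht HF L H.
  eapply is_limC_ext_loc; [|apply (beta_lim tau th F (fun n => Z.to_nat (idx n))
    (fun n => Z.to_nat (Z.of_nat n - idx n)) Ht HF L)].
  - destruct (H 0%Z) as [N HN]. exists N. intros n Hn. specialize (HN n Hn). f_equal; lia.
  - intros P [N0 HP]. destruct (H (Z.of_nat N0)) as [N HN]. exists N. intros n Hn.
    apply HP. specialize (HN n Hn). lia.
  - intros P [N0 HP]. destruct (H (Z.of_nat N0)) as [N HN]. exists N. intros n Hn.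
    apply HP. specialize (HN n Hn). lia.
Qed.

Lemma phi_C tau : 0 < tau -> RtoC (phi tau) <> 0%C /\ is_limC (poch tau 0) (RtoC (phi tau)).
Proof.
  intros H. destruct (phi_spec tau H) as [L P]. split.
  - intros E. apply (f_equal Re) in E. simpl in E. lra.
  - split.
    + eapply is_lim_seq_ext; [|exact L]. intros n. now rewrite poch_real.
    + apply (is_lim_seq_ext (fun _ => 0)); [|apply is_lim_seq_const].
      intros n. now rewrite poch_real.
Qed.

(** As n grows every binomial tends to 1 / phi, and the exponents [sa], [sb] interleave as the even
    and odd terms of one theta series with alternating sign. *)
Lemma schur_lim tau s (e : Z -> R) g : 0 < tau -> (s = 0 \/ s = 1)%Z ->
  (forall mu, sa s mu = e (2 * mu)%Z /\ sb s mu = e (2 * mu + 1)%Z) ->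
  summable (fun k => sgn k * exp (- tau * e k)) ->
  has_sum (fun k => sgn k * exp (- tau * e k)) g ->
  is_lim_seq (schur (exp (- tau)) (1 - IZR s) 1) (g / phi tau).
Proof.
  intros Ht Hs He HS Hg.
  destruct (phi_C tau Ht) as [HF L]. destruct (beta_bound tau 0 Ht) as [K HK].
  set (f := fun k => sgn k * exp (- tau * e k)) in *.
  assert (f0 : forall mu, Rabs (f (2 * mu)%Z) = exp (- tau * sa s mu)).
  { intros mu. unfold f. rewrite Rabs_mult, Rabs_sgn, Rabs_pos_eq by (left; apply exp_pos).
    rewrite (proj1 (He mu)). ring. }
  assert (f1 : forall mu, Rabs (f (2 * mu + 1)%Z) = exp (- tau * sb s mu)).
  { intros mu. unfold f. rewrite Rabs_mult, Rabs_sgn, Rabs_pos_eq by (left; apply exp_pos).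
    rewrite (proj2 (He mu)). ring. }
  destruct (tanneryC (fun n mu => sterm tau 0 s n mu)
    (fun mu => (zp tau 0 (sa s mu) * / RtoC (phi tau) - zp tau 0 (sb s mu) * / RtoC (phi tau))%C)
    (fun mu => K * (Rabs (f (2 * mu)%Z) + Rabs (f (2 * mu + 1)%Z)))
    (fun n => RtoC (schur (exp (- tau)) (1 - IZR s) 1 n))) as [t [H1 H2]].
  - apply summable_scal, summable_plus.
    + apply (summable_le _ (fun mu => Rabs (f (2 * mu)%Z))); [intros; rewrite Rabs_Rabsolu; lra|].
      destruct HS as [M HM]. apply (summable_inj (fun mu => (2 * mu)%Z) (fun k => Rabs (f k))); [intros; lia|].
      exists M. intros l N. eapply Rle_trans; [|apply (HM l N)].
      apply lsum_le. intros; rewrite Rabs_Rabsolu; lra.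
    + apply (summable_le _ (fun mu => Rabs (f (2 * mu + 1)%Z))); [intros; rewrite Rabs_Rabsolu; lra|].
      destruct HS as [M HM]. apply (summable_inj (fun mu => (2 * mu + 1)%Z) (fun k => Rabs (f k))); [intros; lia|].
      exists M. intros l N. eapply Rle_trans; [|apply (HM l N)].
      apply lsum_le. intros; rewrite Rabs_Rabsolu; lra.
  - intros n mu. unfold sterm, Cminus. eapply Rle_trans; [apply Cmod_triangle|].
    rewrite Cmod_opp, !Cmod_mult, !Cmod_zp, f0, f1, Rmult_plus_distr_l.
    apply Rplus_le_compat; rewrite Rmult_comm; apply Rmult_le_compat_r; auto; left; apply exp_pos.
  - intros mu. unfold sterm, Cminus. apply is_limC_plus.
    + apply is_limC_mult; [apply is_limC_const|]. apply beta_lim_idx; auto.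
      intros M. exists (Z.to_nat (2 * (Z.abs M + 10 + 5 * Z.abs mu))). intros n Hn. unfold sidx1.
      pose proof (Z.div_mod (Z.of_nat n) 2 ltac:(lia)).
      pose proof (Z.mod_pos_bound (Z.of_nat n) 2 ltac:(lia)). lia.
    + apply (is_limC_ext (fun n => (- (1) * (zp tau 0 (sb s mu) * beta tau 0 n (sidx2 s n mu)))%C)); [intros; ring|].
      replace (- (zp tau 0 (sb s mu) * / RtoC (phi tau)))%C with (- (1) * (zp tau 0 (sb s mu) * / RtoC (phi tau)))%C by ring.
      apply is_limC_mult; [apply is_limC_const|].
      apply is_limC_mult; [apply is_limC_const|]. apply beta_lim_idx; auto.
      intros M. exists (Z.to_nat (2 * (Z.abs M + 10 + 5 * Z.abs mu))). intros n Hn. unfold sidx2.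
      pose proof (Z.div_mod (Z.of_nat n - 1) 2 ltac:(lia)).
      pose proof (Z.mod_pos_bound (Z.of_nat n - 1) 2 ltac:(lia)). lia.
  - intros n. now apply sterm_sum.
  - assert (E : Re t = g / phi tau).
    { destruct H1 as [H1 _].
      apply (has_sum_unique _ _ _ H1).
      pose proof (has_sum_scal (/ phi tau) _ _ (has_sum_even_odd f g HS Hg)) as H.
      replace (g / phi tau) with (/ phi tau * g) by (unfold Rdiv; ring).
      eapply has_sum_ext; [|exact H]. intros mu. cbv beta.
      rewrite !zp_real, <- RtoC_inv, <- !RtoC_mult, <- RtoC_minus.
      2:{ intros E; apply HF; now rewrite E. }
      unfold f. rewrite sgn_plus, sgn_double, sgn_1, (proj1 (He mu)), (proj2 (He mu)).
      simpl. ring. }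
    rewrite <- E. exact (proj1 H2).
Qed.

Lemma schur_lim_g2 tau : 0 < tau -> is_lim_seq (schur (exp (- tau)) 1 1) (g2 tau / phi tau).
Proof.
  intros Ht. replace 1 with (1 - IZR 0) at 1 by (simpl; ring).
  apply (schur_lim tau 0%Z e2); auto using summable_g2.
  - intros mu. unfold sb, sa, e2. rewrite !plus_IZR, !mult_IZR. split; field.
  - apply has_sum_zsum, summable_g2, Ht.
Qed.

Lemma schur_lim_g1 tau : 0 < tau -> is_lim_seq (schur (exp (- tau)) 0 1) (g1 tau / phi tau).
Proof.
  intros Ht. replace 0 with (1 - IZR 1) at 1 by (simpl; ring).
  (* The index is reversed: [sa] at s = 1 is 10 mu^2 - 3 mu, which is e1 (- 2 mu). *)
  apply (schur_lim tau 1%Z (fun k => e1 (- k)%Z)); auto.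
  - intros mu. unfold sb, sa, e1. rewrite !opp_IZR, !plus_IZR, !mult_IZR. split; field.
  - apply (summable_ext (fun k => sgn (- k) * exp (- tau * e1 (- k)%Z))); [intros; now rewrite sgn_opp|].
    apply (summable_inj Z.opp (fun k => sgn k * exp (- tau * e1 k))); [intros; lia|].
    now apply summable_g1.
  - apply (has_sum_bij Z.opp Z.opp); try (intros; lia).
    eapply has_sum_ext; [|apply has_sum_zsum, (summable_g1 tau Ht)].
    intros k. cbv beta. now rewrite sgn_opp, Z.opp_involutive.
Qed.

(* cf_tail with the innermost denominator 1 replaced by x, so that the continued fraction
   can be unfolded from its inner end. *)
Fixpoint cf_end (q : R) (n k : nat) (x : R) : R :=
  match n with
  | O => x
  | S m => 1 + q ^ k / cf_end q m (S k) x
  end.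

Lemma cf_tail_end q n k : cf_tail q n k = cf_end q n k 1.
Proof. revert k; induction n as [|n IH]; intros k; simpl; [reflexivity|now rewrite IH]. Qed.

Lemma cf_end_S q n k x : cf_end q (S n) k x = cf_end q n k (1 + q ^ (k + n) / x).
Proof.
  revert k; induction n as [|n IH]; intros k.
  - simpl. now rewrite Nat.add_0_r.
  - change (cf_end q (S (S n)) k x) with (1 + q ^ k / cf_end q (S n) (S k) x).
    rewrite IH. simpl. do 4 f_equal. now rewrite Nat.add_succ_r.
Qed.

Lemma schur_SS q a b n : schur q a b (S (S n)) = schur q a b (S n) + q ^ S n * schur q a b n.
Proof. reflexivity. Qed.

Lemma schur_pos q a n : 0 < q -> 0 <= a -> 0 <= schur q a 1 n /\ 0 < schur q a 1 (S n).
Proof.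
  intros Hq Ha. induction n as [|n [I1 I2]]; [simpl; lra|]. split; [lra|].
  rewrite schur_SS. pose proof (pow_lt q (S n) Hq). nra.
Qed.

(** A finite continued fraction is a Moebius function of its innermost denominator, with consecutive
    convergents as coefficients; substituting 1 + q^k / x for x performs one step of their
    recurrence. *)
Lemma cf_end_schur q n x : 0 < q -> 0 < x ->
  cf_end q (S n) 1 x = (x * schur q 1 1 (S n) + q ^ S n * schur q 1 1 n) /
                       (x * schur q 0 1 (S n) + q ^ S n * schur q 0 1 n).
Proof.
  intros Hq. revert x; induction n as [|n IH]; intros x Hx.
  - simpl. field. lra.
  - rewrite cf_end_S, IH, !schur_SS.
    + pose proof (schur_pos q 0 n Hq ltac:(lra)) as [P1 P2].
      pose proof (pow_lt q (S n) Hq). pose proof (pow_lt q (S (S n)) Hq).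
      replace (1 + S n)%nat with (S (S n)) by lia.
      assert (0 <= q ^ S n * schur q 0 1 n) by nra.
      field. repeat split; try lra; apply Rgt_not_eq; nra.
    + assert (0 < q ^ (1 + S n) / x) by (apply Rdiv_lt_0_compat; auto; now apply pow_lt). lra.
Qed.

Lemma cf_tail_schur q n : 0 < q -> cf_tail q n 1 = schur q 1 1 (S n) / schur q 0 1 (S n).
Proof.
  intros Hq. rewrite cf_tail_end. destruct n as [|n]; [simpl; field|].
  rewrite cf_end_schur, !schur_SS by lra. now rewrite !Rmult_1_l.
Qed.

(** * The quintic relation for R *)

(** As limits of nonnegative Schur polynomials both series are nonnegative, and neither vanishes
    because their product is phi(tau) phi(5 tau) > 0. *)
Lemma g_pos tau : 0 < tau -> 0 < g1 tau /\ 0 < g2 tau.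
Proof.
  intros Ht. destruct (phi_spec tau Ht) as [_ P]. destruct (phi_spec (5 * tau) ltac:(lra)) as [_ P5].
  pose proof (g1_g2 tau Ht) as E.
  assert (G : forall a g, 0 <= a -> is_lim_seq (schur (exp (- tau)) a 1) (g / phi tau) -> 0 <= g).
  { intros a g Ha L.
    assert (0 <= g / phi tau).
    { apply (is_lim_seq_le (fun _ => 0) (schur (exp (- tau)) a 1) 0 (g / phi tau)); auto.
      - intros n. apply schur_pos; auto. apply exp_pos.
      - apply is_lim_seq_const. }
    replace g with (g / phi tau * phi tau) by (field; lra). nra. }
  pose proof (G 0 (g1 tau) ltac:(lra) (schur_lim_g1 tau Ht)).
  pose proof (G 1 (g2 tau) ltac:(lra) (schur_lim_g2 tau Ht)).
  assert (0 < g1 tau * g2 tau) by (rewrite E; nra).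
  split; nra.
Qed.

Lemma cf_tail_lim tau : 0 < tau ->
  is_lim_seq (fun n => cf_tail (exp (- tau)) n 1) (g2 tau / g1 tau).
Proof.
  intros Ht. destruct (phi_spec tau Ht) as [_ P]. destruct (g_pos tau Ht) as [G1 G2].
  pose proof (proj1 (is_lim_seq_incr_1 _ _) (schur_lim_g2 tau Ht)) as L2.
  pose proof (proj1 (is_lim_seq_incr_1 _ _) (schur_lim_g1 tau Ht)) as L1.
  assert (N : g1 tau / phi tau <> 0) by (apply Rgt_not_eq, Rdiv_lt_0_compat; lra).
  pose proof (is_lim_seq_div' _ _ _ _ L2 L1 N) as L.
  replace (g2 tau / g1 tau) with (g2 tau / phi tau / (g1 tau / phi tau)) by (field; lra).
  eapply is_lim_seq_ext; [|exact L]. intros n. cbv beta.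
  symmetry. apply cf_tail_schur, exp_pos.
Qed.

Lemma Rpower_exp x y : Rpower (exp x) y = exp (y * x).
Proof. unfold Rpower. now rewrite ln_exp. Qed.

Lemma RR_exp tau : 0 < tau -> RR (exp (- tau)) = exp (- tau / 5) * (g1 tau / g2 tau).
Proof.
  intros Ht. destruct (g_pos tau Ht) as [G1 G2].
  pose proof (cf_tail_lim tau Ht) as L.
  assert (N : g2 tau / g1 tau <> 0) by (apply Rgt_not_eq, Rdiv_lt_0_compat; lra).
  pose proof (is_lim_seq_div' _ _ _ _ (is_lim_seq_const (Rpower (exp (- tau)) (1 / 5))) L N) as H.
  unfold RR. apply is_lim_seq_unique in H. rewrite H. simpl.
  rewrite Rpower_exp. replace (1 / 5 * - tau) with (- tau / 5) by field. field. lra.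
Qed.

Lemma cf_tail_ge_1 q n k : 0 < q -> 1 <= cf_tail q n k.
Proof.
  intros Hq. revert k; induction n as [|n IH]; intros k; simpl; [lra|].
  specialize (IH (S k)). pose proof (pow_lt q k Hq).
  assert (0 < q ^ k / cf_tail q n (S k)) by (apply Rdiv_lt_0_compat; lra). lra.
Qed.

Lemma g1_le_g2 tau : 0 < tau -> g1 tau <= g2 tau.
Proof.
  intros Ht. destruct (g_pos tau Ht) as [G1 G2].
  assert (1 <= g2 tau / g1 tau).
  { apply (is_lim_seq_le (fun _ => 1) (fun n => cf_tail (exp (- tau)) n 1) 1 (g2 tau / g1 tau)).
    - intros n. apply cf_tail_ge_1, exp_pos.
    - apply is_lim_seq_const.
    - now apply cf_tail_lim. }
  apply (Rmult_le_compat_r (g1 tau)) in H; [|lra].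
  unfold Rdiv in H. rewrite Rmult_assoc, Rinv_l in H by lra. lra.
Qed.

(** * Fifth roots of unity and fifth roots of the nome *)

Lemma cos_sin_2PI_Z m : cos (2 * PI * IZR m) = 1 /\ sin (2 * PI * IZR m) = 0.
Proof.
  assert (P : forall n, cos (2 * PI * INR n) = 1 /\ sin (2 * PI * INR n) = 0).
  { intros n. replace (2 * PI * INR n) with (0 + 2 * INR n * PI) by ring.
    rewrite cos_period, sin_period. split; [apply cos_0|apply sin_0]. }
  destruct (Z_le_gt_dec 0 m).
  - rewrite <- (Z2Nat.id m), <- INR_IZR_INZ by lia. apply P.
  - replace m with (- Z.of_nat (Z.to_nat (- m)))%Z by lia.
    rewrite opp_IZR, <- INR_IZR_INZ, Ropp_mult_distr_r_reverse, cos_neg, sin_neg.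
    destruct (P (Z.to_nat (- m))) as [-> ->]. split; ring.
Qed.

(* om r is the r-th power of exp (2 i pi / 5). *)
Definition om (r : nat) : C := (cos (2 * PI / 5 * INR r), sin (2 * PI / 5 * INR r)).

Lemma om_plus a b : om (a + b) = (om a * om b)%C.
Proof.
  unfold om, Cmult; simpl. rewrite plus_INR, Rmult_plus_distr_l, cos_plus, sin_plus.
  f_equal; ring.
Qed.

Lemma om_mul5 k : om (5 * k) = 1%C.
Proof.
  unfold om. rewrite mult_INR. simpl (INR 5).
  replace (2 * PI / 5 * ((1 + 1 + 1 + 1 + 1) * INR k)) with (2 * PI * IZR (Z.of_nat k))
    by (rewrite <- INR_IZR_INZ; field).
  destruct (cos_sin_2PI_Z (Z.of_nat k)) as [-> ->]. reflexivity.
Qed.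

Lemma om_mod n : om n = om (n mod 5).
Proof.
  rewrite (Nat.div_mod_eq n 5) at 1. rewrite om_plus, om_mul5. ring.
Qed.

Lemma om_sum : (1 + om 1 + om 2 + om 3 + om 4 = 0)%C.
Proof.
  assert (H : ((1 - om 1) * (1 + om 1 + om 2 + om 3 + om 4) = 0)%C).
  { replace ((1 - om 1) * (1 + om 1 + om 2 + om 3 + om 4))%C with
      (1 + om 1 + om 2 + om 3 + om 4 - (om 1 + om 1 * om 1 + om 1 * om 2 + om 1 * om 3 + om 1 * om 4))%C by ring.
    rewrite <- !om_plus. simpl (_ + _)%nat. change (om 5) with (om (5 * 1)). rewrite om_mul5. ring. }
  assert (N : (1 - om 1 <> 0)%C).
  { intros E. apply (f_equal Im) in E. unfold om in E. simpl in E.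
    assert (0 < sin (2 * PI / 5 * 1)); [|lra].
    pose proof PI_RGT_0. apply sin_gt_0; lra. }
  apply Cmod_eq_0. apply (f_equal Cmod) in H. rewrite Cmod_mult, Cmod_0 in H.
  apply Rmult_integral in H. destruct H as [H|H]; auto. apply Cmod_eq_0 in H. contradiction.
Qed.

(** Pairing inverse roots leaves two quadratic factors with coefficients u and v, the periods om 1 +
    om 4 and om 2 + om 3, whose sum and product are both -1. *)
Lemma cyclotomic5 (a b : C) :
  ((a - b) * (a - om 1 * b) * (a - om 2 * b) * (a - om 3 * b) * (a - om 4 * b)
   = a * a * a * a * a - b * b * b * b * b)%C.
Proof.
  set (u := (om 1 + om 4)%C). set (v := (om 2 + om 3)%C).
  assert (S : (u + v = - (1))%C).
  { unfold u, v. transitivity (1 + om 1 + om 2 + om 3 + om 4 - 1)%C; [ring|rewrite om_sum; ring]. }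
  assert (P : (u * v = - (1))%C).
  { unfold u, v. replace ((om 1 + om 4) * (om 2 + om 3))%C with
      (om 1 * om 2 + om 1 * om 3 + om 4 * om 2 + om 4 * om 3)%C by ring.
    rewrite <- !om_plus. rewrite (om_mod (4 + 2)), (om_mod (4 + 3)). simpl (_ mod _)%nat. simpl (_ + _)%nat.
    transitivity (1 + om 1 + om 2 + om 3 + om 4 - 1)%C; [ring|rewrite om_sum; ring]. }
  assert (E1 : (om 1 * om 4 = 1)%C) by (rewrite <- om_plus; exact (om_mul5 1)).
  assert (E2 : (om 2 * om 3 = 1)%C) by (rewrite <- om_plus; exact (om_mul5 1)).
  transitivity ((a - b) * (a * a - u * a * b + (om 1 * om 4) * b * b) * (a * a - v * a * b + (om 2 * om 3) * b * b))%C.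
  { unfold u, v; ring. }
  rewrite E1, E2.
  transitivity ((a - b) * (a * a * a * a - (u + v) * a * a * a * b + (1 + 1 + u * v) * a * a * b * b
    - (u + v) * a * b * b * b + b * b * b * b))%C; [ring|].
  rewrite S, P. ring.
Qed.

(* Real powers of the j-th fifth root of e^{-tau}. *)
Definition zj (tau : R) (j : nat) (x : R) : C := zp (tau / 5) (2 * PI * INR j / 5) x.

Lemma zj_nat tau j n :
  zj tau j (INR n) = (RtoC (exp (- (tau / 5) * INR n)) * om ((j * n) mod 5))%C.
Proof.
  rewrite <- om_mod. unfold zj, zp, om. rewrite mult_INR.
  replace (2 * PI * INR j / 5 * INR n) with (2 * PI / 5 * (INR j * INR n)) by field.
  unfold RtoC, Cmult; simpl. f_equal; ring.
Qed.

Lemma zj_5Z tau j m : zj tau j (5 * IZR m) = RtoC (exp (- tau * IZR m)).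
Proof.
  unfold zj, zp.
  replace (2 * PI * INR j / 5 * (5 * IZR m)) with (2 * PI * IZR (Z.of_nat j * m))
    by (rewrite mult_IZR, <- INR_IZR_INZ; field).
  destruct (cos_sin_2PI_Z (Z.of_nat j * m)) as [-> ->].
  replace (- (tau / 5) * (5 * IZR m)) with (- tau * IZR m) by field.
  unfold RtoC. f_equal; ring.
Qed.

(** Integrality of the exponents makes the power 5 e2 n of a fifth root of q independent of the root
    chosen; likewise for [e1]. *)
Lemma e2_int n : exists m, e2 n = IZR m.
Proof.
  assert (H : exists m, (5 * n * n + n = 2 * m)%Z).
  { destruct (Z.Even_or_Odd n) as [[p ->]|[p ->]].
    - exists (10 * p * p + p)%Z. ring.
    - exists (10 * p * p + 11 * p + 3)%Z. ring. }
  destruct H as [m H]. exists m. apply (f_equal IZR) in H.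
  rewrite plus_IZR, !mult_IZR in H. unfold e2. simpl. lra.
Qed.

Lemma e1_int n : exists m, e1 n = IZR m.
Proof.
  assert (H : exists m, (5 * n * n + 3 * n = 2 * m)%Z).
  { destruct (Z.Even_or_Odd n) as [[p ->]|[p ->]].
    - exists (10 * p * p + 3 * p)%Z. ring.
    - exists (10 * p * p + 13 * p + 4)%Z. ring. }
  destruct H as [m H]. exists m. apply (f_equal IZR) in H.
  rewrite plus_IZR, !mult_IZR in H. unfold e1. simpl. lra.
Qed.

Lemma zj_e2 tau j n : zj tau j (5 * e2 n) = RtoC (exp (- tau * e2 n)).
Proof. destruct (e2_int n) as [m ->]. apply zj_5Z. Qed.

Lemma zj_e1 tau j n : zj tau j (1 + 5 * e1 n) = (zj tau j 1 * RtoC (exp (- tau * e1 n)))%C.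
Proof.
  destruct (e1_int n) as [m ->]. unfold zj. rewrite zp_plus. f_equal. apply zj_5Z.
Qed.

(* The values (w^{k+1} - w^{-k}) / (w - 1) at a primitive fifth root of unity w, where
   c = w + 1/w is a root of c^2 + c - 1. *)
Definition dper (c : R) (k : Z) : R :=
  match (k mod 5)%Z with
  | 0%Z => 1 | 1%Z => 1 + c | 2%Z => 0 | 3%Z => - (1 + c) | _ => -1
  end.

Lemma mod5_cases k : exists m r, (k = 5 * m + r)%Z /\ (r = 0 \/ r = 1 \/ r = 2 \/ r = 3 \/ r = 4)%Z.
Proof.
  exists (k / 5)%Z, (k mod 5)%Z. split; [apply Z.div_mod; lia|].
  pose proof (Z.mod_pos_bound k 5 ltac:(lia)). lia.
Qed.

Lemma mod5_eq m r : (0 <= r < 5)%Z -> ((5 * m + r) mod 5 = r)%Z.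
Proof. intros H. symmetry. apply Z.mod_unique with m; lia. Qed.

Lemma dper_rec c k : c ^ 2 + c = 1 -> dper c (k + 1) + dper c (k - 1) = c * dper c k.
Proof.
  intros Hc. destruct (mod5_cases k) as [m [r [-> Hr]]]. unfold dper.
  destruct Hr as [->|[->|[->|[->| ->]]]].
  - replace (5 * m + 0 - 1)%Z with (5 * (m - 1) + 4)%Z by lia.
    replace (5 * m + 0 + 1)%Z with (5 * m + 1)%Z by lia. rewrite !mod5_eq by lia. lra.
  - replace (5 * m + 1 - 1)%Z with (5 * m + 0)%Z by lia.
    replace (5 * m + 1 + 1)%Z with (5 * m + 2)%Z by lia. rewrite !mod5_eq by lia. simpl in Hc. lra.
  - replace (5 * m + 2 - 1)%Z with (5 * m + 1)%Z by lia.
    replace (5 * m + 2 + 1)%Z with (5 * m + 3)%Z by lia. rewrite !mod5_eq by lia. lra.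
  - replace (5 * m + 3 - 1)%Z with (5 * m + 2)%Z by lia.
    replace (5 * m + 3 + 1)%Z with (5 * m + 4)%Z by lia. rewrite !mod5_eq by lia. simpl in Hc. lra.
  - replace (5 * m + 4 - 1)%Z with (5 * m + 3)%Z by lia.
    replace (5 * m + 4 + 1)%Z with (5 * (m + 1) + 0)%Z by lia. rewrite !mod5_eq by lia. lra.
Qed.

Lemma dper_bound c k : Rabs (dper c k) <= 1 + Rabs (1 + c).
Proof.
  destruct (mod5_cases k) as [m [r [-> Hr]]]. unfold dper.
  pose proof (Rabs_pos (1 + c)).
  destruct Hr as [->|[->|[->|[->| ->]]]]; rewrite mod5_eq by lia.
  - rewrite Rabs_R1; lra.
  - lra.
  - rewrite Rabs_R0; lra.
  - rewrite Rabs_Ropp; lra.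
  - unfold Rabs at 1; destruct Rcase_abs; lra.
Qed.

Lemma has_sumC_RtoC {T} (f : T -> R) s : has_sum f s -> has_sumC (fun x => RtoC (f x)) (RtoC s).
Proof.
  intros H. split; [exact H|]. simpl.
  pose proof (has_sum_scal 0 _ _ H) as H0. rewrite Rmult_0_l in H0.
  eapply has_sum_ext; [|exact H0]. intros; cbv beta; ring.
Qed.

Lemma has_sumC_mod5 (f : Z -> C) r s :
  has_sumC (fun n => f (5 * n + r)%Z) s ->
  has_sumC (fun k => if Z.eqb ((k - r) mod 5) 0 then f k else 0%C) s.
Proof.
  intros [A B].
  assert (inj : forall x y, (5 * x + r = 5 * y + r -> x = y)%Z) by (intros; lia).
  assert (H0 : forall n, ((5 * n + r - r) mod 5 =? 0)%Z = true).
  { intros n. replace (5 * n + r - r)%Z with (5 * n + 0)%Z by lia. rewrite mod5_eq by lia. reflexivity. }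
  assert (Hn : forall u, (forall n, (5 * n + r)%Z <> u) -> ((u - r) mod 5 =? 0)%Z = false).
  { intros u Hu. apply Z.eqb_neq. intros E. apply (Hu ((u - r) / 5)%Z).
    pose proof (Z.div_mod (u - r) 5 ltac:(lia)). lia. }
  split.
  - apply (has_sum_reindex (fun n => (5 * n + r)%Z)); auto.
    + intros u Hu. now rewrite Hn.
    + eapply has_sum_ext; [|exact A]. intros n. cbv beta. now rewrite H0.
  - apply (has_sum_reindex (fun n => (5 * n + r)%Z)); auto.
    + intros u Hu. now rewrite Hn.
    + eapply has_sum_ext; [|exact B]. intros n. cbv beta. now rewrite H0.
Qed.

Lemma sgn_5 n : sgn (5 * n) = sgn n.
Proof. unfold sgn. now rewrite Z.even_mul. Qed.

Lemma has_sum_opp (f : Z -> R) s : has_sum f s -> has_sum (fun k => f (- k)%Z) s.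
Proof.
  intros H. apply (has_sum_bij Z.opp Z.opp); try (intros; lia).
  eapply has_sum_ext; [|exact H]. intros; now rewrite Z.opp_involutive.
Qed.

(** The residues 0 and -1 of k modulo 5 have tri k = 5 e2 (n) and 5 e2 (- n), the residues 1 and -2
    have 1 + 5 e1 (n) and 1 + 5 e1 (- n), and [dper] vanishes on the residue 2. Each theta series
    thus occurs twice. *)
Lemma theta_dissection tau j c : 0 < tau ->
  has_sumC (fun k => (RtoC (sgn k * dper c k) * zj tau j (tri k))%C)
   (RtoC 2 * (RtoC (g2 tau) - RtoC (1 + c) * zj tau j 1 * RtoC (g1 tau)))%C.
Proof.
  intros Ht.
  pose proof (has_sum_zsum _ (summable_g1 tau Ht)) as G1. fold (g1 tau) in G1.
  pose proof (has_sum_zsum _ (summable_g2 tau Ht)) as G2. fold (g2 tau) in G2.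
  set (f := fun k => (RtoC (sgn k * dper c k) * zj tau j (tri k))%C).
  set (w := (RtoC (1 + c) * zj tau j 1)%C).
  assert (A0 : has_sumC (fun n => f (5 * n + 0)%Z) (RtoC (g2 tau))).
  { eapply has_sumC_ext; [|apply has_sumC_RtoC, G2]. intros n. unfold f, dper.
    rewrite mod5_eq, Z.add_0_r, sgn_5 by lia.
    replace (tri (5 * n)) with (5 * e2 n) by (unfold tri, e2; rewrite mult_IZR; field).
    rewrite zj_e2, <- RtoC_mult. f_equal. ring. }
  assert (A4 : has_sumC (fun n => f (5 * n + -1)%Z) (RtoC (g2 tau))).
  { eapply has_sumC_ext; [|apply has_sumC_RtoC, has_sum_opp, G2]. intros n. unfold f, dper. cbv beta.
    rewrite sgn_plus, sgn_5, sgn_opp, sgn_m1.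
    replace (5 * n + -1)%Z with (5 * (n - 1) + 4)%Z by lia. rewrite mod5_eq by lia.
    replace (tri (5 * (n - 1) + 4)) with (5 * e2 (- n)) by
      (unfold tri, e2; rewrite plus_IZR, mult_IZR, minus_IZR, opp_IZR; field).
    rewrite zj_e2, <- RtoC_mult. f_equal. ring. }
  assert (A1 : has_sumC (fun n => f (5 * n + 1)%Z) (- w * RtoC (g1 tau))%C).
  { eapply has_sumC_ext; [|apply has_sumC_scal, has_sumC_RtoC, G1]. intros n. unfold f, dper. cbv beta.
    rewrite sgn_plus, sgn_5, sgn_1, mod5_eq by lia.
    replace (tri (5 * n + 1)) with (1 + 5 * e1 n) by (unfold tri, e1; rewrite plus_IZR, mult_IZR; field).
    rewrite zj_e1. unfold w. rewrite !RtoC_mult, RtoC_m1. ring. }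
  assert (A3 : has_sumC (fun n => f (5 * n + -2)%Z) (- w * RtoC (g1 tau))%C).
  { eapply has_sumC_ext; [|apply has_sumC_scal, has_sumC_RtoC, has_sum_opp, G1]. intros n. unfold f, dper. cbv beta.
    rewrite sgn_plus, sgn_5, sgn_opp. change (sgn (-2)) with 1.
    replace (5 * n + -2)%Z with (5 * (n - 1) + 3)%Z by lia. rewrite mod5_eq by lia.
    replace (tri (5 * (n - 1) + 3)) with (1 + 5 * e1 (- n)) by
      (unfold tri, e1; rewrite plus_IZR, mult_IZR, minus_IZR, opp_IZR; field).
    rewrite zj_e1. unfold w. rewrite !RtoC_mult, RtoC_opp. ring. }
  pose proof (has_sumC_plus _ _ _ _
    (has_sumC_plus _ _ _ _ (has_sumC_mod5 f _ _ A0) (has_sumC_mod5 f _ _ A4))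
    (has_sumC_plus _ _ _ _ (has_sumC_mod5 f _ _ A1) (has_sumC_mod5 f _ _ A3))) as H.
  match type of H with has_sumC _ ?t =>
    replace (RtoC 2 * (RtoC (g2 tau) - w * RtoC (g1 tau)))%C with t end.
  2:{ replace (RtoC 2) with (1 + 1)%C by (apply C_eq; simpl; ring). ring. }
  eapply has_sumC_ext; [|exact H]. intros k. cbv beta.
  assert (Hf : (k mod 5 = 2)%Z -> f k = 0%C).
  { intros E. unfold f, dper. rewrite E. rewrite Rmult_0_r. ring. }
  destruct (mod5_cases k) as [m [r [E Hr]]].
  assert (Ek : (k mod 5 = r)%Z) by (rewrite E; apply mod5_eq; lia).
  assert (D : forall a b, (k - a = 5 * b)%Z -> ((k - a) mod 5 =? 0)%Z = true).
  { intros a b Eb. rewrite Eb, <- (Z.add_0_r (5 * b)), mod5_eq by lia. reflexivity. }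
  assert (D' : forall a b r', (k - a = 5 * b + r')%Z -> (0 < r' < 5)%Z -> ((k - a) mod 5 =? 0)%Z = false).
  { intros a b r' Eb Hb. rewrite Eb, mod5_eq by lia. apply Z.eqb_neq. lia. }
  destruct Hr as [->|[->|[->|[->| ->]]]].
  - rewrite (D 0 m)%Z, (D' (-1) m 1)%Z, (D' 1 (m-1) 4)%Z, (D' (-2) m 2)%Z by lia. ring.
  - rewrite (D' 0 m 1)%Z, (D' (-1) m 2)%Z, (D 1 m)%Z, (D' (-2) m 3)%Z by lia. ring.
  - rewrite (D' 0 m 2)%Z, (D' (-1) m 3)%Z, (D' 1 m 1)%Z, (D' (-2) m 4)%Z by lia.
    rewrite Hf by assumption. ring.
  - rewrite (D' 0 m 3)%Z, (D' (-1) m 4)%Z, (D' 1 m 2)%Z, (D (-2) (m+1))%Z by lia. ring.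
  - rewrite (D' 0 m 4)%Z, (D (-1) (m+1))%Z, (D' 1 m 3)%Z, (D' (-2) (m+1) 1)%Z by lia. ring.
Qed.

Lemma theta_zeta_prod tau j c : 0 < tau -> c ^ 2 + c = 1 ->
  is_limC (fun N => (poch (tau / 5) (2 * PI * INR j / 5) N * qprod (tau / 5) (2 * PI * INR j / 5) c N)%C)
    (RtoC (g2 tau) - RtoC (1 + c) * zj tau j 1 * RtoC (g1 tau))%C.
Proof.
  intros Ht Hc.
  destruct (jacobi_triple (tau / 5) (2 * PI * INR j / 5) (dper c) c ltac:(lra)) as [s [H1 H2]].
  - intros k. now apply dper_rec.
  - apply summable_theta with (1 + Rabs (1 + c)); [lra|apply growing_tri|].
    intros k. cbv beta. rewrite Rabs_Rabsolu. eapply Rle_trans; [apply dper_bound|].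
    pose proof (pow_ge_1 (tri k) 4 (proj1 (growing_tri k))). pose proof (Rabs_pos (1 + c)). nra.
  - rewrite (has_sumC_unique _ _ _ H1 (theta_dissection tau j c Ht)) in H2.
    (* This prefactor of the triple product cancels the 2 of the dissection. *)
    assert (D2 : dper c 0 - dper c (-1) = 2) by (unfold dper; simpl; lra). rewrite D2 in H2.
    apply (is_limC_mult (fun _ => (/ RtoC 2)%C) _ (/ RtoC 2)%C _ (is_limC_const _)) in H2.
    assert (N2 : RtoC 2 <> 0%C) by (intros E; apply (f_equal Re) in E; simpl in E; lra).
    match type of H2 with is_limC _ ?t =>
      replace (RtoC (g2 tau) - RtoC (1 + c) * zj tau j 1 * RtoC (g1 tau))%C with t by (field; exact N2) end.
    eapply is_limC_ext; [|exact H2]. intros n. cbv beta. field.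
Qed.

(** * The norm of g2 - alpha q^{1/5} g1 *)

Definition alpha : R := (1 + sqrt 5) / 2.
Definition alpha' : R := (1 - sqrt 5) / 2.

Lemma alpha_sum : alpha + alpha' = 1.
Proof. unfold alpha, alpha'; field. Qed.

Lemma alpha_prod : alpha * alpha' = -1.
Proof.
  unfold alpha, alpha'. pose proof (sqrt_sqrt 5 ltac:(lra)). nra.
Qed.

(** The numbers alpha - 1 and alpha' - 1 are the two roots of c^2 + c = 1, that is 2 cos (2 pi/5)
    and 2 cos (4 pi/5), so (1 - z) (1 - c1 z + z^2) (1 - c2 z + z^2) = 1 - z^5. One copy of [poch]
    is consumed this way and the other remains. *)
Lemma theta_norm_factor tau j : 0 < tau ->
  is_limC (fun N => (poch (tau / 5) (2 * PI * INR j / 5) N * RtoC (rpoch tau N))%C)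
   ((RtoC (g2 tau) - RtoC alpha * zj tau j 1 * RtoC (g1 tau)) *
    (RtoC (g2 tau) - RtoC alpha' * zj tau j 1 * RtoC (g1 tau)))%C.
Proof.
  intros Ht. pose proof alpha_sum as As. pose proof alpha_prod as Ap.
  pose proof (theta_zeta_prod tau j (alpha - 1) Ht ltac:(nra)) as H1.
  pose proof (theta_zeta_prod tau j (alpha' - 1) Ht ltac:(nra)) as H2.
  replace (1 + (alpha - 1)) with alpha in H1 by ring.
  replace (1 + (alpha' - 1)) with alpha' in H2 by ring.
  pose proof (is_limC_mult _ _ _ _ H1 H2) as H.
  eapply is_limC_ext; [|exact H]. intros n. cbv beta. clear -As Ap.
  set (th := 2 * PI * INR j / 5).
  transitivity (poch (tau / 5) th n * (poch (tau / 5) th n *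
     (qprod (tau / 5) th (alpha - 1) n * qprod (tau / 5) th (alpha' - 1) n)))%C; [ring|].
  f_equal.
  induction n as [|n IH]; [simpl; ring|]. cbn [poch qprod rpoch].
  set (z := zp (tau / 5) th (INR (S n))).
  replace (zp (tau / 5) th (2 * INR (S n))) with (z * z)%C by (unfold z; rewrite <- zp_plus; f_equal; ring).
  assert (Z5 : (z * z * z * z * z)%C = RtoC (exp (- tau * INR (S n)))).
  { unfold z. rewrite <- !zp_plus. rewrite INR_IZR_INZ, <- (zj_5Z tau j). unfold zj. f_equal; unfold th; ring. }
  rewrite RtoC_mult, (RtoC_minus 1 (exp _)), <- Z5, <- IH.
  set (P := poch (tau / 5) th n). set (A := qprod _ _ _ _). set (B := qprod _ _ _ _).
  set (c1 := RtoC (alpha - 1)). set (c2 := RtoC (alpha' - 1)).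
  assert (S1 : (c1 + c2 = - (1))%C) by (unfold c1, c2; apply C_eq; simpl; lra).
  assert (S2 : (c1 * c2 = - (1))%C) by (unfold c1, c2; apply C_eq; simpl; nra).
  transitivity (P * (A * B) * ((1 - z) * (1 - (c1 + c2) * z + (1 + 1 + c1 * c2) * z * z - (c1 + c2) * z * z * z + z * z * z * z)))%C;
   [ring|]. rewrite S1, S2. ring.
Qed.

Definition fac5 (tau : R) (n : nat) : C :=
  ((1 - zj tau 0 (INR n)) * (1 - zj tau 1 (INR n)) * (1 - zj tau 2 (INR n)) *
   (1 - zj tau 3 (INR n)) * (1 - zj tau 4 (INR n)))%C.

Definition pochj (tau : R) (j n : nat) : C := poch (tau / 5) (2 * PI * INR j / 5) n.

Definition poch5 (tau : R) (n : nat) : C :=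
  (pochj tau 0 n * pochj tau 1 n * pochj tau 2 n * pochj tau 3 n * pochj tau 4 n)%C.

Lemma poch5_S tau n : poch5 tau (S n) = (poch5 tau n * fac5 tau (S n))%C.
Proof.
  unfold poch5, fac5, pochj, zj. cbn [poch].
  repeat match goal with |- context [poch ?a ?b ?m] => generalize (poch a b m); intro end.
  repeat match goal with |- context [(1 - zp ?a ?b ?m)%C] => generalize (1 - zp a b m)%C; intro end.
  ring.
Qed.

Lemma exp_fifth tau n :
  let X := RtoC (exp (- (tau / 5) * INR n)) in (X * X * X * X * X)%C = RtoC (exp (- tau * INR n)).
Proof.
  cbv zeta. rewrite <- !RtoC_mult, <- !exp_plus. do 2 f_equal. field.
Qed.

Lemma om_0 : om 0 = 1%C.
Proof. exact (om_mul5 0). Qed.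

(** For n prime to 5 the map j -> j n permutes the residues modulo 5, so the five factors multiply
    to 1 - q^n. For n divisible by 5 they all coincide, which is [fac5_div]. *)
Lemma fac5_ndiv tau M i : (i = 1 \/ i = 2 \/ i = 3 \/ i = 4)%nat ->
  fac5 tau (5 * M + i) = RtoC (1 - exp (- tau * INR (5 * M + i))).
Proof.
  intros Hi. unfold fac5. rewrite !zj_nat.
  assert (R : forall j, ((j * (5 * M + i)) mod 5 = (j * i) mod 5)%nat).
  { intros j. replace (j * (5 * M + i))%nat with (j * i + (j * M) * 5)%nat by ring.
    now rewrite Nat.Div0.mod_add. }
  rewrite !R, RtoC_minus, <- (exp_fifth tau).
  set (X := RtoC (exp (- (tau / 5) * INR (5 * M + i)))).
  pose proof (cyclotomic5 1 X) as E.
  transitivity (1 * 1 * 1 * 1 * 1 - X * X * X * X * X)%C; [rewrite <- E; clear E|ring].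
  destruct Hi as [->|[->|[->| ->]]]; simpl (_ mod _)%nat; rewrite om_0;
  set (o1 := om 1); set (o2 := om 2); set (o3 := om 3); set (o4 := om 4); ring.
Qed.

Lemma fac5_div tau M :
  let y := 1 - exp (- tau * INR (S M)) in
  fac5 tau (5 * M + 5) = RtoC (y * y * y * y * y).
Proof.
  cbv zeta. unfold fac5. rewrite !zj_nat.
  assert (R : forall j, ((j * (5 * M + 5)) mod 5 = 0)%nat).
  { intros j. replace (j * (5 * M + 5))%nat with ((j * (M + 1)) * 5)%nat by ring.
    apply Nat.Div0.mod_mul. }
  rewrite !R, om_0.
  replace (- (tau / 5) * INR (5 * M + 5)) with (- tau * INR (S M)).
  2:{ rewrite S_INR, plus_INR, mult_INR. simpl (INR 5). field. }
  rewrite !RtoC_mult, RtoC_minus. ring.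
Qed.

(** In the product over the five roots, the factors of (q)_{5M} at multiples of 5, which form
    (q^5)_M, are replaced by (q)_M^5. *)
Lemma poch5_val tau M :
  (poch5 tau (5 * M) * RtoC (rpoch (5 * tau) M))%C =
  RtoC (rpoch tau (5 * M) * (rpoch tau M * rpoch tau M * rpoch tau M * rpoch tau M * rpoch tau M)).
Proof.
  induction M as [|M IH].
  - unfold poch5, pochj. simpl. apply C_eq; simpl; ring.
  - replace (5 * S M)%nat with (S (S (S (S (S (5 * M)))))) by lia.
    rewrite !poch5_S. cbn [rpoch].
    replace (S (S (S (S (S (5 * M)))))) with (5 * M + 5)%nat by lia.
    replace (S (S (S (S (5 * M))))) with (5 * M + 4)%nat by lia.
    replace (S (S (S (5 * M)))) with (5 * M + 3)%nat by lia.
    replace (S (S (5 * M))) with (5 * M + 2)%nat by lia.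
    replace (S (5 * M)) with (5 * M + 1)%nat by lia.
    rewrite fac5_div, !fac5_ndiv by lia.
    replace (- (5 * tau) * INR (S M)) with (- tau * INR (5 * M + 5)).
    2:{ rewrite S_INR, plus_INR, mult_INR. simpl (INR 5). ring. }
    set (y := 1 - exp (- tau * INR (S M))).
    set (x1 := 1 - exp (- tau * INR (5 * M + 1))). set (x2 := 1 - exp (- tau * INR (5 * M + 2))).
    set (x3 := 1 - exp (- tau * INR (5 * M + 3))). set (x4 := 1 - exp (- tau * INR (5 * M + 4))).
    set (x5 := 1 - exp (- tau * INR (5 * M + 5))).
    rewrite !RtoC_mult. rewrite !RtoC_mult in IH.
    set (p := rpoch (5 * tau) M) in *.
    transitivity (poch5 tau (5 * M) * RtoC p * (RtoC x1 * RtoC x2 * RtoC x3 * RtoC x4 * RtoC x5) *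
      (RtoC y * RtoC y * RtoC y * RtoC y * RtoC y))%C; [ring|].
    rewrite IH. ring.
Qed.

Lemma zj_1 tau j : (j < 5)%nat -> zj tau j 1 = (RtoC (exp (- (tau / 5))) * om j)%C.
Proof.
  intros H. change 1 with (INR 1). rewrite zj_nat, Nat.mul_1_r, Nat.mod_small by lia.
  simpl (INR 1). now rewrite Rmult_1_r.
Qed.

(** The 11 is the Lucas number alpha^5 + alpha'^5, and the last sign is (alpha alpha')^5 = -1. *)
Lemma norm_identity_real (g1 g2 q : R) : 
  (g2 ^ 5 - (alpha * q * g1) ^ 5) * (g2 ^ 5 - (alpha' * q * g1) ^ 5)
  = g2 ^ 10 - 11 * (q * g1 * g2) ^ 5 - (q * g1) ^ 10.
Proof.
  pose proof alpha_sum as S. pose proof alpha_prod as P.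
  assert (A5 : alpha ^ 5 + alpha' ^ 5 = 11).
  { replace alpha' with (1 - alpha) in * by lra.
    assert (A2 : alpha ^ 2 = alpha + 1) by (simpl; nra).
    replace (alpha ^ 5) with (alpha ^ 2 * alpha ^ 2 * alpha) by ring.
    replace ((1 - alpha) ^ 5) with ((1 - 2 * alpha + alpha ^ 2) * (1 - 2 * alpha + alpha ^ 2) * (1 - alpha)) by ring.
    rewrite A2.
    transitivity (alpha ^ 2 * alpha + 2 * alpha ^ 2 + alpha + (4 - 4 * alpha + alpha ^ 2) * (1 - alpha)); [ring|].
    rewrite A2.
    transitivity (alpha ^ 2 * 4 + 7 - 4 * alpha); [ring|]. rewrite A2. ring. }
  assert (P5 : (alpha * alpha') ^ 5 = -1) by (rewrite P; ring).
  transitivity (g2 ^ 10 - (alpha ^ 5 + alpha' ^ 5) * (q * g1 * g2) ^ 5 + (alpha * alpha') ^ 5 * (q * g1) ^ 10);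
   [ring|]. rewrite A5, P5. ring.
Qed.

(** Multiplying [theta_norm_factor] over the five roots gives fifth powers on one side by
    [cyclotomic5]. On the other, the five [rpoch] factors give phi^5 and the five complex products
    give phi^6 / phi(5 tau). *)
Lemma quintic_identity tau : 0 < tau ->
  let q := exp (- (tau / 5)) in
  g2 tau ^ 10 - 11 * (q * g1 tau * g2 tau) ^ 5 - (q * g1 tau) ^ 10 = phi tau ^ 11 / phi (5 * tau).
Proof.
  intros Ht. cbv zeta. rewrite <- norm_identity_real.
  set (q := exp (- (tau / 5))).
  pose proof (theta_norm_factor tau 0 Ht) as H0. pose proof (theta_norm_factor tau 1 Ht) as H1.
  pose proof (theta_norm_factor tau 2 Ht) as H2. pose proof (theta_norm_factor tau 3 Ht) as H3.
  pose proof (theta_norm_factor tau 4 Ht) as H4.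
  rewrite zj_1 in H0, H1, H2, H3, H4 by lia. fold q in H0, H1, H2, H3, H4. rewrite om_0 in H0.
  pose proof (is_limC_mult _ _ _ _ (is_limC_mult _ _ _ _ (is_limC_mult _ _ _ _ (is_limC_mult _ _ _ _ H0 H1) H2) H3) H4) as H.
  clear H0 H1 H2 H3 H4.
  (* [poch5_val] evaluates the product at lengths divisible by 5. *)
  apply (is_limC_subseq _ _ (fun N => (5 * N + 0)%nat) (filterlim_5N 0)) in H.
  destruct (phi_C (5 * tau) ltac:(lra)) as [_ L5].
  apply (is_limC_ext _ _ _ (fun n => poch_real (5 * tau) n)) in L5.
  pose proof (is_limC_mult _ _ _ _ H L5) as K. clear H.
  set (b1 := (RtoC alpha * RtoC q * RtoC (g1 tau))%C) in *.
  set (b2 := (RtoC alpha' * RtoC q * RtoC (g1 tau))%C) in *.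
  set (a := RtoC (g2 tau)) in *.
  match type of K with is_limC _ ?t => assert (E : t = RtoC (((g2 tau ^ 5 - (alpha * q * g1 tau) ^ 5) * (g2 tau ^ 5 - (alpha' * q * g1 tau) ^ 5)) * phi (5 * tau))) end.
  { transitivity (((a - b1) * (a - om 1 * b1) * (a - om 2 * b1) * (a - om 3 * b1) * (a - om 4 * b1)) *
      ((a - b2) * (a - om 1 * b2) * (a - om 2 * b2) * (a - om 3 * b2) * (a - om 4 * b2)) * RtoC (phi (5 * tau)))%C.
    - replace (RtoC alpha * (RtoC q * 1) * RtoC (g1 tau))%C with b1 by (unfold b1; ring).
      replace (RtoC alpha' * (RtoC q * 1) * RtoC (g1 tau))%C with b2 by (unfold b2; ring).
      assert (F1 : forall o, (RtoC alpha * (RtoC q * o) * RtoC (g1 tau) = o * b1)%C) by (intros; unfold b1; ring).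
      assert (F2 : forall o, (RtoC alpha' * (RtoC q * o) * RtoC (g1 tau) = o * b2)%C) by (intros; unfold b2; ring).
      rewrite !F1, !F2.
      repeat match goal with |- context [(a - ?x)%C] => generalize (a - x)%C; intro end. ring.
    - rewrite !cyclotomic5. unfold a, b1, b2.
      rewrite <- !RtoC_mult, <- !RtoC_minus, <- !RtoC_mult. f_equal. ring. }
  rewrite E in K. destruct K as [K _].
  match type of K with is_lim_seq ?u (Finite (Re (RtoC ?v))) =>
    change (is_lim_seq u (Finite v)) in K end.
  destruct (phi_spec tau Ht) as [L P]. destruct (phi_spec (5 * tau) ltac:(lra)) as [_ P5].
  (* The sixth power of (q)_{5M} is one factor from [poch5_val] and five from the norm factors;
     (q)_M^5 is the rest of [poch5_val]. *)
  assert (L' : is_lim_seq (fun M => rpoch tau (5 * M + 0) ^ 6 * rpoch tau M ^ 5) (phi tau ^ 6 * phi tau ^ 5)).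
  { pose proof (is_lim_seq_subseq _ _ _ (filterlim_5N 0) L) as L0.
    assert (Pw : forall u l n, is_lim_seq u (Finite l) -> is_lim_seq (fun k => u k ^ n) (l ^ n)).
    { intros u l n Hu. induction n as [|n IH]; simpl; [apply is_lim_seq_const|now apply is_lim_seq_mult']. }
    apply is_lim_seq_mult'; now apply Pw. }
  eapply is_lim_seq_ext in L'.
  - apply is_lim_seq_unique in L'. apply is_lim_seq_unique in K. rewrite K in L'.
    apply (f_equal real) in L'. cbn [real] in L'.
    apply Rmult_eq_reg_r with (phi (5 * tau)); [|lra]. rewrite L'. field. lra.
  - intros M. cbv beta. rewrite Nat.add_0_r.
    set (r := rpoch tau (5 * M)).
    match goal with |- _ = Re ?t => assert (X : t = (poch5 tau (5 * M) * RtoC (rpoch (5 * tau) M) * (RtoC r * RtoC r * RtoC r * RtoC r * RtoC r))%C) end.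
    { unfold poch5, pochj. ring. }
    rewrite X, poch5_val, <- !RtoC_mult. fold r.
    match goal with |- _ = Re (RtoC ?v) => change (Re (RtoC v)) with v end. ring.
Qed.

Definition Rt (tau : R) : R := exp (- tau / 5) * (g1 tau / g2 tau).

Lemma Rt_pos tau : 0 < tau -> 0 < Rt tau.
Proof.
  intros H. destruct (g_pos tau H). apply Rmult_lt_0_compat; [apply exp_pos|].
  apply Rdiv_lt_0_compat; lra.
Qed.

(** [quintic_identity] divided by (q^{1/5} g1 g2)^5, with g1 g2 = phi(tau) phi(5 tau). *)
Lemma Rt_quintic tau : 0 < tau ->
  / Rt tau ^ 5 - 11 - Rt tau ^ 5 = exp tau * (phi tau / phi (5 * tau)) ^ 6.
Proof.
  intros Ht. destruct (g_pos tau Ht) as [G1 G2].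
  destruct (phi_spec tau Ht) as [_ P]. destruct (phi_spec (5 * tau) ltac:(lra)) as [_ P5].
  pose proof (quintic_identity tau Ht) as E. cbv zeta in E.
  pose proof (g1_g2 tau Ht) as G.
  unfold Rt. replace (- tau / 5) with (- (tau / 5)) by field. set (q := exp (- (tau / 5))) in *.
  assert (Q : 0 < q) by apply exp_pos.
  assert (Q5 : exp tau = / q ^ 5).
  { unfold q. rewrite <- exp_mul_INR, <- exp_Ropp. f_equal. simpl (INR 5). field. }
  rewrite Q5.
  transitivity ((g2 tau ^ 10 - 11 * (q * g1 tau * g2 tau) ^ 5 - (q * g1 tau) ^ 10) / (q * (g1 tau * g2 tau)) ^ 5).
  - field. lra.
  - rewrite E, G. field. lra.
Qed.

(** * The derivative of R *)

(* The double series of (2 phi^3)^2 over x + iy with x and y odd, plus a term antisymmetric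
   under exchanging x and y. On the coset r = 0 below, 2x + y = 10n + 3 and 2y - x = 10m + 1,
   and x y + 3/8 (x^2 - y^2) becomes the Wronskian weight ((10n+3)^2 - (10m+1)^2) / 8. *)
Definition lat (tau : R) (p : Z * Z) : R :=
  let x := 2 * IZR (fst p) + 1 in
  let y := 2 * IZR (snd p) + 1 in
  sgn (fst p) * sgn (snd p) * (x * y + 3 / 8 * (x ^ 2 - y ^ 2))
  * exp (- tau * (tri (fst p) + tri (snd p))).

Definition in_coset (r : Z) (p : Z * Z) : bool := Z.eqb ((fst p - 2 * snd p - r) mod 5) 0.

(** Multiplication of the Gaussian integer n + i m by 2 + i, translated by r. The five values of r
    give the cosets of the ideal generated by 2 + i, of norm 5. *)
Definition coset_par (r : Z) (p : Z * Z) : Z * Z :=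
  ((2 * fst p - snd p + r)%Z, (fst p + 2 * snd p)%Z).

Definition restr (r : Z) (f : Z * Z -> R) (p : Z * Z) : R := if in_coset r p then f p else 0.

Lemma in_coset_spec r p : in_coset r p = true <-> exists m, (fst p - 2 * snd p = r + 5 * m)%Z.
Proof.
  unfold in_coset. rewrite Z.eqb_eq. split.
  - intros H. exists ((fst p - 2 * snd p - r) / 5)%Z.
    pose proof (Z.div_mod (fst p - 2 * snd p - r) 5 ltac:(lia)). lia.
  - intros [m H]. replace (fst p - 2 * snd p - r)%Z with (5 * m + 0)%Z by lia.
    apply mod5_eq; lia.
Qed.

Lemma in_coset_congr r r' p p' :
  ((exists m, (fst p - 2 * snd p = r + 5 * m)%Z) <->
   (exists m, (fst p' - 2 * snd p' = r' + 5 * m)%Z)) -> in_coset r p = in_coset r' p'.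
Proof.
  intros H. apply Bool.eq_true_iff_eq. now rewrite !in_coset_spec.
Qed.

Lemma coset_par_inj r p p' : coset_par r p = coset_par r p' -> p = p'.
Proof.
  destruct p as [a b], p' as [c d]. intros E.
  pose proof (f_equal fst E) as E1. pose proof (f_equal snd E) as E2.
  unfold coset_par in E1, E2; cbn [fst snd] in E1, E2. f_equal; lia.
Qed.

Lemma has_sum_restr r f s :
  has_sum (fun p => f (coset_par r p)) s -> has_sum (restr r f) s.
Proof.
  intros H. apply (has_sum_reindex (coset_par r)).
  - apply coset_par_inj.
  - intros [a b] Hn. unfold restr. destruct (in_coset r (a, b)) eqn:E; auto.
    apply in_coset_spec in E. destruct E as [m E]. cbn [fst snd] in E.
    destruct (Hn ((b + 2 * m)%Z, (- m)%Z)). unfold coset_par; cbn [fst snd]. f_equal; lia.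
  - eapply has_sum_ext; [|exact H]. intros [a b]. cbv beta. unfold restr.
    replace (in_coset r (coset_par r (a, b))) with true; auto.
    symmetry. apply in_coset_spec. exists (- b)%Z. unfold coset_par; cbn [fst snd]. lia.
Qed.

Lemma tri_reflect a : tri (-1 - a) = tri a.
Proof. unfold tri. rewrite minus_IZR. field. Qed.

(** On the odd coordinates this is (x, y) -> (y, -x), which negates the quadratic weight; the
    product of signs is negated as well. *)
Lemma lat_rotate tau a b : lat tau (b, (-1 - a)%Z) = lat tau (a, b).
Proof.
  unfold lat; cbn [fst snd]. rewrite tri_reflect, (Rplus_comm (tri b)).
  replace (-1 - a)%Z with (-1 + - a)%Z by lia.
  rewrite sgn_plus, sgn_m1, sgn_opp, plus_IZR, opp_IZR. ring.
Qed.

(* Rotation by a right angle permutes the cosets of the index 5 sublattice. *)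
Lemma restr_rotate tau r r' s : (exists m, 2 * r + 2 = r' + 5 * m)%Z ->
  has_sum (restr r (lat tau)) s -> has_sum (restr r' (lat tau)) s.
Proof.
  intros [k Hk] H.
  apply (has_sum_bij (fun p => (snd p, (-1 - fst p)%Z)) (fun p => ((-1 - snd p)%Z, fst p))).
  - intros [a b]; cbn [fst snd]; f_equal; lia.
  - intros [a b]; cbn [fst snd]; f_equal; lia.
  - eapply has_sum_ext; [|exact H]. intros [a b]. cbn [fst snd]. unfold restr.
    rewrite lat_rotate.
    replace (in_coset r' (b, (-1 - a)%Z)) with (in_coset r (a, b)); auto.
    apply in_coset_congr. cbn [fst snd]. split; intros [m Hm].
    + exists (2 * m + b + k)%Z. lia.
    + exists (a - 2 * b - r - 2 * (m - k - b))%Z. lia.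
Qed.

Lemma summable_sgn tau (w : Z -> R) K : 0 < tau -> (forall k, Rabs (w k) <= K * (1 + tri k) ^ 4) ->
  summable (fun k => sgn k * w k * exp (- tau * tri k)).
Proof.
  intros Ht H. apply summable_theta with K; auto using growing_tri.
  intros k. rewrite Rabs_mult, Rabs_sgn, Rmult_1_l. apply H.
Qed.

(** [lat] is a combination of three products of single series; the antisymmetric part contributes s2
    s0 - s0 s2 = 0. *)
Lemma lat_sum tau : 0 < tau -> summable (lat tau) /\ has_sum (lat tau) (th3 tau ^ 2).
Proof.
  intros Ht.
  assert (E0 : forall k, 0 <= tri k) by apply growing_tri.
  assert (S1 := summable_th3 tau Ht). assert (H1 := has_sum_zsum _ S1). fold (th3 tau) in H1.
  assert (S0 : summable (fun k => sgn k * 1 * exp (- tau * tri k))).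
  { apply (summable_sgn tau (fun _ => 1) 1 Ht). intros k. rewrite Rabs_R1, Rmult_1_l. now apply pow_ge_1. }
  assert (S2 : summable (fun k => sgn k * (2 * IZR k + 1) ^ 2 * exp (- tau * tri k))).
  { apply (summable_sgn tau (fun k => (2 * IZR k + 1) ^ 2) 8 Ht). intros k.
    rewrite Rabs_pos_eq by apply pow2_ge_0.
    replace ((2 * IZR k + 1) ^ 2) with (8 * tri k + 1) by (unfold tri; field).
    pose proof (pow_ge_1 (tri k) 3 (E0 k)). specialize (E0 k).
    replace ((1 + tri k) ^ 4) with ((1 + tri k) * (1 + tri k) ^ 3) by ring. nra. }
  destruct (summable_has_sum _ S0) as [s0 H0]. destruct (summable_has_sum _ S2) as [s2 H2].
  assert (E : forall p : Z * Z,
    (sgn (fst p) * (2 * IZR (fst p) + 1) * exp (- tau * tri (fst p))) *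
    (sgn (snd p) * (2 * IZR (snd p) + 1) * exp (- tau * tri (snd p)))
    + (3 / 8 * ((sgn (fst p) * (2 * IZR (fst p) + 1) ^ 2 * exp (- tau * tri (fst p))) *
    (sgn (snd p) * 1 * exp (- tau * tri (snd p))))
    + - (3 / 8) * ((sgn (fst p) * 1 * exp (- tau * tri (fst p))) *
    (sgn (snd p) * (2 * IZR (snd p) + 1) ^ 2 * exp (- tau * tri (snd p))))) = lat tau p).
  { intros [a b]. unfold lat; cbn [fst snd]. replace (- tau * (tri a + tri b)) with (- tau * tri a + - tau * tri b) by ring. rewrite exp_plus. field. }
  split.
  - eapply summable_ext; [exact E|].
    apply summable_plus; [apply (summable_prod _ _ S1 S1)|apply summable_plus; apply summable_scal].
    + apply (summable_prod _ _ S2 S0).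
    + apply (summable_prod _ _ S0 S2).
  - eapply has_sum_ext; [exact E|].
    replace (th3 tau ^ 2) with (th3 tau * th3 tau + (3 / 8 * (s2 * s0) + - (3 / 8) * (s0 * s2))) by ring.
    apply has_sum_plus; [apply (has_sum_prod _ _ _ _ S1 S1 H1 H1)|apply has_sum_plus; apply has_sum_scal].
    + apply (has_sum_prod _ _ _ _ S2 S0 H2 H0).
    + apply (has_sum_prod _ _ _ _ S0 S2 H0 H2).
Qed.

(* On the sublattice x = 2y mod 5 the summand is antisymmetric under a reflection. *)
Lemma lat_zero_coset tau : 0 < tau -> has_sum (restr 3 (lat tau)) 0.
Proof.
  intros Ht. apply has_sum_restr.
  set (f := fun p => lat tau (coset_par 3 p)).
  assert (S : summable f).
  { apply (summable_inj (coset_par 3) (lat tau)); [apply coset_par_inj|apply lat_sum, Ht]. }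
  destruct (summable_has_sum _ S) as [s Hs].
  assert (Hs' : has_sum f (-1 * s)).
  (* On this coset 2x + y = 5 (2n + 3) and 2y - x = 5 (2m - 1); the map exchanges the two, and the
     weight is an eighth of the difference of their squares. *)
  { apply (has_sum_bij (fun p => ((snd p - 2)%Z, (fst p + 2)%Z)) (fun p => ((snd p - 2)%Z, (fst p + 2)%Z))).
    - intros [a b]; cbn [fst snd]; f_equal; lia.
    - intros [a b]; cbn [fst snd]; f_equal; lia.
    - eapply has_sum_ext; [|apply (has_sum_scal (-1) _ _ Hs)]. intros [n m].
      unfold f, lat, coset_par; cbn [fst snd].
      replace (2 * n - m + 3)%Z with (2 * n + (- m + 3))%Z by lia.
      replace (2 * (m - 2) - (n + 2) + 3)%Z with (2 * (m - 2) + (- n + 1))%Z by lia.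
      replace (m - 2)%Z with (m + -2)%Z by lia.
      rewrite !sgn_plus, !sgn_double, !sgn_opp.
      change (sgn 3) with (-1). change (sgn 1) with (-1). change (sgn (-2)) with 1. change (sgn 2) with 1.
      unfold tri. rewrite !plus_IZR, !mult_IZR, !plus_IZR, !opp_IZR.
      set (x := IZR n). set (y := IZR m).
      match goal with |- _ * (_ * exp ?u) = _ * exp ?v => replace v with u by field end.
      ring_simplify. field. }
  pose proof (has_sum_unique _ _ _ Hs Hs') as E. replace 0 with s by lra. exact Hs.
Qed.

(** The left side is -5 g1 g2 times the logarithmic derivative of e^{-tau/5} g1 / g2, which is why
    it yields the derivative of R. *)
Lemma wronskian tau D1 D2 : 0 < tau ->
  has_sum (fun k => - (sgn k * e1 k) * exp (- tau * e1 k)) D1 ->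
  has_sum (fun k => - (sgn k * e2 k) * exp (- tau * e2 k)) D2 ->
  5 * (g1 tau * D2 - D1 * g2 tau) + g1 tau * g2 tau = phi tau ^ 6.
Proof.
  intros Ht HD1 HD2.
  assert (T1 := has_sum_zsum _ (summable_g1 tau Ht)). fold (g1 tau) in T1.
  assert (T2 := has_sum_zsum _ (summable_g2 tau Ht)). fold (g2 tau) in T2.
  assert (S1 := summable_g1 tau Ht). assert (S2 := summable_g2 tau Ht).
  assert (Wt : forall e k, growing e -> Rabs (- (sgn k * e k)) <= 1 * (1 + e k) ^ 4).
  { intros e k He. destruct (He k) as [H0 _].
    rewrite Rabs_Ropp, Rabs_mult, Rabs_sgn, Rabs_pos_eq, !Rmult_1_l by lra.
    pose proof (pow_ge_1 (e k) 3 H0).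
    replace ((1 + e k) ^ 4) with ((1 + e k) * (1 + e k) ^ 3) by ring. nra. }
  assert (U1 : summable (fun k => - (sgn k * e1 k) * exp (- tau * e1 k))).
  { apply summable_theta with 1; auto using growing_e1. }
  assert (U2 : summable (fun k => - (sgn k * e2 k) * exp (- tau * e2 k))).
  { apply summable_theta with 1; auto using growing_e2. }
  set (W := 5 * (g1 tau * D2 - D1 * g2 tau) + g1 tau * g2 tau).
  (* The weight of the double series is 5 (e1 n - e2 m) + 1, which is ((10n+3)^2 - (10m+1)^2) /
     8. *)
  assert (H0 : has_sum (restr 0 (lat tau)) W).
  { apply has_sum_restr.
    pose proof (has_sum_plus _ _ _ _ (has_sum_scal 5 _ _ (has_sum_minus _ _ _ _
      (has_sum_prod _ _ _ _ S1 U2 T1 HD2) (has_sum_prod _ _ _ _ U1 S2 HD1 T2)))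
      (has_sum_prod _ _ _ _ S1 S2 T1 T2)) as H.
    eapply has_sum_ext; [|exact H]. intros [n m]. cbv beta. unfold lat, coset_par; cbn [fst snd].
    replace (2 * n - m + 0)%Z with (2 * n + - m)%Z by lia.
    replace (tri (2 * n + - m) + tri (n + 2 * m)) with (e1 n + e2 m).
    2:{ unfold tri, e1, e2. rewrite !plus_IZR, !mult_IZR, !opp_IZR. field. }
    replace (- tau * (e1 n + e2 m)) with (- tau * e1 n + - tau * e2 m) by ring.
    rewrite !sgn_plus, !sgn_double, !sgn_opp, exp_plus, !plus_IZR, !mult_IZR, !opp_IZR.
    set (u := exp (- tau * e1 n)). set (v := exp (- tau * e2 m)). unfold e1, e2. field. }
  (* Rotation sends r to 2r + 2 modulo 5: the cycle 0, 2, 1, 4 and the fixed coset 3, which sums to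
     0. Hence 4 W is the full sum 4 phi^6. *)
  assert (H2 : has_sum (restr 2 (lat tau)) W) by (apply (restr_rotate tau 0 2); auto; exists 0%Z; lia).
  assert (H1 : has_sum (restr 1 (lat tau)) W) by (apply (restr_rotate tau 2 1); auto; exists 1%Z; lia).
  assert (H4 : has_sum (restr 4 (lat tau)) W) by (apply (restr_rotate tau 1 4); auto; exists 0%Z; lia).
  pose proof (lat_zero_coset tau Ht) as H3.
  pose proof (has_sum_plus _ _ _ _ (has_sum_plus _ _ _ _ (has_sum_plus _ _ _ _ (has_sum_plus _ _ _ _ H0 H1) H2) H3) H4) as H.
  apply (has_sum_ext _ (lat tau)) in H.
  - pose proof (has_sum_unique _ _ _ H (proj2 (lat_sum tau Ht))) as E.
    rewrite th3_phi in E by assumption.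
    replace ((2 * phi tau ^ 3) ^ 2) with (4 * phi tau ^ 6) in E by ring. lra.
  - intros [a b]. unfold restr, in_coset; cbn [fst snd].
    destruct (mod5_cases (a - 2 * b)) as [m [r [E Hr]]]. rewrite E.
    replace (5 * m + r - 0)%Z with (5 * m + r)%Z by lia.
    destruct Hr as [->|[->|[->|[->| ->]]]].
    + replace (5 * m + 0 - 1)%Z with (5 * (m - 1) + 4)%Z by lia. replace (5 * m + 0 - 2)%Z with (5 * (m - 1) + 3)%Z by lia.
      replace (5 * m + 0 - 3)%Z with (5 * (m - 1) + 2)%Z by lia. replace (5 * m + 0 - 4)%Z with (5 * (m - 1) + 1)%Z by lia.
      rewrite !mod5_eq by lia. simpl. ring.
    + replace (5 * m + 1 - 1)%Z with (5 * m + 0)%Z by lia. replace (5 * m + 1 - 2)%Z with (5 * (m - 1) + 4)%Z by lia.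
      replace (5 * m + 1 - 3)%Z with (5 * (m - 1) + 3)%Z by lia. replace (5 * m + 1 - 4)%Z with (5 * (m - 1) + 2)%Z by lia.
      rewrite !mod5_eq by lia. simpl. ring.
    + replace (5 * m + 2 - 1)%Z with (5 * m + 1)%Z by lia. replace (5 * m + 2 - 2)%Z with (5 * m + 0)%Z by lia.
      replace (5 * m + 2 - 3)%Z with (5 * (m - 1) + 4)%Z by lia. replace (5 * m + 2 - 4)%Z with (5 * (m - 1) + 3)%Z by lia.
      rewrite !mod5_eq by lia. simpl. ring.
    + replace (5 * m + 3 - 1)%Z with (5 * m + 2)%Z by lia. replace (5 * m + 3 - 2)%Z with (5 * m + 1)%Z by lia.
      replace (5 * m + 3 - 3)%Z with (5 * m + 0)%Z by lia. replace (5 * m + 3 - 4)%Z with (5 * (m - 1) + 4)%Z by lia.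
      rewrite !mod5_eq by lia. simpl. ring.
    + replace (5 * m + 4 - 1)%Z with (5 * m + 3)%Z by lia. replace (5 * m + 4 - 2)%Z with (5 * m + 2)%Z by lia.
      replace (5 * m + 4 - 3)%Z with (5 * m + 1)%Z by lia. replace (5 * m + 4 - 4)%Z with (5 * m + 0)%Z by lia.
      rewrite !mod5_eq by lia. simpl. ring.
Qed.

(** * Differentiability of the theta series and of R *)

Lemma g1_derive tau : 0 < tau -> exists D,
  has_sum (fun k => - (sgn k * e1 k) * exp (- tau * e1 k)) D /\ is_derive g1 tau D.
Proof.
  intros Ht. apply (theta_derive sgn e1 1); auto using growing_e1.
  - intros k. apply sgn_weight, growing_e1.
  - intros t H. apply has_sum_zsum, summable_g1, H.
Qed.

Lemma g2_derive tau : 0 < tau -> exists D,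
  has_sum (fun k => - (sgn k * e2 k) * exp (- tau * e2 k)) D /\ is_derive g2 tau D.
Proof.
  intros Ht. apply (theta_derive sgn e2 1); auto using growing_e2.
  - intros k. apply sgn_weight, growing_e2.
  - intros t H. apply has_sum_zsum, summable_g2, H.
Qed.

Lemma th3_derive tau : 0 < tau -> ex_derive th3 tau.
Proof.
  intros Ht. destruct (theta_derive (fun k => sgn k * (2 * IZR k + 1)) tri 9 th3 tau) as [D [_ H]];
   auto using growing_tri, odd_weight.
  - intros t H. apply has_sum_zsum, summable_th3, H.
  - now exists D.
Qed.

(** Written with theta series, (th3 / 2)^2 being phi^6, since [theta_derive] makes these
    differentiable and so gives the continuity of [Rt'], while [phi] is only a limit of products. *)
Definition Rt' (tau : R) : R :=
  - (1 / 5) * Rt tau * ((th3 tau / 2) ^ 2 / (g1 tau * g2 tau)).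

Lemma Rt_derive tau : 0 < tau -> is_derive Rt tau (Rt' tau).
Proof.
  intros Ht. destruct (g1_derive tau Ht) as [D1 [S1 H1]]. destruct (g2_derive tau Ht) as [D2 [S2 H2]].
  pose proof (wronskian tau D1 D2 Ht S1 S2) as W. destruct (g_pos tau Ht) as [P1 P2].
  unfold Rt', Rt. auto_derive.
  - repeat split; try (eexists; eassumption). lra.
  - change (fun x => g1 x) with g1. change (fun x => g2 x) with g2.
    rewrite (is_derive_unique _ _ _ H1), (is_derive_unique _ _ _ H2), th3_phi by assumption.
    replace ((2 * phi tau ^ 3 / 2) ^ 2) with (phi tau ^ 6) by field.
    rewrite <- W. unfold Rdiv. field. lra.
Qed.

Lemma Rt'_continuous tau : 0 < tau -> continuous Rt' tau.
Proof.
  intros Ht. apply (ex_derive_continuous Rt').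
  destruct (g1_derive tau Ht) as [D1 [_ H1]]. destruct (g2_derive tau Ht) as [D2 [_ H2]].
  destruct (g_pos tau Ht) as [P1 P2].
  unfold Rt'. auto_derive. repeat split.
  - eexists; apply Rt_derive; assumption.
  - now apply th3_derive.
  - now exists D1.
  - now exists D2.
  - apply Rgt_not_eq. nra.
Qed.

Lemma Rt'_phi tau : 0 < tau -> Rt' tau = - (1 / 5) * Rt tau * (phi tau ^ 5 / phi (5 * tau)).
Proof.
  intros Ht. unfold Rt'. rewrite th3_phi, g1_g2 by assumption.
  destruct (phi_spec tau Ht) as [_ P]. destruct (phi_spec (5 * tau) ltac:(lra)) as [_ P5].
  field. lra.
Qed.

(** * Change of variables *)

(** While n tau <= 3/10, x = e^{-n tau} is at least 7/10, so (1 - x^5) / (1 - x) >= 1 + x + x^2 >=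
    2. These k factors each contribute 1/2 and all later ones at most 1. *)
Lemma phi_ratio_le tau k : 0 < tau -> INR k * tau <= 3 / 10 ->
  phi tau <= (1 / 2) ^ k * phi (5 * tau).
Proof.
  intros Ht Hk.
  assert (E5 : forall n, exp (- (5 * tau) * INR n) = exp (- tau * INR n) ^ 5).
  { intros n. rewrite <- exp_mul_INR. f_equal. simpl (INR 5). ring. }
  assert (B : forall n, rpoch tau (k + n) <= (1 / 2) ^ k * rpoch (5 * tau) (k + n)).
  { assert (Bk : forall j, (j <= k)%nat -> rpoch tau j <= (1 / 2) ^ j * rpoch (5 * tau) j).
    { induction j as [|j IH]; intros Hj; [simpl; lra|]. cbn [rpoch].
      specialize (IH ltac:(lia)). rewrite E5. set (x := exp (- tau * INR (S j))).
      assert (X1 : 7 / 10 <= x).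
      { pose proof (exp_ineq1_le (- tau * INR (S j))) as H. fold x in H.
        assert (INR (S j) * tau <= INR k * tau) by (apply Rmult_le_compat_r; [lra|apply le_INR, Hj]).
        lra. }
      assert (X2 : x <= 1).
      { unfold x. rewrite <- exp_0 at 1. apply exp_le. pose proof (pos_INR (S j)). nra. }
      assert (X3 : 1 - x <= 1 / 2 * (1 - x ^ 5)).
      { assert (1 <= x + x * x) by nra.
        assert (0 <= x * x * x) by nra. assert (0 <= x * x * x * x) by nra.
        replace (1 - x ^ 5) with ((1 - x) * (1 + (x + x * x) + x * x * x + x * x * x * x)) by ring. nra. }
      replace ((1 / 2) ^ S j * (rpoch (5 * tau) j * (1 - x ^ 5)))
        with ((1 / 2) ^ j * rpoch (5 * tau) j * (1 / 2 * (1 - x ^ 5))) by (simpl; ring).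
      apply Rmult_le_compat; try lra. left; now apply rpoch_pos. }
    induction n as [|n IH].
    - rewrite Nat.add_0_r. now apply Bk.
    - rewrite Nat.add_succ_r. cbn [rpoch]. rewrite E5. set (x := exp (- tau * INR (S (k + n)))).
      assert (X0 : 0 < x) by apply exp_pos.
      assert (X2 : x <= 1).
      { unfold x. rewrite <- exp_0 at 1. apply exp_le. pose proof (pos_INR (S (k + n))). nra. }
      assert (x ^ 5 <= x).
      { assert (x ^ 4 <= 1) by (rewrite <- (pow1 4); apply pow_incr; lra).
        replace (x ^ 5) with (x * x ^ 4) by ring. nra. }
      rewrite <- Rmult_assoc. apply Rmult_le_compat; try lra. left; now apply rpoch_pos. }
  destruct (phi_spec tau Ht) as [L1 _]. destruct (phi_spec (5 * tau) ltac:(lra)) as [L2 _].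
  assert (Sh : filterlim (fun n => (k + n)%nat) eventually eventually).
  { intros P [N0 H]. exists N0. intros n Hn. apply H. lia. }
  apply (is_lim_seq_le (fun n => rpoch tau (k + n)) (fun n => (1 / 2) ^ k * rpoch (5 * tau) (k + n))
    (phi tau) ((1 / 2) ^ k * phi (5 * tau))); auto.
  - apply (is_lim_seq_subseq (rpoch tau) (phi tau) _ Sh L1).
  - apply is_lim_seq_mult'; [apply is_lim_seq_const|].
    apply (is_lim_seq_subseq (rpoch (5 * tau)) (phi (5 * tau)) _ Sh L2).
Qed.

(** * The range of R *)

Lemma x0_spec : 0 < x0 /\ (x0 ^ 5) ^ 2 + 11 * x0 ^ 5 = 1.
Proof.
  assert (S5 : sqrt 5 * sqrt 5 = 5) by (apply sqrt_sqrt; lra).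
  assert (P5 : 0 < sqrt 5) by (apply sqrt_lt_R0; lra).
  assert (W : 0 < (-11 + 5 * sqrt 5) / 2) by nra.
  assert (E : x0 ^ 5 = (-11 + 5 * sqrt 5) / 2).
  { unfold x0. rewrite <- Rpower_pow by apply exp_pos. rewrite Rpower_mult.
    replace (1 / 5 * INR 5) with 1 by (simpl; field). now apply Rpower_1. }
  split; [apply exp_pos|]. rewrite E. nra.
Qed.

Definition quintic_gap (t : R) : R := / t ^ 5 - 11 - t ^ 5.

Lemma quintic_gap_pos t : 0 < t -> (0 < quintic_gap t <-> t < x0).
Proof.
  intros Ht. destruct x0_spec as [X0 X5]. unfold quintic_gap.
  assert (U : 0 < t ^ 5) by now apply pow_lt.
  assert (V : 0 < x0 ^ 5) by now apply pow_lt.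
  assert (E : / t ^ 5 - 11 - t ^ 5 = (1 - 11 * t ^ 5 - (t ^ 5) ^ 2) / t ^ 5) by (field; lra).
  rewrite E.
  assert (F : 1 - 11 * t ^ 5 - (t ^ 5) ^ 2 = (x0 ^ 5 - t ^ 5) * (11 + x0 ^ 5 + t ^ 5)) by (rewrite <- X5; ring).
  rewrite F.
  split; intros H.
  - apply Rnot_le_lt. intros L.
    assert (x0 ^ 5 <= t ^ 5) by (apply pow_incr; lra).
    assert ((x0 ^ 5 - t ^ 5) * (11 + x0 ^ 5 + t ^ 5) / t ^ 5 <= 0); [|lra].
    unfold Rdiv. assert (0 < / t ^ 5) by now apply Rinv_0_lt_compat.
    assert ((x0 ^ 5 - t ^ 5) * (11 + x0 ^ 5 + t ^ 5) <= 0) by nra. nra.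
  - assert (t ^ 5 < x0 ^ 5).
    { assert (P : forall n, t ^ S n < x0 ^ S n).
      { induction n as [|n IH]; [simpl; lra|].
        change (t * t ^ S n < x0 * x0 ^ S n). pose proof (pow_lt t (S n) Ht). nra. }
      apply P. }
    apply Rdiv_lt_0_compat; auto. nra.
Qed.

Lemma quintic_gap_decr s t : 0 < s <= t -> quintic_gap t <= quintic_gap s.
Proof.
  intros H. unfold quintic_gap.
  assert (s ^ 5 <= t ^ 5) by (apply pow_incr; lra).
  assert (0 < s ^ 5) by (apply pow_lt; lra).
  assert (/ t ^ 5 <= / s ^ 5) by (apply Rinv_le_contravar; auto). lra.
Qed.

Lemma Rt_gap tau : 0 < tau -> 0 < quintic_gap (Rt tau).
Proof.
  intros Ht. unfold quintic_gap. rewrite Rt_quintic by assumption.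
  destruct (phi_spec tau Ht) as [_ P]. destruct (phi_spec (5 * tau) ltac:(lra)) as [_ P5].
  apply Rmult_lt_0_compat; [apply exp_pos|]. apply pow_lt, Rdiv_lt_0_compat; lra.
Qed.

Lemma Rt_lt_x0 tau : 0 < tau -> Rt tau < x0.
Proof.
  intros Ht. apply quintic_gap_pos; [now apply Rt_pos|now apply Rt_gap].
Qed.

Lemma Rt_le_exp tau : 0 < tau -> Rt tau <= exp (- tau / 5).
Proof.
  intros Ht. destruct (g_pos tau Ht) as [G1 G2]. pose proof (g1_le_g2 tau Ht).
  unfold Rt. assert (g1 tau / g2 tau <= 1).
  { apply Rmult_le_reg_r with (g2 tau); auto. unfold Rdiv. rewrite Rmult_assoc, Rinv_l; lra. }
  pose proof (exp_pos (- tau / 5)). nra.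
Qed.

(** At tau = (3/10) / (k + 1) the gap of [Rt] is e^tau (phi(tau) / phi(5 tau))^6 <= 3 (1/2)^k, the 3
    bounding e^tau for tau <= 1. For large k this is below the gap at y, and the gap is
    decreasing. *)
Lemma Rt_near_x0 y : 0 < y < x0 -> exists tau, 0 < tau <= 1 /\ y < Rt tau.
Proof.
  intros [Hy Hx].
  pose proof (proj2 (quintic_gap_pos y Hy) Hx) as L.
  destruct (pow_lt_1_zero (1 / 2) ltac:(rewrite Rabs_pos_eq; lra) (quintic_gap y / 3) ltac:(lra)) as [k Hk].
  specialize (Hk k (Nat.le_refl k)). rewrite Rabs_pos_eq in Hk by (apply pow_le; lra).
  set (tau := 3 / 10 / (INR k + 1)).
  pose proof (pos_INR k) as Ik.
  assert (T0 : 0 < tau) by (apply Rdiv_lt_0_compat; lra).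
  assert (T1 : (INR k + 1) * tau = 3 / 10) by (unfold tau; field; lra).
  assert (T2 : tau <= 1) by nra.
  exists tau. split; [lra|]. apply Rnot_le_lt. intros H.
  pose proof (quintic_gap_decr (Rt tau) y (conj (Rt_pos tau T0) H)) as D.
  unfold quintic_gap at 2 in D. rewrite Rt_quintic in D by assumption.
  pose proof (phi_ratio_le tau k T0 ltac:(lra)) as B.
  destruct (phi_spec tau T0) as [_ P]. destruct (phi_spec (5 * tau) ltac:(lra)) as [_ P5].
  set (r := phi tau / phi (5 * tau)) in *.
  assert (R0 : 0 <= r) by (left; apply Rdiv_lt_0_compat; lra).
  assert (R1 : r <= (1 / 2) ^ k).
  { apply Rmult_le_reg_r with (phi (5 * tau)); auto. unfold r, Rdiv. rewrite Rmult_assoc, Rinv_l; lra. }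
  assert (R2 : (1 / 2) ^ k <= 1) by (rewrite <- (pow1 k) at 2; apply pow_incr; lra).
  assert (R6 : r ^ 6 <= r).
  { assert (r ^ 5 <= 1) by (rewrite <- (pow1 5); apply pow_incr; lra).
    assert (0 <= r ^ 5) by now apply pow_le.
    replace (r ^ 6) with (r * r ^ 5) by ring. nra. }
  assert (E3 : exp tau <= 3) by (eapply Rle_trans; [apply exp_le, T2|apply exp_le_3]).
  pose proof (exp_pos tau). assert (0 <= r ^ 6) by now apply pow_le. nra.
Qed.

Lemma Rt_continuity_pt tau : 0 < tau -> continuity_pt Rt tau.
Proof.
  intros Ht. apply continuity_pt_filterlim, (ex_derive_continuous Rt).
  exists (Rt' tau). now apply Rt_derive.
Qed.

Lemma Rt_onto y : 0 < y < x0 -> exists tau, 0 < tau /\ Rt tau = y.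
Proof.
  intros Hy. destruct (Rt_near_x0 y Hy) as [t0 [H0 R0]].
  (* Chosen so that Rt t1 <= e^{-t1/5} < y; as t1 >= 5, it lies beyond t0 <= 1. *)
  set (t1 := 5 * (Rabs (ln y) + 1)).
  assert (T1 : 5 <= t1) by (unfold t1; pose proof (Rabs_pos (ln y)); lra).
  assert (R1 : Rt t1 < y).
  { eapply Rle_lt_trans; [apply Rt_le_exp; lra|]. rewrite <- (exp_ln y) by lra.
    apply exp_increasing. unfold t1. pose proof (Rle_abs (- ln y)) as A. rewrite Rabs_Ropp in A. lra. }
  destruct (Ranalysis5.IVT_interv (fun t => y - Rt t) t0 t1) as [z [Z1 Z2]].
  - intros a Ha. apply continuity_pt_minus; [apply continuity_pt_const; intros ? ?; reflexivity|].
    apply Rt_continuity_pt; lra.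
  - lra.
  - lra.
  - lra.
  - exists z. split; lra.
Qed.

(** * Transport of the integrals *)

Lemma eta_i_phi t : eta_i (t / 2) = exp (- (PI * t) / 24) * phi (PI * t).
Proof.
  unfold eta_i, phi. f_equal.
  - f_equal. field.
  - f_equal. apply Lim_seq_ext. intros n. induction n as [|n IH]; [reflexivity|].
    cbn [eta_pprod rpoch]. rewrite IH. do 3 f_equal. field.
Qed.

Definition source (G : R -> R) (t : R) : R :=
  5 * (G t / (t * Rpower (/ t ^ 5 - 11 - t ^ 5) (1 / 6))).

Lemma source_continuous G t : smooth_on 0 x0 G -> 0 < t < x0 -> continuous (source G) t.
Proof.
  intros HG Ht.
  assert (CG : continuous G t) by (apply (ex_derive_continuous G), (HG 1%nat t Ht)).
  pose proof (proj2 (quintic_gap_pos t (proj1 Ht)) (proj2 Ht)) as Q. unfold quintic_gap in Q.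
  apply (continuous_ext (fun t => mult (G t) (5 / (t * Rpower (/ t ^ 5 - 11 - t ^ 5) (1 / 6))))).
  { intros x. unfold source, mult; simpl. unfold Rdiv. ring. }
  apply (continuous_mult G); auto.
  apply (ex_derive_continuous (fun t => 5 / (t * Rpower (/ t ^ 5 - 11 - t ^ 5) (1 / 6)))).
  unfold Rpower. auto_derive. repeat split.
  - apply Rgt_not_eq. exact (pow_lt t 5 (proj1 Ht)).
  - exact Q.
  - apply Rgt_not_eq, Rmult_lt_0_compat; [lra|apply exp_pos].
Qed.

(** At R the sixth root in [source] equals e^{tau/6} phi(tau) / phi(5 tau). Against [Rt'] the
    factors 5, R and phi(5 tau) cancel, leaving e^{-tau/6} phi(tau)^4, the fourth power of eta. *)
Lemma pullback G t : 0 < t ->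
  mG_integrand G t = - (PI * Rt' (PI * t) * source G (Rt (PI * t))).
Proof.
  intros Ht. assert (PI0 := PI_RGT_0). set (tau := PI * t).
  assert (T0 : 0 < tau) by (unfold tau; nra).
  unfold mG_integrand, source. rewrite eta_i_phi.
  replace (- PI * t) with (- tau) by (unfold tau; ring). fold tau.
  rewrite RR_exp by assumption. fold (Rt tau).
  rewrite Rt_quintic, Rt'_phi by assumption.
  destruct (phi_spec tau T0) as [_ P]. destruct (phi_spec (5 * tau) ltac:(lra)) as [_ P5].
  assert (D : 0 < phi tau / phi (5 * tau)) by (apply Rdiv_lt_0_compat; lra).
  assert (K : Rpower (exp tau * (phi tau / phi (5 * tau)) ^ 6) (1 / 6) = exp (tau / 6) * (phi tau / phi (5 * tau))).
  { rewrite <- (exp_ln (phi tau / phi (5 * tau)) D), <- exp_mul_INR, <- !exp_plus, Rpower_exp.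
    f_equal. simpl (INR 6). field. }
  rewrite K, Rpow_mult_distr, <- exp_mul_INR.
  replace (- tau / 24 * INR 4) with (- (tau / 6)) by (simpl (INR 4); field).
  rewrite exp_Ropp. pose proof (Rt_pos tau T0). pose proof (exp_pos (tau / 6)).
  field. repeat split; lra.
Qed.

Lemma Rt_scaled_derive t : 0 < t -> is_derive (fun t => Rt (PI * t)) t (PI * Rt' (PI * t)).
Proof.
  intros Ht. assert (PI0 := PI_RGT_0).
  apply (is_derive_comp Rt (fun t => PI * t)).
  - apply Rt_derive. nra.
  - auto_derive; auto. ring.
Qed.

(** Since [Rt'] is negative the substitution reverses orientation, which the minus sign of
    [pullback] compensates. *)
Lemma integral_pullback G a b v : smooth_on 0 x0 G -> 0 < a <= b ->
  is_RInt (source G) (Rt (PI * b)) (Rt (PI * a)) v -> is_RInt (mG_integrand G) a b v.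
Proof.
  intros HG Hab Hv. assert (PI0 := PI_RGT_0).
  assert (H : is_RInt (fun t => scal (PI * Rt' (PI * t)) (source G (Rt (PI * t)))) a b
     (RInt (source G) (Rt (PI * a)) (Rt (PI * b)))).
  { apply (is_RInt_comp (source G) (fun t => Rt (PI * t)) (fun t => PI * Rt' (PI * t))).
    - intros x. rewrite Rmin_left, Rmax_right by lra. intros Hx.
      assert (0 < PI * x) by nra.
      apply source_continuous; auto. split; [now apply Rt_pos|now apply Rt_lt_x0].
    - intros x. rewrite Rmin_left, Rmax_right by lra. intros Hx. split.
      + apply Rt_scaled_derive; lra.
      + apply (continuous_mult (fun _ => PI)); [apply continuous_const|].
        apply (continuous_comp (fun t => PI * t) Rt').
        * apply (continuous_mult (fun _ => PI)); [apply continuous_const|apply continuous_id].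
        * apply Rt'_continuous. nra. }
  rewrite (is_RInt_unique _ _ _ _ (is_RInt_swap _ _ _ _ Hv)) in H.
  apply is_RInt_opp in H. rewrite opp_opp in H.
  eapply is_RInt_ext; [|exact H].
  intros x. rewrite Rmin_left, Rmax_right by lra. intros Hx.
  rewrite pullback by lra. reflexivity.
Qed.

Theorem theorem1 (G : R -> R) (m : R -> R) (y A : R) :
  smooth_on 0 x0 G ->
  is_mG G m ->
  0 < y < x0 ->
  is_RInt_gen
    (fun t => 5 * (G t / (t * Rpower (/ t ^ 5 - 11 - t ^ 5) (1/6))))
    (at_right 0) (at_point y) A ->
  y = RR (exp (- PI * sqrt (m A))).
Proof.
  intros HG [_ Hm] Hy HA. assert (PI0 := PI_RGT_0).
  destruct (Rt_onto y Hy) as [tau [T0 Ty]].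
  set (T := tau / PI).
  assert (HT : 0 < T) by (apply Rdiv_lt_0_compat; lra).
  assert (PT : PI * T = tau) by (unfold T; field; lra).
  (* By the defining equivalence of m it suffices that the integral from T to infinity converges to
     A. *)
  assert (E : m A = T ^ 2).
  { apply Hm; [now apply pow_lt|]. rewrite sqrt_pow2 by lra.
    intros P HP. destruct (HA P HP) as [Q1 Q2 HQ1 HQ2 HQ].
    destruct HQ1 as [eps Heps].
    (* Beyond this bound Rt (PI b) <= e^{- PI b / 5} < eps, so the image of the upper end lies in
       the given right neighbourhood of 0; the maximum with T ensures T < b. *)
    apply (Filter_prod _ _ _ (fun a => a = T)
      (fun b => Rmax T (5 * (Rabs (ln eps) + 1) / PI) < b)).
    - reflexivity.
    - exists (Rmax T (5 * (Rabs (ln eps) + 1) / PI)). auto.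
    - intros a b -> Hb. cbn [fst snd].
      assert (Tb : T < b) by (eapply Rle_lt_trans; [apply Rmax_l|exact Hb]).
      assert (Eb : 5 * (Rabs (ln eps) + 1) < PI * b).
      { assert (H : 5 * (Rabs (ln eps) + 1) / PI < b) by (eapply Rle_lt_trans; [apply Rmax_r|exact Hb]).
        apply (Rmult_lt_compat_l PI) in H; auto.
        replace (PI * (5 * (Rabs (ln eps) + 1) / PI)) with (5 * (Rabs (ln eps) + 1)) in H by (field; lra).
        exact H. }
      assert (B0 : 0 < PI * b) by nra.
      assert (Q1b : Q1 (Rt (PI * b))).
      { pose proof (Rt_pos (PI * b) B0) as R0. apply Heps; auto.
        change (Rabs (Rt (PI * b) - 0) < eps). rewrite Rminus_0_r, Rabs_pos_eq by lra.
        eapply Rle_lt_trans; [apply Rt_le_exp; assumption|].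
        rewrite <- (exp_ln eps) by apply cond_pos. apply exp_increasing.
        pose proof (Rle_abs (- ln eps)) as L. rewrite Rabs_Ropp in L. lra. }
      destruct (HQ _ _ Q1b HQ2) as [v [Hv Pv]]. cbn [fst snd] in Hv.
      exists v. split; auto. apply integral_pullback; auto; [lra|].
      rewrite PT, Ty. exact Hv. }
  rewrite E, sqrt_pow2 by lra.
  replace (- PI * T) with (- tau) by (rewrite <- PT; ring).
  rewrite RR_exp by assumption. symmetry. exact Ty.
Qed.
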